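(* Let $(M,g,N)\to(\overline M,\overline g)$ be a closed rigged null hypersurface and $\alpha$ a nowhere vanishing smooth function on $M$ constant on each leaf of the screen distribution. Let $\mathcal X$ and $\mathcal Y$ be two orthogonal sections of the screen distribution, with $g(\mathcal X,\mathcal X)$ and $g(\mathcal Y,\mathcal Y)$ nowhere zero, and consider the planes $\Pi_0=\mathrm{span}(\xi,\mathcal X)$ and $\Pi=\mathrm{span}(\mathcal X,\mathcal Y)$. Then: (1) $$K_\alpha(\Pi_0)=\frac{1}{\alpha\, g(\mathcal X,\mathcal X)}\Big[\overline K_\xi(\Pi_0)+\Big(\tau(\xi)+\frac1{2\alpha}d\alpha(\xi)\Big)B(\mathcal X,\mathcal X)\Big],\qquad \overline K_\xi(\Pi_0):=\overline g(\overline R(\xi,\mathcal X)\xi,\mathcal X);$$ (2) $$K_\alpha(\Pi)=\overline K(\Pi)+\frac{B(\mathcal X,\mathcal X)B(\mathcal Y,\mathcal Y)-B(\mathcal X,\mathcal Y)^2}{\alpha\, g(\mathcal X,\mathcal X)g(\mathcal Y,\mathcal Y)}+\frac{2B(\mathcal X,\mathcal Y)C(\mathcal X,\mathcal Y)-B(\mathcal X,\mathcal X)C(\mathcal Y,\mathcal Y)-B(\mathcal Y,\mathcal Y)C(\mathcal X,\mathcal X)}{g(\mathcal X,\mathcal X)g(\mathcal Y,\mathcal Y)}.$$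
   Context: All manifolds are smooth and connected. $(\overline M,\overline g)$ is an $(n+1)$-dimensional semi-Riemannian manifold of index $q>0$ with Levi-Civita connection $\overline\nabla$ and curvature $\overline R$. $M\subset\overline M$ is an embedded hypersurface with inclusion $x$, and $g=x^\star\overline g$ is degenerate at every point ($M$ is a null hypersurface). A null rigging for $M$ is a vector field $N$ on an open subset of $\overline M$ containing $M$ such that, for every $p\in M$, $N_p\notin T_pM$ and $N_p$ is lightlike (nonzero and $\overline g(N_p,N_p)=0$); $(M,g,N)$ is then called a rigged null hypersurface. Put $\overline\eta=\overline g(N,\cdot)$ and $\eta=x^\star\overline\eta$. The screen distribution is $\mathcal S(TM)=\ker\eta\subset TM$. The rigged vector field $\xi$ is the unique section of $TM^\perp=\{X\in TM: g(X,Y)=0\ \forall Y\in TM\}$ with $\overline g(\xi,N)=1$. $P$ is the projection of $TM$ onto $\mathcal S(TM)$ along $\xi$. One has $T\overline M|_M=TM\oplus\mathrm{span}(N)$. The induced connection $\nabla$, the second fundamental forms $B$ (of $M$) and $C$ (of $\mathcal S(TM)$), the shape operators $A_N,\stackrel{\star}{A}_\xi$ (with values in $\mathcal S(TM)$) and the rotation $1$-form $\tau$ are defined, for $X,Y\in\Gamma(TM)$, by $$\overline\nabla_XY=\nabla_XY+B(X,Y)N,\quad \nabla_XPY=\stackrel{\star}{\nabla}_XPY+C(X,PY)\xi,\quad \overline\nabla_XN=-A_NX+\tau(X)N,\quad \nabla_X\xi=-\stackrel{\star}{A}_\xi X-\tau(X)\xi,$$ where $\stackrel{\star}{\nabla}_XPY\in\Gamma(\mathcal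 S(TM))$; thus $B(X,Y)=g(\stackrel{\star}{A}_\xi X,Y)$ and $C(X,PY)=g(A_NX,Y)$. $(M,g,N)$ is closed if $d\eta=0$ on $M$; then $\mathcal S(TM)$ is integrable. $g_\alpha=g+\alpha\,\eta\otimes\eta$ is the $\alpha$-associated (non-degenerate) metric on $M$, with curvature $R_\alpha$. Curvature convention: $R(X,Y)Z=\nabla_X\nabla_YZ-\nabla_Y\nabla_XZ-\nabla_{[X,Y]}Z$. Sectional curvature convention: for $\Pi=\mathrm{span}(X,Y)$, $$K_\alpha(\Pi)=\frac{g_\alpha(R_\alpha(X,Y)X,Y)}{g_\alpha(X,X)g_\alpha(Y,Y)-g_\alpha(X,Y)^2},$$ and $\overline K(\Pi)$ is defined by the same formula with $\overline g,\overline R$. *)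

(* Defs.v *)
From HB Require Import structures.
From mathcomp Require Import all_boot all_order all_algebra.
From mathcomp Require Import all_classical all_reals all_analysis.

Set Implicit Arguments.
Unset Strict Implicit.
Unset Printing Implicit Defensive.
Import Order.TTheory GRing.Theory Num.Theory.
Import numFieldNormedType.Exports.

Local Open Scope classical_set_scope.
Local Open Scope ring_scope.

(* Meant for U open. *)
Fixpoint Ck_on (R : realType) (V W : normedModType R) (k : nat) (U : set V)
    (f : V -> W) : Prop :=
  if k is k'.+1 then
    (forall z, U z -> differentiable f z) /\
    (forall v, Ck_on k' U (fun z => 'd f z v))
  else forall z, U z -> {for z, continuous f}.

Definition smooth_on (R : realType) (V W : normedModType R) (U : set V)
    (f : V -> W) : Prop :=
  forall k, Ck_on k U f.

(* The values of chart_map outside chart_dom, and of chart_inv outside the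
   image of chart_dom, are irrelevant. *)
Record chart (R : realType) (n : nat) (T : topologicalType) := Chart {
  chart_dom : set T;
  chart_map : T -> 'rV[R]_n;
  chart_inv : 'rV[R]_n -> T;
  chart_dom_open : open chart_dom;
  chart_im_open : open (chart_map @` chart_dom);
  chart_mapK : forall p, chart_dom p -> chart_inv (chart_map p) = p;
  chart_map_cont : forall p, chart_dom p -> {for p, continuous chart_map};
  chart_inv_cont : forall p, chart_dom p ->
    {for chart_map p, continuous chart_inv} }.

(* The smooth structure is the one generated by the atlas {chart_at p | p}.
   Every smooth structure arises in this way: choose a chart around each point. *)
Record manifold (R : realType) (n : nat) := Manifold {
  manifold_sort :> topologicalType;
  manifold_hausdorff : hausdorff_space manifold_sort;
  manifold_countable : @second_countable manifold_sort;
  manifold_connected : connected [set: manifold_sort];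
  chart_at : manifold_sort -> chart R n manifold_sort;
  chart_at_dom : forall p, chart_dom (chart_at p) p;
  chart_at_compat : forall p q,
    smooth_on
      (chart_map (chart_at p) @`
         (chart_dom (chart_at p) `&` chart_dom (chart_at q)))
      (chart_map (chart_at q) \o chart_inv (chart_at p)) }.

Definition coord (R : realType) (n : nat) (M : manifold R n) (p : M) :
  M -> 'rV[R]_n := chart_map (chart_at p).

Definition uncoord (R : realType) (n : nat) (M : manifold R n) (p : M) :
  'rV[R]_n -> M := chart_inv (chart_at p).

(* U may overflow the image of the chart: only a neighbourhood of p matters. *)
Definition smooth_at (R : realType) (n : nat) (M : manifold R n)
    (W : normedModType R) (p : M) (f : M -> W) : Prop :=
  exists2 U : set 'rV[R]_n,
    open_nbhs (coord p p) U & smooth_on U (f \o uncoord p).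

Definition smooth_map (R : realType) (m n : nat) (M : manifold R m)
    (N : manifold R n) (x : M -> N) : Prop :=
  continuous x /\ forall p, smooth_at p (coord (x p) \o x).

(* The tangent space at p is 'rV[R]_n: a tangent vector is given by its
   components in the chart chart_at p. A vector field along a map x : M -> N is
   thus a function M -> 'rV[R]_n whose value at p is read in chart_at (x p). *)

Definition vder (R : realType) (n : nat) (M : manifold R n) (p : M)
    (u : 'rV[R]_n) (f : M -> R) : R :=
  'd (f \o uncoord p) (coord p p) u.

(* The differential dx_p : T_pM -> T_{x(p)}N. *)
Definition tmap (R : realType) (m n : nat) (M : manifold R m)
    (N : manifold R n) (x : M -> N) (p : M) (u : 'rV[R]_m) : 'rV[R]_n :=
  'd (coord (x p) \o x \o uncoord p) (coord p p) u.

Definition vfield (R : realType) (n : nat) (M : manifold R n) : Type :=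
  M -> 'rV[R]_n.

(* A vector field Y along x is smooth near p iff its action turns smooth
   functions into smooth functions. *)
Definition vsmooth_along_at (R : realType) (m n : nat) (M : manifold R m)
    (N : manifold R n) (x : M -> N) (p : M) (Y : M -> 'rV[R]_n) : Prop :=
  forall f : N -> R, smooth_at (x p) f ->
    smooth_at p (fun a => vder (x a) (Y a) f).

Definition vsmooth_at (R : realType) (n : nat) (M : manifold R n) (p : M)
    (X : vfield M) : Prop := vsmooth_along_at idfun p X.

Definition vsmooth (R : realType) (n : nat) (M : manifold R n)
    (X : vfield M) : Prop := forall p, vsmooth_at p X.

Definition lie (R : realType) (n : nat) (M : manifold R n)
    (X Y : vfield M) : vfield M :=
  fun p => xget 0 [set w : 'rV[R]_n | forall f : M -> R, smooth_at p f ->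
    vder p w f = vder p (X p) (fun a => vder a (Y a) f)
                 - vder p (Y p) (fun a => vder a (X a) f)].

(* Near p, the field whose components in chart_at p are constantly u. *)
Definition const_field (R : realType) (n : nat) (M : manifold R n) (p : M)
    (u : 'rV[R]_n) : vfield M :=
  fun a => 'd (coord a \o uncoord p) (coord p a) u.

Record immersion (R : realType) (m n : nat) (M : manifold R m)
    (N : manifold R n) (x : M -> N) : Prop := Immersion {
  imm_smooth : smooth_map x;
  imm_inj : forall p, injective (tmap x p) }.

Record embedding (R : realType) (m n : nat) (M : manifold R m)
    (N : manifold R n) (x : M -> N) : Prop := Embedding {
  emb_imm : immersion x;
  emb_inj : injective x;
  emb_homeo : forall A : set M, open A ->
    exists2 B : set N, open B & A = x @^-1` B }.

Definition distribution (R : realType) (n : nat) (M : manifold R n) : Type :=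
  M -> set 'rV[R]_n.

(* A connected integral manifold of S, as an injectively immersed manifold. *)
Record integral_manifold (R : realType) (n : nat) (M : manifold R n)
    (S : distribution M) (k : nat) (L : manifold R k) (j : L -> M) : Prop :=
  IntegralManifold {
    intm_imm : immersion j;
    intm_inj : injective j;
    intm_tan : forall l, range (tmap j l) = S (j l) }.

(* The leaf through p: the union of all connected integral manifolds
   containing p. *)
Definition leaf (R : realType) (n : nat) (M : manifold R n)
    (S : distribution M) (p : M) : set M :=
  [set a | exists (k : nat) (L : manifold R k) (j : L -> M),
     [/\ integral_manifold S j, range j p & range j a]].

Definition constant_on_leaves (R : realType) (n : nat) (M : manifold R n)
    (S : distribution M) (f : M -> R) : Prop :=
  forall p a b, leaf S p a -> leaf S p b -> f a = f b.

Definition form1 (R : realType) (n : nat) (M : manifold R n) : Type :=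
  M -> 'rV[R]_n -> R.

Definition form2 (R : realType) (n : nat) (M : manifold R n) : Type :=
  M -> 'rV[R]_n -> 'rV[R]_n -> R.

Definition dform1 (R : realType) (n : nat) (M : manifold R n)
    (eta : form1 M) (X Y : vfield M) (p : M) : R :=
  vder p (X p) (fun a => eta a (Y a)) - vder p (Y p) (fun a => eta a (X a))
  - eta p (lie X Y p).

Definition closed_form1 (R : realType) (n : nat) (M : manifold R n)
    (eta : form1 M) : Prop :=
  forall p X Y, vsmooth_at p X -> vsmooth_at p Y -> dform1 eta X Y p = 0.

(* The index of b is the largest dimension of a subspace (here, the row space
   of W) on which b is negative definite. *)
Definition neg_definite_on (R : realType) (n : nat)
    (b : 'rV[R]_n -> 'rV[R]_n -> R) (W : 'M[R]_n) : Prop :=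
  forall u : 'rV[R]_n, (u <= W)%MS -> u != 0 -> b u u < 0.

Definition has_index (R : realType) (n : nat)
    (b : 'rV[R]_n -> 'rV[R]_n -> R) (q : nat) : Prop :=
  (exists2 W : 'M[R]_n, neg_definite_on b W & \rank W = q) /\
  (forall W : 'M[R]_n, neg_definite_on b W -> (\rank W <= q)%N).

Definition degenerate (R : realType) (n : nat)
    (b : 'rV[R]_n -> 'rV[R]_n -> R) : Prop :=
  exists2 u : 'rV[R]_n, u != 0 & forall v, b u v = 0.

Record semi_riemannian (R : realType) (n : nat) (M : manifold R n)
    (g : form2 M) (q : nat) : Prop := SemiRiemannian {
  sr_linear : forall p u, scalar (g p u);
  sr_sym : forall p u v, g p u v = g p v u;
  sr_smooth : forall p X Y, vsmooth_at p X -> vsmooth_at p Y ->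
    smooth_at p (fun a => g a (X a) (Y a));
  sr_nondeg : forall p, ~ degenerate (g p);
  sr_index : forall p, has_index (g p) q }.

Definition pull_metric (R : realType) (m n : nat) (M : manifold R m)
    (N : manifold R n) (x : M -> N) (g : form2 N) : form2 M :=
  fun p u v => g (x p) (tmap x p u) (tmap x p v).

(* D p u Y is the covariant derivative of Y in the direction of u \in T_pM. It
   acts on the fields Y along x that are defined everywhere but smooth only
   near p, i.e. on germs of sections of x^*TN: a linear connection acts on local
   sections. The values at other Y are irrelevant. *)
Definition cov_along (R : realType) (m n : nat) (M : manifold R m)
    (N : manifold R n) : Type :=
  M -> 'rV[R]_m -> (M -> 'rV[R]_n) -> 'rV[R]_n.

Record connection_along (R : realType) (m n : nat) (M : manifold R m)
    (N : manifold R n) (x : M -> N) (D : cov_along M N) : Prop :=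
  ConnectionAlong {
    conn_linear : forall p Y, vsmooth_along_at x p Y -> linear (D p ^~ Y);
    conn_add : forall p u Y Z,
      vsmooth_along_at x p Y -> vsmooth_along_at x p Z ->
      D p u (fun a => Y a + Z a) = D p u Y + D p u Z;
    conn_leibniz : forall p u (f : M -> R) Y,
      smooth_at p f -> vsmooth_along_at x p Y ->
      D p u (fun a => f a *: Y a) = vder p u f *: Y p + f p *: D p u Y;
    conn_smooth : forall p X Y,
      vsmooth_at p X -> vsmooth_along_at x p Y ->
      vsmooth_along_at x p (fun a => D a (X a) Y) }.

Definition cov (R : realType) (n : nat) (M : manifold R n) : Type :=
  cov_along M M.

Record levi_civita (R : realType) (n : nat) (M : manifold R n)
    (g : form2 M) (D : cov M) : Prop := LeviCivita {
  lc_conn : connection_along idfun D;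
  lc_torsion_free : forall p X Y, vsmooth_at p X -> vsmooth_at p Y ->
    D p (X p) Y - D p (Y p) X = lie X Y p;
  lc_metric : forall p u Y Z, vsmooth_at p Y -> vsmooth_at p Z ->
    vder p u (fun a => g a (Y a) (Z a)) =
      g p (D p u Y) (Z p) + g p (Y p) (D p u Z) }.

(* Dx is the (unique) connection on x^*TN induced by the connection D of N, that
   is, the one which gives a meaning to D_X Y for X tangent to M and Y a field
   of N defined along M only. *)
Record pullback_connection (R : realType) (m n : nat) (M : manifold R m)
    (N : manifold R n) (x : M -> N) (D : cov N) (Dx : cov_along M N) : Prop :=
  PullbackConnection {
    pull_conn : connection_along x Dx;
    pull_compat : forall p u (Y : vfield N), vsmooth_at (x p) Y ->
      Dx p u (Y \o x) = D (x p) (tmap x p u) Y }.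

Definition curvature (R : realType) (n : nat) (M : manifold R n) (D : cov M)
    (X Y Z : vfield M) : vfield M :=
  fun p => D p (X p) (fun a => D a (Y a) Z) - D p (Y p) (fun a => D a (X a) Z)
           - D p (lie X Y p) Z.

(* The value of the curvature tensor at p on tangent vectors; tensoriality makes
   the choice of the local extensions of u, v, w immaterial. *)
Definition curv_tensor (R : realType) (n : nat) (M : manifold R n) (D : cov M)
    (p : M) (u v w : 'rV[R]_n) : 'rV[R]_n :=
  curvature D (const_field p u) (const_field p v) (const_field p w) p.

(* Note the sign convention g(R(u,v)u,v). *)
Definition sectional (R : realType) (n : nat) (M : manifold R n)
    (g : form2 M) (D : cov M) (p : M) (u v : 'rV[R]_n) : R :=
  g p (curv_tensor D p u v u) v / (g p u u * g p v v - g p u v ^+ 2).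

Record null_hypersurface (R : realType) (n : nat) (M : manifold R n)
    (Mb : manifold R n.+1) (gb : form2 Mb) (x : M -> Mb) : Prop :=
  NullHypersurface {
    nh_emb : embedding x;
    nh_null : forall p, degenerate (pull_metric x gb p) }.

(* The values of N outside U are irrelevant. *)
Record null_rigging (R : realType) (n : nat) (M : manifold R n)
    (Mb : manifold R n.+1) (gb : form2 Mb) (x : M -> Mb)
    (U : set Mb) (N : vfield Mb) : Prop := NullRigging {
  rig_open : open U;
  rig_sub : range x `<=` U;
  rig_smooth : forall b, U b -> vsmooth_at b N;
  rig_transverse : forall p, ~ range (tmap x p) (N (x p));
  rig_neq0 : forall p, N (x p) != 0;
  rig_null : forall p, gb (x p) (N (x p)) (N (x p)) = 0 }.

Definition rig_form (R : realType) (n : nat) (M : manifold R n)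
    (Mb : manifold R n.+1) (gb : form2 Mb) (x : M -> Mb) (N : vfield Mb) :
  form1 M := fun p u => gb (x p) (N (x p)) (tmap x p u).

Definition screen (R : realType) (n : nat) (M : manifold R n)
    (eta : form1 M) : distribution M := fun p => [set u | eta p u = 0].

Record rigged_field (R : realType) (n : nat) (M : manifold R n)
    (Mb : manifold R n.+1) (gb : form2 Mb) (x : M -> Mb) (N : vfield Mb)
    (xi : vfield M) : Prop := RiggedField {
  rf_smooth : vsmooth xi;
  rf_radical : forall p v, pull_metric x gb p (xi p) v = 0;
  rf_norm : forall p, gb (x p) (tmap x p (xi p)) (N (x p)) = 1 }.

(* The projection of TM onto ker eta along xi, given that eta(xi) = 1. *)
Definition screen_proj (R : realType) (n : nat) (M : manifold R n)
    (eta : form1 M) (xi : vfield M) (p : M) (u : 'rV[R]_n) : 'rV[R]_n :=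
  u - eta p u *: xi p.

(* The Gauss and Weingarten formulas, which determine the induced objects. *)
Record gauss_weingarten (R : realType) (n : nat) (M : manifold R n)
    (Mb : manifold R n.+1) (x : M -> Mb) (Dx : cov_along M Mb) (N : vfield Mb)
    (eta : form1 M) (xi : vfield M)
    (nabla nablaS : cov M) (B C : form2 M) (AN Axi : M -> 'rV[R]_n -> 'rV[R]_n)
    (tau : form1 M) : Prop := GaussWeingarten {
  gw_nabla_smooth : forall p X Y, vsmooth_at p X -> vsmooth_at p Y ->
    vsmooth_at p (fun a => nabla a (X a) Y);
  gw_nablaS_screen : forall p u Y, vsmooth_at p Y ->
    screen eta p (nablaS p u (fun a => screen_proj eta xi a (Y a)));
  gw_AN_screen : forall p u, screen eta p (AN p u);
  gw_Axi_screen : forall p u, screen eta p (Axi p u);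
  gw_gauss : forall p u Y, vsmooth_at p Y ->
    Dx p u (fun a => tmap x a (Y a)) =
      tmap x p (nabla p u Y) + B p u (Y p) *: N (x p);
  gw_gauss_screen : forall p u Y, vsmooth_at p Y ->
    nabla p u (fun a => screen_proj eta xi a (Y a)) =
      nablaS p u (fun a => screen_proj eta xi a (Y a))
      + C p u (screen_proj eta xi p (Y p)) *: xi p;
  gw_weingarten : forall p u,
    Dx p u (N \o x) = - tmap x p (AN p u) + tau p u *: N (x p);
  gw_weingarten_screen : forall p u,
    nabla p u xi = - Axi p u - tau p u *: xi p }.

Definition assoc_metric (R : realType) (n : nat) (M : manifold R n)
    (g : form2 M) (eta : form1 M) (alpha : M -> R) : form2 M :=
  fun p u v => g p u v + alpha p * (eta p u * eta p v).

(* Main.v *)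
Require Import Defs.
From HB Require Import structures.
From mathcomp Require Import all_boot all_order all_algebra.
From mathcomp Require Import all_classical all_reals all_analysis.
From mathcomp Require Import ring lra.
(* [vector] shadows [Defs.coord]. *)
Import Defs.

Set Implicit Arguments.
Unset Strict Implicit.
Unset Printing Implicit Defensive.
Import Order.TTheory GRing.Theory Num.Theory.
Import numFieldNormedType.Exports.

Local Open Scope classical_set_scope.
Local Open Scope ring_scope.

(* All the curvature terms come from two difference tensors. The Gauss formula
   expresses the induced connection [nabla] through the connection pulled back
   from the ambient manifold, whose curvature is the pulled back ambient
   curvature. On the other side, since [eta] is closed, [nabla eta] is symmetric,
   and since [d alpha] is a multiple of [eta], the Koszul formula shows that the
   Levi-Civita connection of [g_alpha] is [nabla + h xi] with
     [h = (B + alpha nabla eta + (1/2) xi(alpha) eta * eta) / alpha].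
   Paired with a screen vector, the derivatives of [B] and [h] drop out, so that
     [g_alpha(R_alpha(u,v)w, r) = gb(Rb(u,v)w, r) + B(v,w) g(A_N u, r)
        - B(u,w) g(A_N v, r) - h(v,w) B(u,r) + h(u,w) B(v,r)].
   That [d alpha] vanishes on the screen requires enough leaves: near a point,
   [eta] has a primitive by the Poincare lemma, and its level sets, which are
   graphs by the implicit function theorem, are integral manifolds. *)

(** A tangent vector at [a] is recorded in the chart chosen at [a], and this choice may jump from
    point to point, so the components of a vector field are not smooth functions as they stand.
    Every differential computation is therefore made in the coordinate frame of one fixed chart: the
    coefficients there are smooth and the brackets of the frame vanish. [B], [C], [AN] and [tau] are
    known only through the values that the Gauss and Weingarten formulas prescribe. Their symmetry,
    and smooth expressions standing for them, are recovered by pairing ambient derivatives with [xi]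
    and [N]. The derivative of [B] drops out because it multiplies [N], whose product with a screen
    vector is [eta = 0]; that of [h] because it multiplies [xi], which is orthogonal to all of TM.
    Closedness of [eta] enters twice: it makes [nabla eta] symmetric, so that the Koszul sum
    collapses and [C] is symmetric on the screen, and it provides the primitive whose level sets are
    the leaves. In the Koszul sum the three terms in [d alpha] combine as 1 + 1 - 1 once [d alpha]
    is a multiple of [eta], whence the factor 1/2 in [h]. *)

(** * Differentials through epsilon estimates, and their locality *)

Section epsilon_differential.
Variables (R : numFieldType) (V W : normedModType R).
Implicit Types f g : V -> W.

Lemma diff_epsP f z : differentiable f z -> forall e, 0 < e ->
  \forall h \near (0 : V), `|f (h + z) - f z - 'd f z h| <= e * `|h|.
Proof.
move=> /diff_locally/eqaddoP fz e e0; move: (fz _ e0).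
by apply: filterS => h /=; rewrite -[(_ - _ : _ -> _) h]/(_ - _) /= opprD addrA.
Qed.

Lemma eps_diff f z (df : {linear V -> W}) : continuous df ->
  (forall e, 0 < e ->
    \forall h \near (0 : V), `|f (h + z) - f z - df h| <= e * `|h|) ->
  differentiable f z /\ 'd f z = df :> (V -> W).
Proof.
move=> cdf fz.
have Hf : f \o shift z = cst (f z) + df +o_ 0 id.
  apply/eqaddoP => e e0; move: (fz _ e0).
  by apply: filterS => h /=; rewrite -[(_ - _ : _ -> _) h]/(_ - _) /= opprD addrA.
have E := diff_unique cdf Hf.
by split => //; apply/diff_locallyP; rewrite E.
Qed.

Lemma near_eq_is_diff f g z : (\forall y \near z, f y = g y) ->
  differentiable f z -> differentiable g z /\ 'd g z = 'd f z :> (V -> W).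
Proof.
move=> fg dfz; apply: eps_diff; first exact: diff_continuous.
move=> e e0.
have fg' : \forall h \near (0 : V), f (h + z) = g (h + z).
  by move: fg; rewrite (near_shift 0) subr0.
have := diff_epsP dfz e0.
by apply: filterS2 fg' => h ->; rewrite (nbhs_singleton fg).
Qed.

Lemma near_eq_differentiable f g z : (\forall y \near z, f y = g y) ->
  differentiable f z -> differentiable g z.
Proof. by move=> fg /(near_eq_is_diff fg)[]. Qed.

(** Differentiability is not assumed. The differential is a [get] over candidate linear maps; where
    the functions are not differentiable this set is empty for both, and both receive the same
    default value. *)
Lemma near_eq_diff f g z : (\forall y \near z, f y = g y) ->
  'd f z = 'd g z :> (V -> W).
Proof.
move=> fg; have gf : \forall y \near z, g y = f y by apply: filterS fg.
have [df|ndf] := pselect (differentiable f z).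
  by have [_ ->] := near_eq_is_diff fg df.
have [dg|ndg] := pselect (differentiable g z).
  by have [_ ->] := near_eq_is_diff gf dg.
suff noP k : ~ differentiable k z -> [set df : {linear V -> W} |
    continuous df /\ forall y, k y = k (lim (nbhs z)) + df (y - lim (nbhs z))
                  +o_(y \near z) (y - lim (nbhs z))] = set0.
  rewrite /diff; congr (GRing.Linear.sort (get _)).
  by rewrite -[LHS]/[set df | _] -[RHS]/[set df | _] !noP.
move=> ndk; rewrite -subset0 => df Pdf; apply: ndk; apply/diffP.
by apply: (@getPex _ (fun df : {linear V -> W} => continuous df /\
    forall y, k y = k (lim (nbhs z)) + df (y - lim (nbhs z))
                  +o_(y \near z) (y - lim (nbhs z)))); exists df.
Qed.

End epsilon_differential.

(** * Closure properties of functions of class C^k on an open set *)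

Section smooth_functions.
Variable R : realType.
Implicit Types V W : normedModType R.

Lemma Ck_eq V W k (U : set V) (f g : V -> W) : open U ->
  (forall z, U z -> f z = g z) -> Ck_on k U f -> Ck_on k U g.
Proof.
elim: k f g => [|k IH] f g oU fg /=.
  move=> cf z Uz; change (g @ z --> g z); rewrite -(fg _ Uz).
  apply: cvg_trans (cf z Uz); apply: near_eq_cvg.
  by near=> y; rewrite fg//; near: y; exact: open_nbhs_nbhs.
have near_fg z : U z -> \forall y \near z, f y = g y.
  by move=> Uz; near=> y; rewrite fg//; near: y; exact: open_nbhs_nbhs.
move=> [df cf]; split=> [z Uz|v].
  exact: near_eq_differentiable (near_fg z Uz) (df z Uz).
apply: (IH _ _ oU _ (cf v)) => z Uz; exact: (congr1 (fun h => h v) (near_eq_diff (near_fg z Uz))).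
Unshelve. all: by end_near. Qed.

Lemma Ck_sub V W k (U U' : set V) (f : V -> W) : U' `<=` U ->
  Ck_on k U f -> Ck_on k U' f.
Proof.
move=> sU; elim: k f => [|k IH] f /=; first by move=> + z /sU; apply.
by move=> [df cf]; split=> [z /sU /df//|v]; exact: IH.
Qed.

Lemma Ck_pred V W k (U : set V) (f : V -> W) : Ck_on k.+1 U f -> Ck_on k U f.
Proof.
elim: k f => [|k IH] f.
  by move=> [df _] z /df; exact: differentiable_continuous.
by move=> [df cf]; split=> // v; exact: IH.
Qed.

Lemma Ck_local V W k (U : set V) (f : V -> W) :
  (forall z, U z -> exists2 U', open_nbhs z U' & Ck_on k U' f) -> Ck_on k U f.
Proof.
elim: k f => [|k IH] f H /=.
  by move=> z /H[U' [_ U'z]]; apply.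
split=> [z /H[U' [_ U'z] [df _]]|v]; first exact: df.
by apply: IH => z /H[U' oU' [_ cf]]; exists U'; last exact: cf.
Qed.

Lemma Ck_cst V W k (U : set V) (a : W) : Ck_on k U (cst a).
Proof.
elim: k a => [|k IH] a /=; first by move=> z _; exact: cst_continuous.
split=> [z _|v]; first exact: differentiable_cst.
by rewrite [X in Ck_on _ _ X](_ : _ = cst 0)//; apply/funext => z; rewrite diff_cst.
Qed.

Lemma diffDE V W (f g : V -> W) z v : differentiable f z ->
  differentiable g z -> 'd (fun y => f y + g y) z v = 'd f z v + 'd g z v.
Proof. by move=> df dg; have /(congr1 (fun h => h v)) := diffD df dg. Qed.

Lemma diffME V (f g : V -> R) z v : differentiable f z ->
  differentiable g z ->
  'd (fun y => f y * g y) z v = f z * 'd g z v + g z * 'd f z v.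
Proof. by move=> df dg; have /(congr1 (fun h => h v)) := diffM df dg. Qed.

Lemma diffVE V (f : V -> R) z v : differentiable f z -> f z != 0 ->
  'd (fun y => (f y)^-1) z v = - ((f z)^-1 * (f z)^-1 * 'd f z v).
Proof.
move=> df f0; have /(congr1 (fun h => h v)) -> := diffV df f0.
by rewrite -[LHS]/(- (f z ^+ 2)^-1 * 'd f z v) expr2 invfM mulNr.
Qed.

Lemma Ck_add V W k (U : set V) (f g : V -> W) : open U ->
  Ck_on k U f -> Ck_on k U g -> Ck_on k U (fun z => f z + g z).
Proof.
move=> oU; elim: k f g => [|k IH] f g /=.
  by move=> cf cg z Uz; apply: cvgD; [exact: cf|exact: cg].
move=> [df cf] [dg cg]; split=> [z Uz|v].
  by apply: differentiableD; [exact: df|exact: dg].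
apply: (Ck_eq oU) (IH _ _ (cf v) (cg v)) => z Uz.
rewrite diffDE; [by []|exact: df|exact: dg].
Qed.

Lemma Ck_sum V W k (I : Type) (s : seq I) (U : set V) (f : I -> V -> W) :
  open U -> (forall i, Ck_on k U (f i)) ->
  Ck_on k U (fun z => \sum_(i <- s) f i z).
Proof.
move=> oU fk; elim: s => [|i s IH].
  by under eq_fun do rewrite big_nil; exact: Ck_cst.
by under eq_fun do rewrite big_cons; exact: Ck_add.
Qed.

Lemma Ck_mul V k (U : set V) (f g : V -> R) : open U ->
  Ck_on k U f -> Ck_on k U g -> Ck_on k U (fun z => f z * g z).
Proof.
move=> oU; elim: k f g => [|k IH] f g.
  by move=> /= cf cg z Uz; apply: cvgM; [exact: cf|exact: cg].
move=> Cf Cg; have [df cf] := Cf; have [dg cg] := Cg; split=> [z Uz|v].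
  by apply: differentiableM; [exact: df|exact: dg].
have H := Ck_add oU (IH _ _ (Ck_pred Cf) (cg v)) (IH _ _ (Ck_pred Cg) (cf v)).
by apply: (Ck_eq oU) H => z Uz; rewrite diffME//; [exact: df|exact: dg].
Qed.

Lemma Ck_lin V W W' k (U : set V) (L : {linear W -> W'}) (f : V -> W) :
  continuous L -> open U -> Ck_on k U f -> Ck_on k U (L \o f).
Proof.
move=> cL oU; elim: k f => [|k IH] f.
  by move=> cf z Uz; apply: continuous_comp; [exact: cf|exact: cL].
move=> [df cf]; split=> [z Uz|v].
  by apply: differentiable_comp; [exact: df|exact: linear_differentiable].
apply: (Ck_eq oU) (IH _ (cf v)) => z Uz.
rewrite (diff_comp (df z Uz)); first by rewrite diff_lin.
exact: linear_differentiable.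
Qed.

Lemma Ck_opp V W k (U : set V) (f : V -> W) : open U ->
  Ck_on k U f -> Ck_on k U (fun z => - f z).
Proof.
move=> oU Cf; apply: (@Ck_lin V W W k U (-%R : {linear W -> W})) Cf => //.
exact: opp_continuous.
Qed.

Lemma Ck_inv V k (U : set V) (f : V -> R) : open U ->
  (forall z, U z -> f z != 0) -> Ck_on k U f -> Ck_on k U (fun z => (f z)^-1).
Proof.
move=> oU f0; elim: k => [|k IH].
  by move=> cf z Uz; apply: cvgV; [exact: f0|exact: cf].
move=> Cf; have [df cf] := Cf; split=> [z Uz|v].
  by apply: differentiableV; [exact: df|exact: f0].
have C1 := IH (Ck_pred Cf).
have := Ck_opp oU (Ck_mul oU (Ck_mul oU C1 C1) (cf v)).
apply: (Ck_eq oU) => z Uz; by rewrite diffVE//; [exact: df|exact: f0].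
Qed.

(** A component seen as a linear map into [R^o], so that the lemmas on linear maps apply to it. *)
Definition rcoord n (i : 'I_n) (u : 'rV[R]_n) : R := u 0 i.

Lemma rcoord_is_linear n (i : 'I_n) : linear (@rcoord n i : 'rV[R]_n -> R^o).
Proof. by move=> a u v; rewrite /rcoord !mxE. Qed.

HB.instance Definition _ n (i : 'I_n) :=
  GRing.isLinear.Build R 'rV[R]_n R^o _ (@rcoord n i) (@rcoord_is_linear n i).

Lemma rcoord_continuous n (i : 'I_n) : continuous (@rcoord n i).
Proof. exact: coord_continuous. Qed.

Lemma diff_row V n (f : V -> 'rV[R]_n) z v i :
  differentiable f z -> 'd f z v 0 i = 'd (fun y => f y 0 i) z v.
Proof.
move=> df; rewrite (_ : (fun y => f y 0 i) = @rcoord n i \o f)//.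
rewrite (diff_comp df); last exact: (linear_differentiable _ (@rcoord_continuous n i)).
by rewrite diff_lin//; exact: rcoord_continuous.
Qed.

Lemma differentiable_row V n (f : V -> 'rV[R]_n) z :
  (forall i, differentiable (fun y => f y 0 i) z) -> differentiable f z.
Proof.
move=> df; rewrite (_ : f = \sum_i (fun y => f y 0 i *: (delta_mx 0 i : 'rV_n))).
  by apply: differentiable_sum => i; exact: differentiableZl.
by apply/funext => y; rewrite fct_sumE [LHS]row_sum_delta.
Qed.

Lemma Ck_rowP V n k (U : set V) (f : V -> 'rV[R]_n) : open U ->
  Ck_on k U f <-> forall i, Ck_on k U (fun y => f y 0 i).
Proof.
move=> oU; split=> [Cf i|].
  exact: (@Ck_lin _ _ _ _ _ (@rcoord n i) _ (@rcoord_continuous n i)).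
elim: k f => [|k IH] f Cf /=.
  move=> z Uz; rewrite (_ : f = fun y => \sum_i f y 0 i *: (delta_mx 0 i : 'rV_n)).
    apply: (@cvg_big _ _ +%R) => [|i _]; first exact: add_continuous.
    by apply: cvgZl; exact: Cf.
  by apply/funext => y; rewrite [LHS]row_sum_delta.
have df z : U z -> differentiable f z.
  by move=> Uz; apply: differentiable_row => i; have [+ _] := Cf i; apply.
split=> // v; apply: IH => i; have [_ /(_ v)] := Cf i.
by apply: (Ck_eq oU) => z Uz; rewrite diff_row//; exact: df.
Qed.

(** [Ck_on] differentiates in constant directions only, whereas the chain rule evaluates ['d g] in
    the moving direction ['d f z v]. Expanding that direction in the standard basis leaves constant
    directions and scalar coefficients, which is the form that the induction of [Ck_comp] can
    use. *)
Lemma diff_comp_row V n W (g : 'rV[R]_n -> W) (f : V -> 'rV[R]_n) z v :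
  differentiable f z -> differentiable g (f z) ->
  'd (g \o f) z v = \sum_i 'd (fun y => f y 0 i) z v *: 'd g (f z) (delta_mx 0 i).
Proof.
move=> df dg; rewrite (diff_comp df dg) /= [X in 'd g _ X]row_sum_delta linear_sum.
by apply: eq_bigr => i _; rewrite linearZ /= diff_row.
Qed.

Lemma Ck_comp V n k (U : set V) (U' : set 'rV[R]_n) (g : 'rV[R]_n -> R)
    (f : V -> 'rV[R]_n) : open U -> (forall z, U z -> U' (f z)) ->
  Ck_on k U f -> Ck_on k U' g -> Ck_on k U (g \o f).
Proof.
move=> oU UU'; elim: k g => [|k IH] g.
  by move=> cf cg z Uz; apply: continuous_comp; [exact: cf|apply: cg; exact: UU'].
move=> Cf [dg cg]; have [df cf] := Cf; split=> [z Uz|v].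
  by apply: differentiable_comp; [exact: df|apply: dg; exact: UU'].
have C : Ck_on k U (fun z => \sum_i 'd f z v 0 i * 'd g (f z) (delta_mx 0 i)).
  apply: (Ck_sum _ oU) => i; apply: Ck_mul => //.
    have /(Ck_rowP _ _ oU) := cf v; exact.
  exact: (IH (fun y => 'd g y (delta_mx 0 i)) (Ck_pred Cf) (cg _)).
apply: (Ck_eq oU) C => z Uz; rewrite diff_comp_row; [|exact: df|by apply: dg; exact: UU'].
by apply: eq_bigr => i _; rewrite diff_row//; exact: df.
Qed.

End smooth_functions.

(** * Smoothness near a point, and the symmetry of second derivatives *)

Section smooth_near.
Variable R : realType.
Implicit Types V W : normedModType R.

Lemma diffBE V W (f g : V -> W) z v : differentiable f z ->
  differentiable g z -> 'd (fun y => f y - g y) z v = 'd f z v - 'd g z v.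
Proof. by move=> df dg; have /(congr1 (fun h => h v)) := diffB df dg. Qed.

Lemma diff_compE (U V W : normedModType R) (f : U -> V) (g : V -> W) z v :
  differentiable f z -> differentiable g (f z) ->
  'd (fun y => g (f y)) z v = 'd g (f z) ('d f z v).
Proof. by move=> df dg; have /(congr1 (fun h => h v)) := diff_comp df dg. Qed.

Lemma is_diff_shift V W (f : V -> W) (a : W) (z : V) (df : V -> W) :
  is_diff z f df -> is_diff z (fun y => f y + a) df.
Proof. by move=> Df; rewrite -[X in is_diff _ _ X]addr0; exact: is_diffD. Qed.

(** [smooth_at p f] unfolds to this notion for [f \o uncoord p] at [coord p p], so the lemmas below
    pass to manifolds by conversion. *)
Definition smooth_near V W (z : V) (f : V -> W) : Prop :=
  exists2 U : set V, open_nbhs z U & smooth_on U f.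

Lemma smooth_near_eq V W (z : V) (f g : V -> W) :
  (\forall y \near z, f y = g y) -> smooth_near z f -> smooth_near z g.
Proof.
move=> fg [U [oU Uz] Cf].
have oUI : open (U `&` [set y | f y = g y]^°) by apply: openI => //; exact: open_interior.
exists (U `&` [set y | f y = g y]^°); first by split.
move=> k; apply: (@Ck_eq _ _ _ _ _ f) => //.
  by move=> y [_ /interior_subset].
by apply: Ck_sub (Cf k) => y [].
Qed.

Lemma smooth_near_open V W (z : V) (f : V -> W) :
  smooth_near z f -> \forall y \near z, smooth_near y f.
Proof.
by move=> [U [oU Uz] Cf]; near=> y; exists U => //; split=> //; near: y; exact: open_nbhs_nbhs.
Unshelve. all: by end_near. Qed.

Lemma smooth_near_differentiable V W (z : V) (f : V -> W) :
  smooth_near z f -> differentiable f z.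
Proof. by move=> [U [_ Uz] Cf]; have [+ _] := Cf 1%N; apply. Qed.

Lemma smooth_near_diff V W (z : V) (f : V -> W) v :
  smooth_near z f -> smooth_near z (fun y => 'd f y v).
Proof. by move=> [U oU Cf]; exists U => // k; have [_] := Cf k.+1; apply. Qed.

Lemma smooth_near_cst V W (z : V) (a : W) : smooth_near z (cst a).
Proof.
by exists setT; [split=> //; exact: openT|move=> k; exact: Ck_cst].
Qed.

Lemma open_nbhsI2 V (z : V) (U U' : set V) :
  open_nbhs z U -> open_nbhs z U' -> open_nbhs z (U `&` U').
Proof. by move=> [? ?] [? ?]; split; [exact: openI|split]. Qed.

Lemma smooth_near2 V W1 W2 W (z : V) (f : V -> W1) (g : V -> W2) (h : V -> W) :
  (forall U k, open U -> Ck_on k U f -> Ck_on k U g -> Ck_on k U h) ->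
  smooth_near z f -> smooth_near z g -> smooth_near z h.
Proof.
move=> H [U oU Cf] [U' oU' Cg]; exists (U `&` U'); first exact: open_nbhsI2.
move=> k; apply: H; first by apply: openI; [exact: oU.1|exact: oU'.1].
  by apply: Ck_sub (Cf k) => ? [].
by apply: Ck_sub (Cg k) => ? [].
Qed.

Lemma smooth_near1 V W1 W (z : V) (f : V -> W1) (h : V -> W) :
  (forall U k, open U -> Ck_on k U f -> Ck_on k U h) ->
  smooth_near z f -> smooth_near z h.
Proof. by move=> H [U oU Cf]; exists U => // k; apply: H => //; exact: oU.1. Qed.

Lemma smooth_near_add V W (z : V) (f g : V -> W) :
  smooth_near z f -> smooth_near z g -> smooth_near z (fun y => f y + g y).
Proof. by apply: smooth_near2 => U k; exact: Ck_add. Qed.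

Lemma smooth_near_mul V (z : V) (f g : V -> R) :
  smooth_near z f -> smooth_near z g -> smooth_near z (fun y => f y * g y).
Proof. by apply: smooth_near2 => U k; exact: Ck_mul. Qed.

Lemma smooth_near_opp V W (z : V) (f : V -> W) :
  smooth_near z f -> smooth_near z (fun y => - f y).
Proof. by apply: smooth_near1 => U k; exact: Ck_opp. Qed.

Lemma smooth_near_sum V W (I : Type) (s : seq I) (z : V) (f : I -> V -> W) :
  (forall i, smooth_near z (f i)) ->
  smooth_near z (fun y => \sum_(i <- s) f i y).
Proof.
move=> Cf; elim: s => [|i s IH].
  by under eq_fun do rewrite big_nil; exact: smooth_near_cst.
by under eq_fun do rewrite big_cons; exact: smooth_near_add.
Qed.

Lemma smooth_near_inv V (z : V) (f : V -> R) :
  f z != 0 -> smooth_near z f -> smooth_near z (fun y => (f y)^-1).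
Proof.
move=> f0 Sf; have [U [oU Uz] Cf] := Sf.
have cf : {for z, continuous f}.
  exact/differentiable_continuous/smooth_near_differentiable.
have nz : \forall y \near z, f y != 0 by exact: (cvgr_neq0 (f z) cf f0).
exists (U `&` [set y | f y != 0]^°); first by split=> //; apply: openI => //; exact: open_interior.
move=> k; apply: Ck_inv; first by apply: openI => //; exact: open_interior.
  by move=> y [_ /interior_subset].
by apply: Ck_sub (Cf k) => ? [].
Qed.

Lemma smooth_near_row V n (z : V) (f : V -> 'rV[R]_n) :
  smooth_near z f <-> forall i, smooth_near z (fun y => f y 0 i).
Proof.
split=> [Cf i|].
  by apply: smooth_near1 Cf => U k oU /(Ck_rowP _ _ oU); apply.
move=> Cf; have /choice[U HU] : forall i, exists U, open_nbhs z U /\ smooth_on U (fun y => f y 0 i).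
  by move=> i; have [U ? ?] := Cf i; exists U.
have HUz : \forall y \near z, forall i, U i y.
  by apply: filter_forall => i; apply: open_nbhs_nbhs; exact: (HU i).1.
exists [set y | forall i, U i y]^°; first by split=> //; exact: open_interior.
move=> k; apply/Ck_rowP => [|i]; first exact: open_interior.
by apply: Ck_sub ((HU i).2 k) => y /interior_subset.
Qed.

Lemma smooth_near_comp V n (z : V) (g : 'rV[R]_n -> R)
    (f : V -> 'rV[R]_n) :
  smooth_near z f -> smooth_near (f z) g -> smooth_near z (g \o f).
Proof.
move=> Sf [U' [oU' U'z] Cg]; have [U [oU Uz] Cf] := Sf.
have cf : {for z, continuous f}.
  exact/differentiable_continuous/smooth_near_differentiable.
have fU : \forall y \near z, U' (f y) by apply: cf; exact: open_nbhs_nbhs.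
have oUI : open (U `&` [set y | U' (f y)]^°) by apply: openI => //; exact: open_interior.
exists (U `&` [set y | U' (f y)]^°); first by split.
move=> k; apply: (@Ck_comp _ _ _ _ _ U') => //.
  by move=> y [_ /interior_subset].
by apply: Ck_sub (Cf k) => ? [].
Qed.

Lemma smooth_near_comp_row V n m (z : V) (g : 'rV[R]_n -> 'rV[R]_m)
    (f : V -> 'rV[R]_n) :
  smooth_near z f -> smooth_near (f z) g -> smooth_near z (g \o f).
Proof.
move=> Sf Sg; apply/smooth_near_row => i.
by apply: (@smooth_near_comp V _ z (fun y => g y 0 i)) => //; exact: (iffLR (smooth_near_row _ _)).
Qed.

Lemma smooth_near_lin V W W' (z : V) (L : {linear W -> W'}) (f : V -> W) :
  continuous L -> smooth_near z f -> smooth_near z (L \o f).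
Proof. by move=> cL; apply: smooth_near1 => U k; exact: Ck_lin. Qed.

Lemma smooth_near_id V (z : V) : smooth_near z id.
Proof.
exists setT; first by split=> //; exact: openT.
case=> [|k]; first by move=> y _; exact: cvg_id.
split=> [y _|v]; first exact: (@ex_diff _ _ _ _ _ _ _ (is_diff_id y)).
rewrite [X in Ck_on _ _ X](_ : _ = cst v); first exact: Ck_cst.
by apply/funext => y; rewrite diff_val.
Qed.

Lemma is_derive_line V W (f : V -> W) (u y : V) (t : R) :
  differentiable f (t *: u + y) ->
  is_derive t 1 (fun s : R => f (s *: u + y)) ('d f (t *: u + y) u).
Proof.
move=> df.
have dl : is_diff t (fun s : R => s *: u + y) (fun s => s *: u).
  exact: is_diff_shift.
have dfl : differentiable (f \o (fun s : R => s *: u + y)) t.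
  exact: differentiable_comp.
have dd : derivable (f \o (fun s : R => s *: u + y)) t 1 by exact/derivable1_diffP.
apply: DeriveDef => //.
by rewrite deriveE// diff_comp// /= diff_val scale1r.
Qed.

Lemma MVT_line V (f : V -> R) (u y : V) (s : R) : 0 < s ->
  (forall t, 0 <= t <= s -> differentiable f (t *: u + y)) ->
  exists2 c, 0 < c < s & f (s *: u + y) - f y = s * 'd f (c *: u + y) u.
Proof.
move=> s0 df.
have dl t : t \in `]0, s[ ->
    is_derive t 1 (fun t : R => f (t *: u + y)) ('d f (t *: u + y) u).
  by rewrite in_itv/= => /andP[t0 ts]; apply/is_derive_line/df; rewrite !ltW.
have cl : {within `[0, s], continuous (fun t : R => f (t *: u + y))}.
  apply: derivable_within_continuous => t; rewrite in_itv/= => /df dt.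
  exact: (@ex_derive _ _ _ _ _ _ _ (is_derive_line dt)).
have [c] := MVT s0 dl cl.
by rewrite in_itv/= => cs /=; rewrite scale0r add0r subr0 mulrC => ->; exists c.
Qed.

(** The mean value theorem along [u], applied to the first difference of [f] in the direction
    [s *: v], turns the second difference into [s] times an increment of [D = 'd f _ u].
    Differentiability of [D] at [z] alone then gives the mixed derivative up to [e * s^2]. *)
Lemma second_difference V (f : V -> R) (u v z : V) :
  (\forall y \near z, differentiable f y) ->
  differentiable (fun y => 'd f y u) z ->
  forall e, 0 < e -> exists2 d, 0 < d & forall s, 0 < s < d ->
    `|f (s *: u + (s *: v + z)) - f (s *: u + z) - f (s *: v + z) + f z
      - s * (s * 'd (fun y => 'd f y u) z v)| <= e * (s * s).
Proof.
move=> df dD e e0; set D := fun y => 'd f y u.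
(* All increments used below have norm at most [s * K]; the added 1 keeps [K] positive. The error
   [e * s^2] is shared between the two values of [D], hence the bound [e / 2 / K]. *)
pose K := `|u| + `|v| + 1.
have K0 : 0 < K by rewrite ltr_wpDl// addr_ge0.
have K1 : `|u| + `|v| <= K by rewrite lerDl.
have e20 : 0 < e / 2 / K by rewrite !divr_gt0.
have df' : \forall h \near (0 : V), differentiable f (h + z).
  by move: df; rewrite (near_shift 0) subr0.
have Hn : \forall h \near (0 : V), differentiable f (h + z) /\
    `|D (h + z) - D z - 'd D z h| <= e / 2 / K * `|h|.
  by apply: filterS2 df' (diff_epsP dD e20) => h.
move: Hn => /nbhs_ballP[r /= r0 rH].
exists (r / K); first by rewrite divr_gt0.
move=> s /andP[s0 sd].
have sK : s * K < r by rewrite -ltr_pdivlMr.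
have rE h : `|h| < r -> differentiable f (h + z) /\ `|D (h + z) - D z - 'd D z h| <= e / 2 / K * `|h|.
  by move=> hr; apply: rH; rewrite -ball_normE /ball_ /= sub0r normrN.
have norm_le c (b : bool) : 0 <= c <= s -> `|c *: u + (b%:R * s) *: v| <= s * K.
  move=> /andP[c0 cs]; rewrite (le_trans (ler_normD _ _))// !normrZ (ger0_norm c0).
  rewrite (gtr0_norm s0) (ger0_norm (ler0n R b)).
  apply: (@le_trans _ _ (s * (`|u| + `|v|))); last by rewrite ler_pM2l.
  rewrite mulrDr lerD ?ler_wpM2r//.
  by case: b; rewrite ?mul1r// mul0r ltW.
pose g y := f (y + s *: v) - f y.
have dg t : 0 <= t <= s -> differentiable (fun y => f (y + s *: v)) (t *: u + z) /\
   differentiable f (t *: u + z) /\ 'd g (t *: u + z) u = D (t *: u + s *: v + z) - D (t *: u + z).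
  move=> ts; have d1 : differentiable f (t *: u + s *: v + z).
    have := norm_le _ true ts; rewrite mul1r => h; exact: (rE _ (le_lt_trans h sK)).1.
  have d2 : differentiable f (t *: u + z).
    have := norm_le _ false ts; rewrite mul0r scale0r addr0 => h; exact: (rE _ (le_lt_trans h sK)).1.
  have dsh (y : V) : is_diff y (fun y => y + s *: v) id.
    exact: is_diff_shift.
  have d1' : differentiable f ((fun y => y + s *: v) (t *: u + z)) by rewrite /= addrAC.
  have d3 : differentiable (fun y => f (y + s *: v)) (t *: u + z).
    exact: (@differentiable_comp _ _ _ _ (fun y => y + s *: v) f).
  split=> //; split=> //.
  rewrite /g (diffBE _ d3 d2); congr (_ - _).
  rewrite (@diff_compE _ _ _ (fun y => y + s *: v) f); [|by []|by []].
  by rewrite diff_val addrAC.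
have [t ts|c cs] := @MVT_line V g u z s s0 _.
  by have [d1 [d2 _]] := dg _ ts; exact: differentiableB.
have cs' : 0 <= c <= s by case/andP: cs => /ltW-> /ltW->.
have [_ [_ ->]] := dg _ cs'.
move=> E.
have -> : f (s *: u + (s *: v + z)) - f (s *: u + z) - f (s *: v + z) + f z
   = s * (D (c *: u + s *: v + z) - D (c *: u + z)).
  by rewrite -E /g -[_ + z + _]addrA [z + _]addrC; ring.
rewrite -mulrBr normrM (gtr0_norm s0) mulrCA ler_pM2l//.
have n1 := norm_le _ true cs'; have n2 := norm_le _ false cs'.
rewrite mul1r in n1; rewrite mul0r scale0r addr0 in n2.
have [_ E1] := rE _ (le_lt_trans n1 sK).
have [_ E2] := rE _ (le_lt_trans n2 sK).
have -> : D (c *: u + s *: v + z) - D (c *: u + z) - s * 'd D z v =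
   (D (c *: u + s *: v + z) - D z - 'd D z (c *: u + s *: v)) -
   (D (c *: u + z) - D z - 'd D z (c *: u)).
  rewrite linearD [in 'd D z (s *: v)]linearZ /= -[s *: 'd D z v]/(s * 'd D z v).
  by rewrite !opprD !opprK !addrA; ring.
apply: le_trans (ler_normB _ _) _.
have -> : e * s = e / 2 / K * (s * K) + e / 2 / K * (s * K).
  by rewrite -mulrDl -mulrDl -splitr mulrCA divfK ?gt_eqF// mulrC.
apply: lerD.
  by apply: (le_trans E1); rewrite ler_pM2l.
by apply: (le_trans E2); rewrite ler_pM2l.
Qed.

(** The second difference is symmetric in [u] and [v], and both mixed derivatives approximate it
    within [(e / 2) * s^2]. *)
Lemma diff_symmetric V (f : V -> R) (u v z : V) : smooth_near z f ->
  'd (fun y => 'd f y u) z v = 'd (fun y => 'd f y v) z u.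
Proof.
move=> Sf; have df : \forall y \near z, differentiable f y.
  by apply: filterS (smooth_near_open Sf) => y; exact: smooth_near_differentiable.
have dD w : differentiable (fun y => 'd f y w) z.
  exact/smooth_near_differentiable/smooth_near_diff.
apply/eqP; rewrite -subr_eq0 -normr_le0; apply/ler_addgt0Pl => e e0; rewrite addr0.
have e20 : 0 < e / 2 by rewrite divr_gt0.
have [d1 d10 H1] := @second_difference _ f u v z df (dD u) _ e20.
have [d2 d20 H2] := @second_difference _ f v u z df (dD v) _ e20.
pose s := Num.min d1 d2 / 2.
have s0 : 0 < s by rewrite divr_gt0// lt_min d10.
have sm : s < Num.min d1 d2 by rewrite ltr_pdivrMr// ltr_pMr ?ltr1n// lt_min d10.
move: sm; rewrite lt_min => /andP[sd1 sd2].
have {H1} := H1 s; rewrite s0 sd1 => /(_ isT) H1.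
have {H2} := H2 s; rewrite s0 sd2 => /(_ isT) H2.
have s20 : 0 < s * s by rewrite mulr_gt0.
rewrite -(ler_pM2l s20) -[X in X * `|_|](gtr0_norm s20) -normrM.
have -> : s * s * e = e / 2 * (s * s) + e / 2 * (s * s).
  by rewrite -mulrDl -splitr mulrC.
apply: le_trans (lerD H2 H1); apply: le_trans (ler_normB _ _).
by rewrite le_eqVlt; apply/orP; left; apply/eqP; congr (`| _ |); rewrite [s *: v + (s *: u + z)]addrCA; ring.
Qed.

End smooth_near.

(** * Charts, coordinate frames and Lie brackets on a manifold *)

Section manifold_calculus.
Variables (R : realType) (n : nat) (M : manifold R n).
Implicit Types (p a b : M) (u v w : 'rV[R]_n).

Definition mdom p : set M := chart_dom (chart_at p).

Lemma mdom_self p : mdom p p. Proof. exact: chart_at_dom. Qed.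

Lemma mdom_near p a : mdom p a -> \forall b \near a, mdom p b.
Proof. by move=> pa; apply: open_nbhs_nbhs; split=> //; exact: chart_dom_open. Qed.

Lemma coordK p a : mdom p a -> uncoord p (coord p a) = a.
Proof. exact: chart_mapK. Qed.

Lemma near_uncoord p a (P : set M) : mdom p a ->
  (\forall b \near a, P b) -> \forall z \near coord p a, P (uncoord p z).
Proof.
move=> pa aP; have := @chart_inv_cont _ _ _ (chart_at p) a pa; apply.
by rewrite /= -/(uncoord p) -/(coord p) coordK.
Qed.

Lemma near_coord p a (P : set 'rV[R]_n) : mdom p a ->
  (\forall z \near coord p a, P z) -> \forall b \near a, P (coord p b).
Proof. by move=> pa aP; exact: (@chart_map_cont _ _ _ (chart_at p) a pa). Qed.

Lemma uncoordK p a : mdom p a ->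
  \forall z \near coord p a, coord p (uncoord p z) = z.
Proof.
move=> pa; near=> z.
have [b pb <-] : (coord p @` mdom p) z.
  near: z; apply: open_nbhs_nbhs; split; first exact: chart_im_open.
  by exists a.
by rewrite coordK.
Unshelve. all: by end_near. Qed.

Lemma transition_smooth p q a : mdom p a -> mdom q a ->
  smooth_near (coord p a) (coord q \o uncoord p).
Proof.
move=> pa qa; pose A := coord p @` (mdom p `&` mdom q).
have Aa : nbhs (coord p a) A.
  near=> z; exists (uncoord p z); last by near: z; exact: uncoordK.
  split; near: z; apply: near_uncoord => //; exact: mdom_near.
exists A^°; first by split=> //; exact: open_interior.
by move=> k; apply: Ck_sub (chart_at_compat p q k) => z /interior_subset.
Unshelve. all: by end_near. Qed.

Lemma transition_eq p q a (W : Type) (f : M -> W) : mdom p a -> mdom q a ->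
  \forall z \near coord p a,
    (f \o uncoord q \o (coord q \o uncoord p)) z = (f \o uncoord p) z.
Proof.
move=> pa qa; near=> z => /=; rewrite coordK//.
by near: z; apply: near_uncoord => //; exact: mdom_near.
Unshelve. all: by end_near. Qed.

Lemma smooth_at_chart p q a (f : M -> R) : mdom p a -> mdom q a ->
  smooth_near (coord q a) (f \o uncoord q) ->
  smooth_near (coord p a) (f \o uncoord p).
Proof.
move=> pa qa sf; apply: smooth_near_eq (transition_eq f pa qa) _.
apply: (@smooth_near_comp _ _ _ _ (f \o uncoord q) (coord q \o uncoord p)).
  exact: transition_smooth.
by rewrite /= coordK.
Qed.

(** By definition, smoothness at [a] is read in the chart chosen at [a]. This lets the single chart
    at [p] serve for all points near [p]. *)
Lemma smooth_atP p a (f : M -> R) : mdom p a ->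
  smooth_at a f <-> smooth_near (coord p a) (f \o uncoord p).
Proof.
move=> pa; split=> sf; apply: smooth_at_chart sf => //; exact: mdom_self.
Qed.

Lemma smooth_at_differentiable p (f : M -> R) : smooth_at p f ->
  differentiable (f \o uncoord p) (coord p p).
Proof. exact: smooth_near_differentiable. Qed.

Lemma smooth_at_open p (f : M -> R) : smooth_at p f ->
  \forall a \near p, smooth_at a f.
Proof.
move=> /smooth_near_open sf; near=> a.
apply/(@smooth_atP p); first by near: a; apply: mdom_near; exact: mdom_self.
by near: a; exact: (near_coord (mdom_self p) sf).
Unshelve. all: by end_near. Qed.

Lemma smooth_at_near_eq p (f g : M -> R) :
  (\forall a \near p, f a = g a) -> smooth_at p f -> smooth_at p g.
Proof.
by move=> fg; apply: smooth_near_eq; exact: (near_uncoord (mdom_self p) fg).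
Qed.

Lemma smooth_at_cst p (c : R) : smooth_at p (fun=> c).
Proof. exact: smooth_near_cst. Qed.

Lemma smooth_at_add p (f g : M -> R) :
  smooth_at p f -> smooth_at p g -> smooth_at p (fun a => f a + g a).
Proof. exact: smooth_near_add. Qed.

Lemma smooth_at_mul p (f g : M -> R) :
  smooth_at p f -> smooth_at p g -> smooth_at p (fun a => f a * g a).
Proof. exact: smooth_near_mul. Qed.

Lemma smooth_at_opp p (f : M -> R) :
  smooth_at p f -> smooth_at p (fun a => - f a).
Proof. exact: smooth_near_opp. Qed.

Lemma smooth_at_sum p (I : Type) (s : seq I) (f : I -> M -> R) :
  (forall i, smooth_at p (f i)) -> smooth_at p (fun a => \sum_(i <- s) f i a).
Proof. exact: smooth_near_sum. Qed.

Lemma vder_near_eq p u (f g : M -> R) :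
  (\forall a \near p, f a = g a) -> vder p u f = vder p u g.
Proof.
move=> fg; have H := near_uncoord (mdom_self p) fg.
exact: (congr1 (fun h => h u) (near_eq_diff H)).
Qed.

Lemma vderD p u v (f : M -> R) : vder p (u + v) f = vder p u f + vder p v f.
Proof. by rewrite /vder linearD. Qed.

Lemma vderZ p (c : R) u (f : M -> R) : vder p (c *: u) f = c * vder p u f.
Proof. by rewrite /vder linearZ. Qed.

Lemma vder0 p (f : M -> R) : vder p 0 f = 0.
Proof. by rewrite /vder linear0. Qed.

Lemma vderB p u v (f : M -> R) : vder p (u - v) f = vder p u f - vder p v f.
Proof. by rewrite /vder linearB. Qed.

Lemma vder_sum_l p (I : Type) (s : seq I) (u : I -> 'rV[R]_n) (f : M -> R) :
  vder p (\sum_(i <- s) u i) f = \sum_(i <- s) vder p (u i) f.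
Proof. by rewrite /vder linear_sum. Qed.

Lemma vder_cst p u (c : R) : vder p u (fun=> c) = 0.
Proof.
by rewrite /vder (_ : _ \o _ = cst c)// diff_cst.
Qed.

Lemma vder_add p u (f g : M -> R) : smooth_at p f -> smooth_at p g ->
  vder p u (fun a => f a + g a) = vder p u f + vder p u g.
Proof.
move=> /smooth_at_differentiable df /smooth_at_differentiable dg.
exact: (diffDE u df dg).
Qed.

Lemma vder_mul p u (f g : M -> R) : smooth_at p f -> smooth_at p g ->
  vder p u (fun a => f a * g a) = f p * vder p u g + g p * vder p u f.
Proof.
move=> /smooth_at_differentiable df /smooth_at_differentiable dg.
have := diffME u df dg.
by rewrite /= coordK//; exact: mdom_self.
Qed.

Lemma vder_sum p u (I : Type) (s : seq I) (f : I -> M -> R) :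
  (forall i, smooth_at p (f i)) ->
  vder p u (fun a => \sum_(i <- s) f i a) = \sum_(i <- s) vder p u (f i).
Proof.
move=> sf; elim: s => [|i s IH].
  by rewrite big_nil; under eq_fun do rewrite big_nil; rewrite vder_cst.
rewrite big_cons; under eq_fun do rewrite big_cons.
by rewrite vder_add// ?IH//; exact: smooth_at_sum.
Qed.

Lemma diff_transition p q a u (f : M -> R) : mdom p a -> mdom q a ->
  smooth_at a f ->
  'd (f \o uncoord p) (coord p a) u = 'd (f \o uncoord q) (coord q a)
                 ('d (coord q \o uncoord p) (coord p a) u).
Proof.
move=> pa qa sf; set t := coord q \o uncoord p; set F := f \o uncoord q.
transitivity ('d (fun y => F (t y)) (coord p a) u).
  exact: (congr1 (fun h => h u) (esym (near_eq_diff (transition_eq f pa qa)))).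
have tE : t (coord p a) = coord q a by rewrite /t /= coordK.
rewrite -tE; apply: diff_compE.
  exact/smooth_near_differentiable/transition_smooth.
by rewrite tE; apply: smooth_near_differentiable; apply/smooth_atP.
Qed.

Lemma vder_chart p a u (f : M -> R) : mdom p a -> smooth_at a f ->
  vder a u f = 'd (f \o uncoord p) (coord p a)
                 ('d (coord p \o uncoord a) (coord a a) u).
Proof. by move=> pa; apply: diff_transition => //; exact: mdom_self. Qed.

Lemma vder_const_field p a u (f : M -> R) : mdom p a -> smooth_at a f ->
  vder a (const_field p u a) f = 'd (f \o uncoord p) (coord p a) u.
Proof.
by move=> pa sf; apply/esym/diff_transition => //; exact: mdom_self.
Qed.

Lemma const_field_self p u : const_field p u p = u.
Proof.
rewrite /const_field (near_eq_diff (g := id)) ?diff_val//.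
by have := uncoordK (mdom_self p).
Qed.

Lemma smooth_at_coord p a i : mdom p a -> smooth_at a (fun b => coord p b 0 i).
Proof.
move=> pa; apply/(smooth_atP _ pa).
apply: (@smooth_near_eq _ _ _ _ (@rcoord R n i)).
  by apply: filterS (uncoordK pa) => z /= ->.
apply: (@smooth_near_lin _ _ _ _ _ (@rcoord R n i) id).
  exact: rcoord_continuous.
exact: smooth_near_id.
Qed.

Lemma vder_coord p a u i : mdom p a ->
  vder a (const_field p u a) (fun b => coord p b 0 i) = u 0 i.
Proof.
move=> pa; rewrite vder_const_field//; last exact: smooth_at_coord.
rewrite (near_eq_diff (g := @rcoord R n i)).
  by rewrite diff_lin//; exact: rcoord_continuous.
by apply: filterS (uncoordK pa) => z /= ->.
Qed.

(** Two transition differentials are inverse to each other. Testing on the coordinate functions of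
    the chart at [a] avoids differentiating the composite of the transition maps. *)
Lemma const_field_inv p a u : mdom p a ->
  const_field p ('d (coord p \o uncoord a) (coord a a) u) a = u.
Proof.
move=> pa; have aa := mdom_self a.
apply/rowP => i; rewrite -[LHS](vder_coord _ _ aa) -[RHS](vder_coord _ _ aa) !const_field_self.
rewrite vder_const_field//; last exact: smooth_at_coord.
by rewrite -vder_chart//; exact: smooth_at_coord.
Qed.

(** The substitute for components: the coefficients are derivatives of fixed coordinate functions,
    so they are smooth in [a] as soon as the vector field is, whatever charts are chosen at nearby
    points. *)
Lemma frame_expand p a u : mdom p a ->
  u = \sum_i vder a u (fun b => coord p b 0 i) *: const_field p (delta_mx 0 i) a.
Proof.
move=> pa; rewrite -[in LHS](const_field_inv u pa).
rewrite [X in const_field p X a]row_sum_delta.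
rewrite /const_field linear_sum; apply: eq_bigr => i _.
rewrite linearZ/=; congr (_ *: _).
by rewrite -[u in RHS](const_field_inv u pa) vder_coord.
Qed.

Lemma vder_inj p u v : (forall f, smooth_at p f -> vder p u f = vder p v f) ->
  u = v.
Proof.
move=> uv; rewrite [u](frame_expand u (mdom_self p)) [v](frame_expand v (mdom_self p)).
by apply: eq_bigr => i _; rewrite uv//; apply: smooth_at_coord; exact: mdom_self.
Qed.

Lemma vsmooth_vder p (X : vfield M) (f : M -> R) : vsmooth_at p X ->
  smooth_at p f -> smooth_at p (fun a => vder a (X a) f).
Proof. by move=> sX; exact: sX. Qed.

Lemma near_vder_const_field p a u (f : M -> R) : mdom p a -> smooth_at a f ->
  \forall z \near coord p a, 'd (f \o uncoord p) z u
    = vder (uncoord p z) (const_field p u (uncoord p z)) f.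
Proof.
move=> pa sf; have H : \forall b \near a,
    vder b (const_field p u b) f = 'd (f \o uncoord p) (coord p b) u.
  apply: filterS2 (mdom_near pa) (smooth_at_open sf) => b pb sfb.
  exact: vder_const_field.
have K := near_uncoord pa H; have K' := uncoordK pa.
near=> z.
have zE : coord p (uncoord p z) = z by near: z.
transitivity ('d (f \o uncoord p) (coord p (uncoord p z)) u).
  by rewrite zE.
by apply/esym; near: z.
Unshelve. all: by end_near. Qed.

Lemma vsmooth_const_field p a u : mdom p a -> vsmooth_at a (const_field p u).
Proof.
move=> pa f sf; apply/(smooth_atP _ pa).
have sf' := iffLR (smooth_atP f pa) sf.
exact: smooth_near_eq (near_vder_const_field u pa sf) (smooth_near_diff u sf').
Qed.

Lemma vder_vder_const p a u v (f : M -> R) : mdom p a -> smooth_at a f ->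
  vder a (const_field p v a) (fun b => vder b (const_field p u b) f) =
  vder a (const_field p u a) (fun b => vder b (const_field p v b) f).
Proof.
move=> pa sf; have sf' := iffLR (smooth_atP f pa) sf.
have H w w' : vder a (const_field p w' a) (fun b => vder b (const_field p w b) f) =
   'd (fun z => 'd (f \o uncoord p) z w) (coord p a) w'.
  rewrite vder_const_field; [|exact: pa|exact: (vsmooth_const_field w pa sf)].
  exact: (congr1 (fun h => h w') (esym (near_eq_diff (near_vder_const_field w pa sf)))).
by rewrite !H; exact: diff_symmetric.
Qed.

Lemma vder_expand p (X : vfield M) (f : M -> R) : smooth_at p f ->
  \forall a \near p, vder a (X a) f =
    \sum_i vder a (X a) (fun b => coord p b 0 i)
           * vder a (const_field p (delta_mx 0 i) a) f.
Proof.
move=> sf; near=> a.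
have pa : mdom p a by near: a; exact/mdom_near/mdom_self.
rewrite {1}(frame_expand (X a) pa).
by rewrite vder_sum_l; apply: eq_bigr => i _; rewrite vderZ.
Unshelve. all: by end_near. Qed.

(** [lie] is an [xget] with default 0, so a vector representing the commutator has to be exhibited
    before the defining property can be used. After expansion in the frame, the second-order terms
    cancel by the symmetry of second derivatives. *)
Lemma lieE p (X Y : vfield M) : vsmooth_at p X -> vsmooth_at p Y ->
  forall f, smooth_at p f -> vder p (lie X Y p) f =
    vder p (X p) (fun a => vder a (Y a) f)
    - vder p (Y p) (fun a => vder a (X a) f).
Proof.
move=> sX sY; rewrite /lie.
have pp := mdom_self p; pose x i := fun b => coord p b 0 i.
have sx i : smooth_at p (x i) by exact: smooth_at_coord.
(* The components of the bracket are forced: they are the commutator evaluated on the coordinate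
   functions. *)
pose w := \sum_i (vder p (X p) (fun a => vder a (Y a) (x i))
   - vder p (Y p) (fun a => vder a (X a) (x i))) *: const_field p (delta_mx 0 i) p.
case: xgetP => [_ _ //|/(_ w)[]] /= f sf.
have E (X' Y' : vfield M) : vsmooth_at p X' -> vsmooth_at p Y' ->
    vder p (X' p) (fun a => vder a (Y' a) f) =
    \sum_i (vder p (X' p) (fun a => vder a (Y' a) (x i)) * vder p (const_field p (delta_mx 0 i) p) f
    + \sum_j vder p (Y' p) (x i) * (vder p (X' p) (x j) *
       vder p (const_field p (delta_mx 0 j) p) (fun b => vder b (const_field p (delta_mx 0 i) b) f))).
  move=> sX' sY'; rewrite (vder_near_eq _ (vder_expand Y' sf)).
  have s1 i : smooth_at p (fun a => vder a (Y' a) (x i)) by exact: vsmooth_vder.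
  have s2 i : smooth_at p (fun a => vder a (const_field p (delta_mx 0 i) a) f).
    by apply: vsmooth_vder => //; exact: vsmooth_const_field.
  rewrite vder_sum => [|i]; last exact: (smooth_at_mul (s1 i) (s2 i)).
  apply: eq_bigr => i _; rewrite (vder_mul _ (s1 i) (s2 i)) addrC [X in X + _]mulrC; congr (_ + _).
  rewrite -mulr_sumr; congr (_ * _).
  exact: (nbhs_singleton (vder_expand X' (s2 i))).
rewrite (E X Y)// (E Y X)// -sumrB /w vder_sum_l.
rewrite -[LHS]addr0.
under eq_bigr do rewrite vderZ mulrBl.
under [in RHS]eq_bigr do rewrite opprD addrACA.
rewrite [RHS]big_split/=; congr (_ + _).
rewrite sumrB [X in _ - X]exchange_big/=; apply/esym/eqP; rewrite subr_eq0; apply/eqP.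
apply: eq_bigr => i _; apply: eq_bigr => j _.
by rewrite mulrCA vder_vder_const.
Unshelve. all: by end_near. Qed.

Lemma lie_const_field p a u v : mdom p a ->
  lie (const_field p u) (const_field p v) a = 0.
Proof.
move=> pa; apply: (@vder_inj a) => f sf; rewrite lieE//; try exact: vsmooth_const_field.
by rewrite vder_vder_const// subrr vder0.
Qed.

End manifold_calculus.

(** * Smooth maps, their differentials, and fields along them *)

Section maps.
Variables (R : realType) (m n : nat) (M : manifold R m) (N : manifold R n).
Variable x : M -> N.
Implicit Types (p a : M) (u v w : 'rV[R]_m).

Lemma vsmooth_along_near_eq p (Y Z : M -> 'rV[R]_n) :
  (\forall a \near p, Y a = Z a) ->
  vsmooth_along_at x p Y -> vsmooth_along_at x p Z.
Proof.
move=> YZ sY f /sY; apply: smooth_at_near_eq.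
by apply: filterS YZ => a ->.
Qed.

Lemma vsmooth_along0 p : vsmooth_along_at x p (fun=> 0).
Proof.
move=> f _; rewrite (_ : (fun a => _) = fun=> 0); first exact: smooth_at_cst.
by apply/funext => a; rewrite vder0.
Qed.

Lemma vsmooth_along_add p (Y Z : M -> 'rV[R]_n) :
  vsmooth_along_at x p Y -> vsmooth_along_at x p Z ->
  vsmooth_along_at x p (fun a => Y a + Z a).
Proof.
move=> sY sZ f sf; have := smooth_at_add (sY f sf) (sZ f sf).
apply: smooth_at_near_eq; near=> a; by rewrite vderD.
Unshelve. all: by end_near. Qed.

Lemma vsmooth_along_scale p (f : M -> R) (Y : M -> 'rV[R]_n) :
  smooth_at p f -> vsmooth_along_at x p Y ->
  vsmooth_along_at x p (fun a => f a *: Y a).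
Proof.
move=> sf sY h sh; have := smooth_at_mul sf (sY h sh).
apply: smooth_at_near_eq; near=> a; by rewrite vderZ.
Unshelve. all: by end_near. Qed.

Lemma vsmooth_along_sum p (I : Type) (s : seq I) (Y : I -> M -> 'rV[R]_n) :
  (forall i, vsmooth_along_at x p (Y i)) ->
  vsmooth_along_at x p (fun a => \sum_(i <- s) Y i a).
Proof.
move=> sY; elim: s => [|i s IH].
  by under eq_fun do rewrite big_nil; exact: vsmooth_along0.
by under eq_fun do rewrite big_cons; exact: vsmooth_along_add.
Qed.

Hypothesis smx : smooth_map x.

Lemma near_smooth_map p (P : set N) :
  (\forall b \near x p, P b) -> \forall a \near p, P (x a).
Proof. by move=> H; exact: (smx.1 p). Qed.

Lemma chart_map_smooth p :
  smooth_near (coord p p) (coord (x p) \o x \o uncoord p).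
Proof. exact: (smx.2 p). Qed.

Lemma map_chart_eq p (W : Type) (f : N -> W) :
  \forall z \near coord p p,
    (f \o uncoord (x p) \o (coord (x p) \o x \o uncoord p)) z
    = (f \o x \o uncoord p) z.
Proof.
near=> z; rewrite /= coordK//.
near: z; apply: (@near_uncoord _ _ _ p p (fun a => mdom (x p) (x a))).
  exact: mdom_self.
by apply: near_smooth_map; apply: mdom_near; exact: mdom_self.
Unshelve. all: by end_near. Qed.

Lemma smooth_at_comp p (f : N -> R) : smooth_at (x p) f -> smooth_at p (f \o x).
Proof.
move=> sf; apply: smooth_near_eq (map_chart_eq p f) _.
apply: (@smooth_near_comp _ _ _ _ (f \o uncoord (x p)) (coord (x p) \o x \o uncoord p)).
  exact: chart_map_smooth.
by rewrite /= coordK//; exact: mdom_self.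
Qed.

Lemma vder_tmap p u (f : N -> R) : smooth_at (x p) f ->
  vder (x p) (tmap x p u) f = vder p u (f \o x).
Proof.
move=> sf; apply/esym.
set F := f \o uncoord (x p); set t := coord (x p) \o x \o uncoord p.
transitivity ('d (fun y => F (t y)) (coord p p) u).
  exact: (congr1 (fun h => h u) (esym (near_eq_diff (map_chart_eq p f)))).
have tE : t (coord p p) = coord (x p) (x p).
  by rewrite /t /= coordK//; exact: mdom_self.
rewrite [RHS](_ : _ = 'd F (t (coord p p)) ('d t (coord p p) u)); last by rewrite tE.
apply: diff_compE; first exact/smooth_near_differentiable/chart_map_smooth.
by rewrite tE; apply: smooth_near_differentiable.
Qed.

Lemma tmap_linear p : linear (tmap x p).
Proof. by move=> c u v; rewrite /tmap linearP. Qed.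

Lemma vsmooth_along_tmap p (Y : vfield M) : vsmooth_at p Y ->
  vsmooth_along_at x p (fun a => tmap x a (Y a)).
Proof.
move=> sY f sf; have := sY _ (smooth_at_comp sf).
apply: smooth_at_near_eq.
have H := near_smooth_map (smooth_at_open sf).
by apply: filterS H => a sfa; rewrite vder_tmap.
Qed.

Lemma vsmooth_along_comp p (Y : vfield N) : vsmooth_at (x p) Y ->
  vsmooth_along_at x p (Y \o x).
Proof. by move=> sY f /sY /smooth_at_comp. Qed.

Lemma frame_along q p (Y : M -> 'rV[R]_n) : mdom q (x p) ->
  \forall a \near p, Y a = \sum_i vder (x a) (Y a) (fun b => coord q b 0 i)
     *: const_field q (delta_mx 0 i) (x a).
Proof.
by move=> qp; apply: filterS (near_smooth_map (mdom_near qp)) => a; exact: frame_expand.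
Qed.

End maps.

(** * Connections along a map: locality and expansion in a frame *)

Section connections.
Variables (R : realType) (m n : nat) (M : manifold R m) (N : manifold R n).
Variables (x : M -> N) (D : cov_along M N).
Hypothesis conn : connection_along x D.
Implicit Types (p a : M) (u v w : 'rV[R]_m) (Y Z : M -> 'rV[R]_n).

(* The indicator function of [Y = Z] is smooth at p, being locally constant
   there, and multiplying by it makes the two fields globally equal. *)
Lemma conn_near_eq p u Y Z : (\forall a \near p, Y a = Z a) ->
  vsmooth_along_at x p Y -> D p u Y = D p u Z.
Proof.
move=> YZ sY; have sZ := vsmooth_along_near_eq YZ sY.
pose f a : R := (Y a == Z a)%:R.
have f1 : \forall a \near p, 1 = f a.
  by apply: filterS YZ => a YZa; rewrite /f YZa eqxx.
have sf : smooth_at p f by apply: smooth_at_near_eq f1 _; exact: smooth_at_cst.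
have fp : f p = 1 by rewrite -(nbhs_singleton f1).
have df : vder p u f = 0 by rewrite -(vder_near_eq u f1) vder_cst.
have E V : vsmooth_along_at x p V -> D p u V = D p u (fun a => f a *: V a).
  by move=> sV; rewrite (conn_leibniz conn)// df fp scale0r add0r scale1r.
rewrite (E Y)// (E Z)//; congr (D p u _); apply/funext => a; rewrite /f.
by case: eqP => [->//|_]; rewrite !scale0r.
Qed.

Lemma conn0 p u : D p u (fun=> 0) = 0.
Proof.
have := conn_leibniz conn u (smooth_at_cst p 0) (@vsmooth_along0 _ _ _ _ _ x p).
rewrite vder_cst scale0r add0r scale0r => H; rewrite -[RHS]H; congr (D p u _).
Qed.

Lemma conn_sum p u (I : Type) (s : seq I) (Y : I -> M -> 'rV[R]_n) :
  (forall i, vsmooth_along_at x p (Y i)) ->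
  D p u (fun a => \sum_(i <- s) Y i a) = \sum_(i <- s) D p u (Y i).
Proof.
move=> sY; elim: s => [|i s IH].
  by rewrite big_nil; under eq_fun do rewrite big_nil; exact: conn0.
rewrite big_cons; under eq_fun do rewrite big_cons.
by rewrite (conn_add conn)// ?IH//; exact: vsmooth_along_sum.
Qed.

Lemma conn_scale p u (c : R) Y : vsmooth_along_at x p Y ->
  D p u (fun a => c *: Y a) = c *: D p u Y.
Proof.
move=> sY; rewrite (conn_leibniz conn u (smooth_at_cst p c) sY).
by rewrite vder_cst scale0r add0r.
Qed.

Lemma conn0l p Y : vsmooth_along_at x p Y -> D p 0 Y = 0.
Proof.
move=> sY; have := conn_linear conn sY (-1) 0 0.
by rewrite scaler0 addr0 scaleN1r addNr.
Qed.

Lemma conn_linsum p Y (I : Type) (s : seq I) (c : I -> R) (u : I -> 'rV[R]_m) :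
  vsmooth_along_at x p Y ->
  D p (\sum_(i <- s) c i *: u i) Y = \sum_(i <- s) c i *: D p (u i) Y.
Proof.
move=> sY; have L := conn_linear conn sY.
elim: s => [|i s IH]; first by rewrite !big_nil conn0l.
by rewrite !big_cons L IH.
Qed.

Lemma conn_frame p u (I : Type) (s : seq I) (f : I -> M -> R)
    (Y : I -> M -> 'rV[R]_n) :
  (forall i, smooth_at p (f i)) -> (forall i, vsmooth_along_at x p (Y i)) ->
  D p u (fun a => \sum_(i <- s) f i a *: Y i a) =
    \sum_(i <- s) (vder p u (f i) *: Y i p + f i p *: D p u (Y i)).
Proof.
move=> sf sY; rewrite conn_sum => [|i]; last exact: vsmooth_along_scale.
by apply: eq_bigr => i _; rewrite (conn_leibniz conn).
Qed.

End connections.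

Lemma add_congr (V : nmodType) (a b c d : V) : a = b -> c = d -> a + c = b + d.
Proof. by move=> -> ->. Qed.

Lemma scale_congr (R : nzRingType) (V : lmodType R) (a b : R) (u v : V) :
  a = b -> u = v -> a *: u = b *: v.
Proof. by move=> -> ->. Qed.

Lemma leibniz_cross_swap (R : comNzRingType) (a b c d e : R) :
  a * b + (e + c * d) = d * c + (e + b * a).
Proof. by ring. Qed.

(** * The pullback connection: metric compatibility, torsion and curvature *)

Section pullback.
Variables (R : realType) (m n : nat) (M : manifold R m) (N : manifold R n).
Variables (x : M -> N) (D : cov N) (Dx : cov_along M N).
Hypothesis smx : smooth_map x.
Hypothesis connD : connection_along idfun D.
Hypothesis pull : pullback_connection x D Dx.
Implicit Types (p a : M) (u v w : 'rV[R]_m) (Y Z : M -> 'rV[R]_n).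

Let connDx := pull_conn pull.

Definition chart_frame (q : N) (i : 'I_n) : vfield N := const_field q (delta_mx 0 i).

Definition frame_coef (q : N) (i : 'I_n) (b : N) (s : 'rV[R]_n) : R :=
  vder b s (fun c => coord q c 0 i).

Lemma vsmooth_frame q b i : mdom q b -> vsmooth_at b (chart_frame q i).
Proof. exact: vsmooth_const_field. Qed.

Lemma vsmooth_frame_along q p i : mdom q (x p) ->
  vsmooth_along_at x p (chart_frame q i \o x).
Proof. by move=> qp; apply: vsmooth_along_comp => //; exact: vsmooth_frame. Qed.

Lemma smooth_frame_coef q p i Y : mdom q (x p) -> vsmooth_along_at x p Y ->
  smooth_at p (fun a => frame_coef q i (x a) (Y a)).
Proof. by move=> qp sY; apply: sY; exact: smooth_at_coord. Qed.

Lemma pull_frame q p u i : mdom q (x p) ->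
  Dx p u (chart_frame q i \o x) = D (x p) (tmap x p u) (chart_frame q i).
Proof. by move=> qp; rewrite (pull_compat pull)//; exact: vsmooth_frame. Qed.

Lemma cov_expand q b (s : 'rV[R]_n) (Y : vfield N) :
  mdom q b -> vsmooth_at b Y ->
  D b s Y = \sum_j frame_coef q j b s *: D b (chart_frame q j b) Y.
Proof.
move=> qb sY; rewrite {1}(frame_expand s qb).
exact: (conn_linsum connD).
Qed.

(** [Dx] is tied to [D] only on restrictions of ambient fields. The ambient coordinate frame
    restricts to such fields, and the Leibniz rule reaches every other field along [x]. *)
Lemma pull_expand q p u Y : mdom q (x p) -> vsmooth_along_at x p Y ->
  Dx p u Y = \sum_i (vder p u (fun a => frame_coef q i (x a) (Y a)) *: chart_frame q i (x p)
    + frame_coef q i (x p) (Y p) *: D (x p) (tmap x p u) (chart_frame q i)).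
Proof.
move=> qp sY; rewrite (conn_near_eq connDx _ (frame_along smx _ qp) sY).
rewrite (conn_frame connDx _ _ (fun i => smooth_frame_coef i qp sY)
  (fun i => vsmooth_frame_along i qp)).
by apply: eq_bigr => i _; rewrite pull_frame.
Qed.

Lemma frame_coef_tmap q a i u : mdom q (x a) ->
  frame_coef q i (x a) (tmap x a u) = vder a u ((fun b => coord q b 0 i) \o x).
Proof. by move=> qa; rewrite /frame_coef vder_tmap//; exact: smooth_at_coord. Qed.

Section metric.
Variables (g : form2 N).
Hypothesis g_lin : forall b s, scalar (g b s).
Hypothesis g_sym : forall b s t, g b s t = g b t s.
Hypothesis g_smooth : forall b (X Y : vfield N), vsmooth_at b X ->
  vsmooth_at b Y -> smooth_at b (fun c => g c (X c) (Y c)).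
Hypothesis g_compat : forall b s (Y Z : vfield N),
  vsmooth_at b Y -> vsmooth_at b Z ->
  vder b s (fun c => g c (Y c) (Z c)) = g b (D b s Y) (Z b) + g b (Y b) (D b s Z).

Lemma metricDr b s t r : g b s (t + r) = g b s t + g b s r.
Proof. by have := g_lin b s 1 t r; rewrite scale1r mul1r. Qed.

Lemma metric0r b s : g b s 0 = 0.
Proof. by have := g_lin b s (-1) 0 0; rewrite scaler0 addr0 mulN1r addNr. Qed.

Lemma metricZr b s c t : g b s (c *: t) = c * g b s t.
Proof. by have := g_lin b s c t 0; rewrite metric0r !addr0. Qed.

Lemma metricDl b s t r : g b (t + r) s = g b t s + g b r s.
Proof. by rewrite g_sym metricDr !(g_sym _ s). Qed.

Lemma metric0l b s : g b 0 s = 0.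
Proof. by rewrite g_sym metric0r. Qed.

Lemma metricZl b s c t : g b (c *: t) s = c * g b t s.
Proof. by rewrite g_sym metricZr g_sym. Qed.

(** Smoothness of the product is bundled with the product rule because the sum over a frame can be
    differentiated term by term only if each term is smooth. *)
Definition metric_compatible p u Y Z :=
  smooth_at p (fun a => g (x a) (Y a) (Z a)) /\
  vder p u (fun a => g (x a) (Y a) (Z a)) =
    g (x p) (Dx p u Y) (Z p) + g (x p) (Y p) (Dx p u Z).

Lemma metric_compatible_sym p u Y Z : metric_compatible p u Y Z -> metric_compatible p u Z Y.
Proof.
move=> [sYZ cYZ]; split.
  by under eq_fun do rewrite g_sym.
by under eq_fun do rewrite g_sym; rewrite cYZ addrC (g_sym _ (Dx p u Z)) (g_sym _ (Z p)).
Qed.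

Lemma metric_compatible_frame p u (I : Type) (s : seq I) (f : I -> M -> R)
    (Y : I -> M -> 'rV[R]_n) Z :
  (forall i, smooth_at p (f i)) -> (forall i, vsmooth_along_at x p (Y i)) ->
  (forall i, metric_compatible p u (Y i) Z) ->
  metric_compatible p u (fun a => \sum_(i <- s) f i a *: Y i a) Z.
Proof.
move=> sf sY cY.
have E a : g (x a) (\sum_(i <- s) f i a *: Y i a) (Z a) =
    \sum_(i <- s) f i a * g (x a) (Y i a) (Z a).
  elim: s => [|i s IH]; first by rewrite !big_nil metric0l.
  by rewrite !big_cons metricDl metricZl IH.
rewrite /metric_compatible; under eq_fun do rewrite E; split.
  by apply: smooth_at_sum => i; exact: (smooth_at_mul (sf i) (cY i).1).
rewrite vder_sum => [|i]; last exact: (smooth_at_mul (sf i) (cY i).1).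
rewrite (conn_frame connDx)//.
elim: s {E} => [|i s IH]; first by rewrite !big_nil !metric0l addr0.
rewrite !big_cons IH (vder_mul _ (sf i) (cY i).1) (cY i).2 !metricDl !metricZl.
by ring.
Qed.

Lemma metric_compatible_near_eq p u Y Y' Z : (\forall a \near p, Y a = Y' a) ->
  vsmooth_along_at x p Y -> metric_compatible p u Y Z -> metric_compatible p u Y' Z.
Proof.
move=> YY' sY [sYZ cYZ].
have H : \forall a \near p, g (x a) (Y a) (Z a) = g (x a) (Y' a) (Z a).
  by apply: filterS YY' => a ->.
split; first exact: smooth_at_near_eq H sYZ.
by rewrite -(vder_near_eq _ H) cYZ (conn_near_eq connDx _ YY' sY) (nbhs_singleton YY').
Qed.

(** Both arguments are expanded in the ambient frame. On frame fields, which are restrictions of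
    ambient fields, the claim is the compatibility of [D] in the direction [tmap x p u]. *)
Lemma pull_compatible p u Y Z : vsmooth_along_at x p Y ->
  vsmooth_along_at x p Z -> metric_compatible p u Y Z.
Proof.
move=> sY sZ; have qp := mdom_self (x p); set q := x p in qp *.
have expand V W : vsmooth_along_at x p V ->
    (forall i, metric_compatible p u (chart_frame q i \o x) W) -> metric_compatible p u V W.
  move=> sV cW.
  have F : \forall a \near p, \sum_i frame_coef q i (x a) (V a) *: chart_frame q i (x a) = V a.
    by apply: filterS (frame_along smx V qp) => a /esym.
  apply: metric_compatible_near_eq F _ _.
    by apply: vsmooth_along_near_eq sV; exact: (frame_along smx V qp).
  apply: (metric_compatible_frame _ (f := fun i a => frame_coef q i (x a) (V a)) (Y := fun i => chart_frame q i \o x)).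
  - by move=> i; exact: smooth_frame_coef.
  - by move=> i; exact: vsmooth_frame_along.
  - exact: cW.
apply: (expand Y Z sY) => i; apply: metric_compatible_sym.
apply: (expand Z (chart_frame q i \o x) sZ) => j.
have sE k := vsmooth_frame k qp.
split; first exact: (smooth_at_comp smx (g_smooth (sE j) (sE i))).
rewrite !pull_frame//.
rewrite -(vder_tmap smx u (g_smooth (sE j) (sE i))).
by rewrite g_compat.
Qed.

End metric.

Hypothesis torD : forall b (X Y : vfield N), vsmooth_at b X -> vsmooth_at b Y ->
  D b (X b) Y - D b (Y b) X = lie X Y b.

Lemma pull_torsion p (X Y : vfield M) : vsmooth_at p X -> vsmooth_at p Y ->
  Dx p (X p) (fun a => tmap x a (Y a)) - Dx p (Y p) (fun a => tmap x a (X a))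
  = tmap x p (lie X Y p).
Proof.
move=> sX sY; have qp := mdom_self (x p); set q := x p in qp *.
have sc i := smooth_at_coord i qp.
pose phi i := (fun c => coord q c 0 i) \o x.
have sphi i : smooth_at p (phi i) by exact: smooth_at_comp.
have cphi (W : vfield M) i : \forall a \near p, frame_coef q i (x a) (tmap x a (W a)) = vder a (W a) (phi i).
  have H := near_smooth_map smx (smooth_at_open (sc i)).
  near=> a; rewrite /frame_coef vder_tmap//.
  by near: a; exact: H.
have E (V W : vfield M) : vsmooth_at p V -> vsmooth_at p W ->
   Dx p (V p) (fun a => tmap x a (W a)) =
   \sum_i vder p (V p) (fun a => vder a (W a) (phi i)) *: chart_frame q i q +
   \sum_i \sum_j (vder p (W p) (phi i) * vder p (V p) (phi j)) *: D q (chart_frame q j q) (chart_frame q i).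
  move=> sV sW; rewrite (pull_expand _ qp); last exact: vsmooth_along_tmap.
  rewrite big_split; apply: add_congr; apply: eq_bigr => i _.
    by rewrite (vder_near_eq _ (cphi W i)).
  rewrite (cov_expand _ qp (vsmooth_frame i qp)) scaler_sumr; apply: eq_bigr => j _.
  by rewrite scalerA /frame_coef !vder_tmap.
rewrite (E X Y)// (E Y X)// opprD addrACA -sumrB.
rewrite [X in _ + (_ - X)]exchange_big/= [X in _ + X](_ : _ = 0).
  rewrite addr0 [RHS](frame_expand _ qp); apply: eq_bigr => i _.
  by rewrite -scalerBl (vder_tmap smx _ (sc i)) (lieE sX sY (sphi i)).
(* The connection terms agree after exchanging [i] and [j]: coordinate fields commute and [D] has no
   torsion, so differentiating the i-th along the j-th or conversely gives the same vector. *)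
apply/eqP; rewrite subr_eq0; apply/eqP; apply: eq_bigr => i _; apply: eq_bigr => j _.
rewrite [in RHS]mulrC; apply: scale_congr => //; apply/eqP; rewrite -subr_eq0; apply/eqP.
by rewrite torD ?lie_const_field//; exact: vsmooth_frame.
Unshelve. all: by end_near. Qed.

Definition frame_hess q i j b := D b (chart_frame q j b) (chart_frame q i).

(** The second covariant derivative at [q] of fields with constant components [t] and [r], taken
    along [s]. Antisymmetrized in [s] and [t], it is the curvature. *)
Definition curv_frame q (s t r : 'rV[R]_n) : 'rV[R]_n :=
  \sum_i frame_coef q i q r *: \sum_j frame_coef q j q t *: D q s (frame_hess q i j).

Lemma vsmooth_hess q b i j : mdom q b -> vsmooth_at b (frame_hess q i j).
Proof.
by move=> qb; apply: (conn_smooth connD); exact: vsmooth_frame.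
Qed.

Lemma curv_tensor_frame q s t r :
  curv_tensor D q s t r = curv_frame q s t r - curv_frame q t s r.
Proof.
have qq := mdom_self q; rewrite /curv_tensor /curvature lie_const_field//.
rewrite (conn0l connD) ?subr0; last exact: vsmooth_const_field.
have cE s' i b : mdom q b -> frame_coef q i b (const_field q s' b) = s' 0 i.
  by move=> qb; rewrite /frame_coef vder_coord.
have cE0 s' i : frame_coef q i q s' = s' 0 i.
  by rewrite -[s' in LHS](const_field_self q) cE.
have E s' t' : D q (const_field q s' q) (fun b => D b (const_field q t' b) (const_field q r)) = curv_frame q s' t' r.
  rewrite const_field_self.
  have H : \forall b \near q, D b (const_field q t' b) (const_field q r) =
     \sum_i r 0 i *: \sum_j t' 0 j *: frame_hess q i j b.
    near=> b; have qb : mdom q b by near: b; exact: mdom_near.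
    have -> : const_field q r = fun c => \sum_i r 0 i *: chart_frame q i c.
      apply/funext => c; rewrite {1}[r]row_sum_delta /const_field linear_sum.
      by apply: eq_bigr => i _; rewrite linearZ.
    rewrite (conn_sum connD) => [|i]; last first.
      by apply: vsmooth_along_scale; [exact: smooth_at_cst|exact: vsmooth_frame].
    apply: eq_bigr => i _; rewrite (conn_scale connD); last exact: vsmooth_frame.
    rewrite (cov_expand _ qb (vsmooth_frame i qb)).
    by apply: scale_congr => //; apply: eq_bigr => j _; rewrite cE.
  rewrite (conn_near_eq connD _ H); last first.
    by apply: (conn_smooth connD); exact: vsmooth_const_field.
  have sH i j : vsmooth_at q (fun b => t' 0 j *: frame_hess q i j b).
    by apply: vsmooth_along_scale; [exact: smooth_at_cst|exact: vsmooth_hess].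
  have sHs i : vsmooth_at q (fun b => \sum_j t' 0 j *: frame_hess q i j b).
    exact: (@vsmooth_along_sum _ _ _ _ _ _ _ _ _ _ (sH i)).
  rewrite (conn_sum connD) => [|i]; last first.
    by apply: vsmooth_along_scale; [exact: smooth_at_cst|exact: sHs].
  apply: eq_bigr => i _; rewrite (conn_scale connD); last exact: sHs.
  rewrite cE0; apply: scale_congr => //; rewrite (conn_sum connD) => [|j]; last exact: sH.
  apply: eq_bigr => j _; rewrite (conn_scale connD); last exact: vsmooth_hess.
  by rewrite cE0.
by rewrite !E.
Unshelve. all: by end_near. Qed.

(** The constant fields commute, so no bracket term appears on the left. The image fields do not
    have constant components in the ambient chart; the extra terms, involving second and third
    derivatives of [x], are symmetric in [u] and [v]. *)
Lemma pull_curvature p u v w :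
  let c := fun s => const_field p s in
  Dx p u (fun a => Dx a (c v a) (fun b => tmap x b (c w b)))
  - Dx p v (fun a => Dx a (c u a) (fun b => tmap x b (c w b)))
  = curv_tensor D (x p) (tmap x p u) (tmap x p v) (tmap x p w).
Proof.
move=> c; have qp := mdom_self (x p); have pp := mdom_self p.
set q := x p in qp *.
have sc i := smooth_at_coord i qp.
pose phi i := (fun d => coord q d 0 i) \o x.
have sphi i : smooth_at p (phi i) by exact: smooth_at_comp.
have svphi s i : smooth_at p (fun a => vder a (c s a) (phi i)).
  by apply: vsmooth_const_field => //.
have cphi s i : \forall a \near p, frame_coef q i (x a) (tmap x a (c s a)) = vder a (c s a) (phi i).
  have H := near_smooth_map smx (smooth_at_open (sc i)).
  near=> a; rewrite /frame_coef vder_tmap//.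
  by near: a; exact: H.
have cpE s : c s p = s by exact: const_field_self.
have cphi0 s i : frame_coef q i q (tmap x p s) = vder p s (phi i).
  by rewrite /frame_coef vder_tmap.
have schwarz s t i : vder p t (fun a => vder a (c s a) (phi i)) =
    vder p s (fun a => vder a (c t a) (phi i)).
  have := vder_vder_const s t pp (sphi i); by rewrite !const_field_self.
(* [S] gathers every term in which a component of [x] is differentiated more than once. What remains
   of the second derivative is [curv_frame] at the image vectors. *)
pose S s t := \sum_i (vder p s (fun a => vder a (c t a) (fun b => vder b (c w b) (phi i))) *: chart_frame q i q
   + \sum_j (vder p t (fun a => vder a (c w a) (phi i)) * vder p s (phi j)
            + (vder p w (phi i) * vder p s (fun a => vder a (c t a) (phi j))
             + vder p t (phi j) * vder p s (fun a => vder a (c w a) (phi i)))) *: frame_hess q i j q).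
have E s t : Dx p s (fun a => Dx a (c t a) (fun b => tmap x b (c w b))) =
    S s t + curv_frame q (tmap x p s) (tmap x p t) (tmap x p w).
  have H : \forall a \near p, Dx a (c t a) (fun b => tmap x b (c w b)) =
     \sum_i (vder a (c t a) (fun b => vder b (c w b) (phi i)) *: chart_frame q i (x a)
       + \sum_j (vder a (c w a) (phi i) * vder a (c t a) (phi j)) *: frame_hess q i j (x a)).
    have scn : \forall b \near q, forall i, smooth_at b (fun d => coord q d 0 i).
      by apply: filter_forall => i; exact: smooth_at_open.
    near=> a.
    have pa : mdom p a by near: a; exact: mdom_near.
    have qa : mdom q (x a) by near: a; apply: (near_smooth_map smx (mdom_near qp)).
    have sca : forall i, smooth_at (x a) (fun d => coord q d 0 i).
      by near: a; apply: (near_smooth_map smx scn).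
    have H i : \forall b \near a, frame_coef q i (x b) (tmap x b (c w b)) = vder b (c w b) (phi i).
      have Hq := near_smooth_map smx (mdom_near qa).
      near=> b; apply: frame_coef_tmap.
      by near: b; exact: Hq.
    rewrite (pull_expand _ qa); last first.
      by apply: vsmooth_along_tmap => //; exact: vsmooth_const_field.
    apply: eq_bigr => i _; rewrite (vder_near_eq _ (H i)); apply: add_congr; first by [].
    rewrite (cov_expand _ qa (vsmooth_frame i qa)) scaler_sumr; apply: eq_bigr => j _.
    by rewrite scalerA !frame_coef_tmap.
  have sD : vsmooth_along_at x p (fun a => Dx a (c t a) (fun b => tmap x b (c w b))).
    apply: (conn_smooth connDx); first exact: vsmooth_const_field.
    by apply: vsmooth_along_tmap => //; exact: vsmooth_const_field.
  have s1 i : smooth_at p (fun a => vder a (c t a) (fun b => vder b (c w b) (phi i))).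
    by apply: (vsmooth_const_field t pp).
  have s2 i j : smooth_at p (fun a => vder a (c w a) (phi i) * vder a (c t a) (phi j)).
    exact: (smooth_at_mul (svphi w i) (svphi t j)).
  have sh i j : vsmooth_along_at x p (frame_hess q i j \o x).
    by apply: vsmooth_along_comp => //; exact: vsmooth_hess.
  pose F i j a := (vder a (c w a) (phi i) * vder a (c t a) (phi j))
    *: frame_hess q i j (x a).
  have ssh i : vsmooth_along_at x p (fun a => \sum_j F i j a).
    exact: (@vsmooth_along_sum _ _ _ _ _ _ _ _ _ (F i)
      (fun j => vsmooth_along_scale (s2 i j) (sh i j))).
  rewrite /F in ssh.
  have sf i : vsmooth_along_at x p (fun a => vder a (c t a) (fun b => vder b (c w b) (phi i)) *: chart_frame q i (x a)).
    exact: (vsmooth_along_scale (s1 i) (vsmooth_frame_along i qp)).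
  rewrite (conn_near_eq connDx _ H sD).
  rewrite (conn_sum connDx) => [|i]; last exact: (vsmooth_along_add (sf i) (ssh i)).
  rewrite /S /curv_frame -big_split; apply: eq_bigr => i _.
  rewrite (conn_add connDx _ (sf i) (ssh i)).
  rewrite (conn_leibniz connDx _ (s1 i) (vsmooth_frame_along i qp)).
  rewrite (conn_frame connDx _ _ (s2 i) (sh i)).
  rewrite pull_frame// (cov_expand _ qp (vsmooth_frame i qp)) !cpE -[RHS]/(_ + _).
  rewrite -!addrA; apply: add_congr; first by [].
  rewrite !scaler_sumr -!big_split; apply: eq_bigr => j _ /=.
  rewrite (pull_compat pull); last exact: vsmooth_hess.
  rewrite (vder_mul _ (svphi w i) (svphi t j)) !cphi0 !cpE.
  rewrite !scalerA -[D q (chart_frame q j q) _]/(frame_hess q i j q) !scalerDl !addrA.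
  exact: erefl.
rewrite !E curv_tensor_frame opprD addrACA [X in X + _](_ : _ = 0) ?add0r//.
(* [S] is symmetric: the third derivatives and one of the second-order products by commuting
   derivatives, the two remaining products by exchanging with each other. *)
apply/eqP; rewrite subr_eq0; apply/eqP; apply: eq_bigr => i _; apply: add_congr.
  apply: scale_congr => //.
  have := vder_vder_const v u pp (svphi w i); by rewrite !const_field_self.
apply: eq_bigr => j _; apply: scale_congr; last by [].
rewrite (schwarz u v j); exact: leibniz_cross_swap.
Unshelve. all: by end_near. Qed.

End pullback.

(** * Differentiation under the integral sign *)

Section parametric_integral.
Variable R : realType.
Local Notation mu := (@lebesgue_measure R).

(** Domination by the constant [K] allows differentiation under the integral at 0. Since a primitive
    [Psi] of the derivative [psi 0] is at hand, the fundamental theorem of calculus evaluates the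
    resulting integral. *)
Lemma parametric_integral (phi psi : R -> R -> R) (Psi : R -> R) (d K : R) :
  0 < d ->
  (forall s : R, -d < s < d -> {within `[0, 1], continuous (phi s)}) ->
  (forall s t : R, -d < s < d -> 0 <= t <= 1 ->
    is_derive s 1 (fun s' => phi s' t) (psi s t)) ->
  (forall s t : R, -d < s < d -> 0 <= t <= 1 -> `|psi s t| <= K) ->
  {within `[0, 1], continuous (psi 0)} ->
  (forall t : R, 0 <= t <= 1 -> is_derive t 1 Psi (psi 0 t)) ->
  is_derive (0 : R) 1 (fun s => \int[mu]_(t in `[0, 1]) phi s t) (Psi 1 - Psi 0).
Proof.
move=> d0 cphi dphi bpsi cpsi dPsi.
have m01 : measurable (`[0%R, 1%R]%classic : set R) by exact: measurable_itv.
have itvP s : `]-d, d[%classic s -> -d < s < d by rewrite /= in_itv.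
have uP t : `[0%R, 1%R]%classic t -> 0 <= t <= 1 by rewrite /= in_itv.
have I0 : `]-d, d[%classic (0 : R) by rewrite /= in_itv /= oppr_lt0 d0.
have K0 : 0 <= K.
  by apply: le_trans (bpsi 0 0 (itvP _ I0) _); rewrite ?normr_ge0 ?lexx ?ler01.
have intphi s : `]-d, d[%classic s -> mu.-integrable `[0, 1] (EFin \o phi s).
  by move=> /itvP Is; apply: continuous_compact_integrable; [exact: segment_compact|exact: cphi].
have derphi s t : `]-d, d[%classic s -> `[0%R, 1%R]%classic t -> derivable (phi^~ t) s 1.
  by move=> /itvP Is /uP It; have [] := dphi s t Is It.
have intK : mu.-integrable `[0, 1] (EFin \o cst K).
  apply: continuous_compact_integrable; first exact: segment_compact.
  by apply: continuous_subspaceT => ?; exact: cst_continuous.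
have dE s t : `]-d, d[%classic s -> `[0%R, 1%R]%classic t -> partial1of2 phi s t = psi s t.
  by move=> /itvP Is /uP It; rewrite partial1of2E; have [_ ->] := dphi s t Is It.
have bphi s t : `]-d, d[%classic s -> `[0%R, 1%R]%classic t -> `|partial1of2 phi s t| <= cst K t.
  by move=> Is It; rewrite dE//; apply: bpsi; [exact: itvP|exact: uP].
have H := @cvg_differentiation_under_integral R _ _ mu phi _ m01 _ _ _ I0 intphi derphi (cst K) (fun=> K0) intK bphi.
have E : \int[mu]_(t in `[0, 1]) partial1of2 phi 0 t = Psi 1 - Psi 0.
  rewrite (@eq_Rintegral _ _ _ mu _ (psi 0)); last first.
    by move=> t; rewrite inE => It; exact: dE.
  rewrite /Rintegral (continuous_FTC2 ltr01 cpsi (F := Psi)).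
  - by rewrite -EFinB.
  - have cP (t : R) : 0 <= t <= 1 -> {for t, continuous Psi}.
      by move=> It; apply/differentiable_continuous/derivable1_diffP; have [] := dPsi t It.
    split.
    + by move=> t; rewrite in_itv/= => /andP[t0 t1]; have [] // := dPsi t; rewrite !ltW.
    + by apply: cvg_at_right_filter; apply: cP; rewrite lexx ler01.
    + by apply: cvg_at_left_filter; apply: cP; rewrite lexx ler01.
  - move=> t; rewrite in_itv/= => /andP[t0 t1].
    have It : 0 <= t <= 1 by rewrite !ltW.
    by rewrite derive1E; have [_ ->] := dPsi t It.
rewrite E in H.
have H' : h^-1 *: ((fun s => \int[mu]_(t in `[0, 1]) phi s t) (h *: (1:R) + 0) -
   \int[mu]_(t in `[0, 1]) phi 0 t) @[h --> 0^'] --> Psi 1 - Psi 0.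
  by under eq_fun do rewrite scaler1.
apply: DeriveDef; first by apply/cvg_ex; exists (Psi 1 - Psi 0).
exact: (cvg_lim _ H').
Qed.
End parametric_integral.

(** * The Poincare lemma for 1-forms on a ball *)

Section poincare.
Variable R : realType.

Lemma is_derive_sumf n (h : 'I_n -> R -> R) (x : R) (dh : 'I_n -> R) :
  (forall i, is_derive x 1 (h i) (dh i)) ->
  is_derive x 1 (fun y => \sum_i h i y) (\sum_i dh i).
Proof.
move=> H; have := is_derive_sum H; congr is_derive.
by apply/funext => y; rewrite fct_sumE.
Qed.

Lemma is_derive_mulf (f g : R -> R) (x df dg : R) :
  is_derive x 1 f df -> is_derive x 1 g dg ->
  is_derive x 1 (fun y => f y * g y) (f x * dg + g x * df).
Proof. exact: is_deriveM. Qed.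

Lemma is_derive_affine (a b x : R) : is_derive x 1 (fun y => y * a + b) a.
Proof.
have H := is_deriveD (is_derive_mulf (is_derive_id x 1) (is_derive_cst a x 1)) (is_derive_cst b x 1).
by apply: is_derive_eq H _; rewrite /= mulr0 mulr1 !add0r addr0.
Qed.

Lemma near0_norm_lt (V : normedModType R) (d : R) : 0 < d ->
  \forall h \near (0 : V), `|h| < d.
Proof.
move=> d0; apply/nbhs_ballP; exists d => // h.
by rewrite -ball_normE /ball_/= sub0r normrN.
Qed.

Lemma local_bound (V : normedModType R) (I : finType) (g : I -> V -> R) (z : V) :
  (forall i, {for z, continuous (g i)}) ->
  exists K, \forall y \near z, forall i, `|g i y| <= K.
Proof.
move=> cg; exists (\sum_i (`|g i z| + 1)).
apply: filter_forall => i.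
have gi : \forall y \near z, `|g i z - g i y| < 1.
  by have /cvgrPdist_lt := cg i; apply.
apply: filterS gi => y yi.
rewrite (bigD1 i)//= -[leLHS]addr0 lerD//; last first.
  by apply: sumr_ge0 => j _; rewrite addr_ge0.
rewrite -[g i y](subrK (g i z)) addrC (le_trans (ler_normD _ _))// lerD2l.
by rewrite distrC ltW.
Qed.

Variable n : nat.

(** Here [c] is a covector given by its components. The linear structure declared next makes
    [pairing c] eligible as a differential. *)
Definition pairing (c v : 'rV[R]_n) : R := \sum_i c 0 i * v 0 i.

Lemma pairing_is_linear c : linear (pairing c : _ -> R^o).
Proof.
move=> a u v; rewrite /pairing scaler_sumr -big_split; apply: eq_bigr => i _ /=.
by rewrite !mxE mulrDr mulrCA.
Qed.

HB.instance Definition _ c :=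
  GRing.isLinear.Build R 'rV[R]_n R^o _ (pairing c) (@pairing_is_linear c).

Lemma pairing_continuous c : continuous (pairing c).
Proof.
move=> v; apply: differentiable_continuous.
rewrite (_ : pairing c = \sum_i (fun v : 'rV[R]_n => c 0 i * v 0 i)).
  apply: differentiable_sum => i; apply: differentiableM => //.
  exact: differentiable_coord.
by apply/funext => w; rewrite fct_sumE.
Qed.

Lemma diff_basis (f : 'rV[R]_n -> R) z v :
  'd f z v = \sum_j v 0 j * 'd f z (delta_mx 0 j).
Proof.
rewrite [v in LHS]row_sum_delta linear_sum; apply: eq_bigr => j _.
by rewrite linearZ.
Qed.

Lemma coord_norm_le (v : 'rV[R]_n) i : `|v 0 i| <= `|v|.
Proof. by rewrite [leRHS]/Num.norm/= mx_normrE; exact: (le_bigmax _ _ (0, i)). Qed.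

(* Radial integration; closedness makes the derivative of the integrand in a
   direction [v] equal to the [t]-derivative of [t * c (z0 + t w) v]. *)
Lemma poincare_lemma (c : 'rV[R]_n -> 'rV[R]_n) (z0 : 'rV[R]_n) : smooth_near z0 c ->
  (\forall z \near z0, forall i j,
     'd (fun y => c y 0 i) z (delta_mx 0 j) = 'd (fun y => c y 0 j) z (delta_mx 0 i)) ->
  exists f : 'rV[R]_n -> R, \forall z \near z0,
    differentiable f z /\ 'd f z = pairing (c z) :> (_ -> _).
Proof.
move=> sc closed; pose ci i y := c y 0 i.
have sci z i : smooth_near z c -> smooth_near z (ci i).
  by move/(smooth_near_row _ _); apply.
have cci z i : smooth_near z c -> {for z, continuous (ci i)}.
  by move=> /(sci _ i)/smooth_near_differentiable/differentiable_continuous.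
have cdci z i v : smooth_near z c -> {for z, continuous (fun y => 'd (ci i) y v)}.
  by move=> /(sci _ i)/(smooth_near_diff v)/smooth_near_differentiable/differentiable_continuous.
have [K1 bK1] := local_bound (fun i => cci z0 i sc).
have [K2 bK2] := @local_bound _ ('I_n * 'I_n)%type (fun ij y => 'd (ci ij.1) y (delta_mx 0 ij.2)) z0
   (fun ij => cdci z0 ij.1 (delta_mx 0 ij.2) sc).
pose G z := [/\ smooth_near z c, forall i j, 'd (ci i) z (delta_mx 0 j) = 'd (ci j) z (delta_mx 0 i),
   forall i, `|ci i z| <= K1 & forall ij : 'I_n * 'I_n, `|'d (ci ij.1) z (delta_mx 0 ij.2)| <= K2].
have nG : \forall z \near z0, G z.
  have scn := smooth_near_open sc.
  by near=> z; split; near: z.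
move: nG => /nbhs_ballP[r /= r0 rG].
have GP w : `|w| < r -> G (w + z0).
  by move=> wr; apply: rG; rewrite -ball_normE /ball_ /= opprD addrCA subrr addr0 normrN.
pose F z := \int[@lebesgue_measure R]_(t in `[0, 1]) pairing (c (t *: (z - z0) + z0)) (z - z0).
have dirF z v : `|z - z0| < r -> is_derive (0 : R) 1 (fun s => F (s *: v + z)) (pairing (c z) v).
  move=> zr; set w := z - z0.
  (* For [|s| < d] the point [s *: v + w] keeps norm below [r], hence so do its multiples by [t] in
     [0, 1]. The added 1 covers [v = 0]. *)
  pose d := (r - `|w|) / (`|v| + 1).
  have v0 : 0 < `|v| + 1 by rewrite ltr_wpDl.
  have d0 : 0 < d by rewrite divr_gt0// subr_gt0.
  have yE (s t : R) : t *: (s *: v + w) + z0 = s *: (t *: v) + (t *: w + z0).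
    by rewrite scalerDr !scalerA [t * s]mulrC addrA.
  have wr (s t : R) : -d < s < d -> 0 <= t <= 1 -> `|t *: (s *: v + w)| < r.
    move=> sd /andP[t0 t1]; rewrite normrZ (ger0_norm t0).
    apply: (@le_lt_trans _ _ `|s *: v + w|); first by rewrite ler_piMl.
    apply: (le_lt_trans (ler_normD _ _)); rewrite normrZ -ltrBrDr.
    move: sd; rewrite -ltr_norml /d ltr_pdivlMr// => /le_lt_trans; apply.
    by rewrite ler_wpM2l// lerDl.
  have gG (s t : R) : -d < s < d -> 0 <= t <= 1 -> G (t *: (s *: v + w) + z0).
    by move=> sd t01; apply: GP; exact: wr.
  have I0 : - d < 0 < d by rewrite oppr_lt0 d0.
  have gG0 (t : R) : 0 <= t <= 1 -> G (t *: w + z0).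
    by move=> t01; have := gG 0 t I0 t01; rewrite scale0r add0r.
  pose phi s t := \sum_i ci i (t *: (s *: v + w) + z0) * (s * v 0 i + w 0 i).
  pose psi s t := \sum_i (ci i (t *: (s *: v + w) + z0) * v 0 i +
     (s * v 0 i + w 0 i) * 'd (ci i) (t *: (s *: v + w) + z0) (t *: v)).
  pose Psi t := \sum_i (t * (ci i (t *: w + z0) * v 0 i)).
  have dline z' u i (t : R) : G (t *: u + z') ->
      is_derive t 1 (fun t => ci i (t *: u + z')) ('d (ci i) (t *: u + z') u).
    by move=> [sG _ _ _]; apply: is_derive_line; exact/smooth_near_differentiable/sci.
  have psi0 : psi 0 = fun t => \sum_i (ci i (t *: w + z0) * v 0 i + w 0 i * (t * 'd (ci i) (t *: w + z0) v)).
    apply/funext => t'; apply: eq_bigr => i _.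
    by rewrite scale0r add0r mul0r add0r linearZ.
  have := @parametric_integral R phi psi Psi d
    (\sum_i (K1 * `|v 0 i| + (d * `|v 0 i| + `|w 0 i|) * (\sum_j `|v 0 j| * K2))) d0.
  have -> : Psi 1 - Psi 0 = pairing (c z) v.
    rewrite /Psi [X in _ - X]big1 ?subr0 => [|i _]; last by rewrite mul0r.
    by apply: eq_bigr => i _; rewrite mul1r scale1r /w subrK.
  have -> : (fun s => \int[@lebesgue_measure R]_(t in `[0, 1]) phi s t) = fun s => F (s *: v + z).
    apply/funext => s; apply: eq_Rintegral => t _; rewrite /phi /pairing.
    by apply: eq_bigr => i _; rewrite -addrA -/w !mxE.
  apply.
  - move=> s sd; apply: continuous_in_subspaceT => t; rewrite inE /= in_itv /= => t01.
    apply/differentiable_continuous/derivable1_diffP.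
    have H := is_derive_sumf (fun i => is_derive_mulf
      (dline z0 (s *: v + w) i t (gG s t sd t01)) (is_derive_cst (s * v 0 i + w 0 i) t 1)).
    exact: (@ex_derive _ _ _ _ _ _ _ H).
  - move=> s t sd t01; rewrite /psi /phi; under eq_fun do under eq_bigr do rewrite yE.
    apply: is_derive_sumf => i; rewrite yE.
    apply: is_derive_mulf; last exact: is_derive_affine.
    by apply: dline; rewrite -yE; exact: gG.
  - move=> s t sd t01; have [_ _ G1 G2] := gG s t sd t01.
    apply: (le_trans (ler_norm_sum _ _ _)); apply: ler_sum => i _.
    apply: (le_trans (ler_normD _ _)); apply: lerD.
      by rewrite normrM ler_wpM2r//; exact: G1.
    rewrite normrM; apply: ler_pM => //.
      apply: (le_trans (ler_normD _ _)); rewrite lerD2r normrM ler_wpM2r//.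
      by move: sd; rewrite -ltr_norml => /ltW.
    rewrite linearZ/= normrM (_ : _ * _ <= _)//.
    move: t01 => /andP[t0 t1]; rewrite (ger0_norm t0).
    apply: le_trans (ler_piMl _ t1) _ => //.
    rewrite diff_basis; apply: (le_trans (ler_norm_sum _ _ _)); apply: ler_sum => j _.
    by rewrite normrM ler_wpM2l//; exact: (G2 (i, j)).
  - apply: continuous_in_subspaceT => t; rewrite inE /= in_itv /= => t01.
    have [sG _ _ _] := gG0 t t01.
    rewrite psi0.
    apply/differentiable_continuous/derivable1_diffP.
    have H i := is_deriveD
      (is_derive_mulf (dline z0 w i t (gG0 t t01)) (is_derive_cst (v 0 i) t 1))
      (is_derive_mulf (is_derive_cst (w 0 i) t 1) (is_derive_mulf (is_derive_id t 1)
        (is_derive_line (smooth_near_differentiable (smooth_near_diff v (sci _ i sG)))))).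
    exact: (@ex_derive _ _ _ _ _ _ _ (is_derive_sumf H)).
  - move=> t t01; have [sG G1 _ _] := gG0 t t01.
    have H i := is_derive_mulf (is_derive_id t 1)
      (is_derive_mulf (dline z0 w i t (gG0 t t01)) (is_derive_cst (v 0 i) t 1)).
    apply: is_derive_eq (is_derive_sumf H) _.
    rewrite psi0 !big_split /= addrC; congr (_ + _).
      by apply: eq_bigr => i _; rewrite mulr1.
    under eq_bigr do rewrite mulr0 add0r diff_basis !mulr_sumr.
    under [RHS]eq_bigr do rewrite diff_basis !mulr_sumr.
    rewrite exchange_big/=; apply: eq_bigr => i _; apply: eq_bigr => j _.
    by rewrite (G1 j i) /cst; ring.
exists F; apply/nbhs_ballP; exists r => //= z; rewrite -ball_normE /ball_/= distrC => zr.
(* So far only directional derivatives of [F] are known. The mean value theorem on the segment from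
   [z] to [h + z], together with the continuity of [c], upgrades them to a differential. *)
apply: eps_diff; first exact: pairing_continuous.
move=> e e0.
have [sG _ _ _] : G z by have := GP (z - z0) zr; rewrite subrK.
(* There are [n] components to sum; dividing by [n + 1] also covers [n = 0]. *)
have e1 : 0 < e / n.+1%:R by rewrite divr_gt0.
have cz : \forall h \near (0 : 'rV[R]_n), forall i, `|ci i (h + z) - ci i z| < e / n.+1%:R.
  suff H i : \forall h \near (0 : 'rV[R]_n), `|ci i (h + z) - ci i z| < e / n.+1%:R.
    exact: filter_forall H.
  have H : \forall t \near z, `|ci i z - ci i t| < e / n.+1%:R.
    by have /cvgrPdist_lt/(_ _ e1) := cci z i sG.
  move: H; rewrite (near_shift (0 : 'rV[R]_n) z) subr0; apply: filterS => h /=.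
  by rewrite distrC.
move: cz => /nbhs_ballP[d /= d0 dH].
have rz : 0 < r - `|z - z0| by rewrite subr_gt0.
have nd : \forall h \near (0 : 'rV[R]_n), `|h| < d by exact: near0_norm_lt.
have nr : \forall h \near (0 : 'rV[R]_n), `|h| < r - `|z - z0| by exact: near0_norm_lt.
near=> h.
have hd : `|h| < d by near: h; exact: nd.
have hr : `|h| < r - `|z - z0|.
  by near: h; exact: nr.
have gs (s : R) : 0 <= s <= 1 -> is_derive s 1 (fun s => F (s *: h + z)) (pairing (c (s *: h + z)) h).
  move=> /andP[s0 s1].
  have sr : `|s *: h + z - z0| < r.
    rewrite -addrA (le_lt_trans (ler_normD _ _))// normrZ (ger0_norm s0) -ltrBrDr.
    by apply: le_lt_trans hr; rewrite ler_piMl.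
  have D := dirF _ h sr.
  have -> : (fun s' : R => F (s' *: h + z)) = (fun s' => F (s' *: h + (s *: h + z))) \o shift (- s).
    by apply/funext => s' /=; rewrite scalerBl addrA subrK.
  rewrite -[X in is_derive _ _ _ X]mulr1; apply: is_derive1_comp; last exact: is_derive_shift.
  by rewrite /= subrr.
have gd (s : R) : s \in `]0, 1[ ->
    is_derive s 1 (fun s => F (s *: h + z)) (pairing (c (s *: h + z)) h).
  by rewrite in_itv/= => /andP[s0 s1]; apply: gs; rewrite !ltW.
have gc : {within `[0, 1], continuous (fun s : R => F (s *: h + z))}.
  apply: derivable_within_continuous => s; rewrite in_itv /= => /gs Hs.
  exact: (@ex_derive _ _ _ _ _ _ _ Hs).
have [s] := MVT ltr01 gd gc.
rewrite in_itv /= => /andP[s0 s1]; rewrite scale1r scale0r add0r subr0 mulr1 => ->.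
have sh : `|s *: h| < d.
  by rewrite normrZ (gtr0_norm s0); apply: le_lt_trans hd; rewrite ler_piMl// ltW.
rewrite /pairing -sumrB.
apply: (@le_trans _ _ (\sum_(i < n) e / n.+1%:R * `|h|)).
  apply: (le_trans (ler_norm_sum _ _ _)); apply: ler_sum => i _.
  rewrite -mulrBl normrM ler_pM//; last exact: coord_norm_le.
  by apply/ltW/dH; rewrite -ball_normE /ball_ /= sub0r normrN.
rewrite sumr_const card_ord -[leLHS]mulr_natl mulrA ler_wpM2r//.
by rewrite mulrCA ger_pMr// ler_pdivrMr// mul1r ler_nat.
Unshelve. all: by end_near. Qed.
End poincare.

(** * Level sets as smooth graphs *)

Section implicit_function.
Variable R : realType.

Lemma mulmxr_continuous k n (A : 'M[R]_(k, n)) :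
  continuous (mulmxr A : 'rV[R]_k -> 'rV[R]_n).
Proof.
move=> y; apply: differentiable_continuous; apply: differentiable_row => i.
rewrite (_ : (fun y => _) = \sum_j (fun y : 'rV[R]_k => y 0 j * A j i)).
  by apply: differentiable_sum => j; apply: differentiableM => //; exact: differentiable_coord.
by apply/funext => w; rewrite fct_sumE /= mxE.
Qed.

Lemma mulmxr_bound k n (A : 'M[R]_(k, n)) :
  exists2 m, 0 < m & forall y : 'rV[R]_k, `|y *m A| <= m * `|y|.
Proof. exact: (linear_lipschitz (f := mulmxr A) (@mulmxr_continuous k n A)). Qed.

Lemma sign_stable (a b c : R) : `|a - b| < a - c -> 0 < b - c.
Proof. by rewrite ltr_norml => /andP[_]; lra. Qed.

Lemma sign_stableN (a b c : R) : `|a - b| < - (a - c) -> b - c < 0.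
Proof. by rewrite ltr_norml => /andP[+ _]; lra. Qed.

Lemma Ck_smooth_near (V W : normedModType R) j (U : set V) (g : V -> W) :
  (forall z, U z -> smooth_near z g) -> Ck_on j U g.
Proof. by move=> Hg; apply: Ck_local => z /Hg[U' oU' Cg]; exists U'. Qed.

Lemma pairing_mulmx k n (c : 'rV[R]_n) (v : 'rV[R]_k) (A : 'M[R]_(k, n)) :
  pairing c (v *m A) = pairing (c *m A^T) v.
Proof.
rewrite /pairing; under eq_bigr do rewrite mxE mulr_sumr.
rewrite exchange_big; apply: eq_bigr => j _; rewrite mxE mulr_suml.
by apply: eq_bigr => i _; rewrite !mxE mulrCA mulrC.
Qed.

Lemma pairingB n (c d v : 'rV[R]_n) : pairing (c - d) v = pairing c v - pairing d v.
Proof. by rewrite /pairing -sumrB; apply: eq_bigr => i _; rewrite !mxE mulrBl. Qed.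

Lemma pairingN n (c v : 'rV[R]_n) : pairing (- c) v = - pairing c v.
Proof. by rewrite /pairing -sumrN; apply: eq_bigr => i _; rewrite !mxE mulNr. Qed.

Lemma smooth_affine k n (A : 'M[R]_(k, n)) (b : 'rV[R]_n) y :
  smooth_near y (fun y => y *m A + b).
Proof.
apply: smooth_near_add (smooth_near_cst _ _).
exact: (smooth_near_lin (@mulmxr_continuous k n A) (smooth_near_id y)).
Qed.

Lemma pairing_bound n (c v : 'rV[R]_n) K : (forall i, `|c 0 i| <= K) ->
  `|pairing c v| <= n%:R * K * `|v|.
Proof.
move=> cK; apply: (le_trans (ler_norm_sum _ _ _)).
apply: (@le_trans _ _ (\sum_(i < n) K * `|v|)).
  by apply: ler_sum => i _; rewrite normrM ler_pM//; exact: coord_norm_le.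
by rewrite sumr_const card_ord -[leLHS]mulr_natl mulrA.
Qed.

Lemma ball_segment (V : normedModType R) (x y z : V) (t r : R) :
  0 <= t <= 1 -> `|x - z| < r -> `|y - z| < r -> `|t *: (y - x) + x - z| < r.
Proof.
move=> /andP[t0 t1] xr yr.
have -> : t *: (y - x) + x - z = t *: (y - z) + (1 - t) *: (x - z).
  have -> : y - x = (y - z) - (x - z) by rewrite opprB addrA subrK.
  by rewrite scalerBr scalerBl scale1r -!addrA [- _ + (x - z)]addrC addrA.
apply: (le_lt_trans (ler_normD _ _)); rewrite !normrZ (ger0_norm t0) ger0_norm ?subr_ge0//.
have [->|t0'] := eqVneq t 0; first by rewrite mul0r add0r subr0 mul1r.
apply: (@lt_le_trans _ _ (t * r + (1 - t) * r)).
  apply: ltr_leD; first by rewrite ltr_pM2l// lt0r t0' t0.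
  by rewrite ler_wpM2l ?subr_ge0// ltW.
by rewrite -mulrDl addrC subrK mul1r.
Qed.

Variables (n k : nat) (f : 'rV[R]_n -> R) (q : 'rV[R]_n -> 'rV[R]_n).
Variables (z0 e : 'rV[R]_n) (A : 'M[R]_(k, n)) (r K : R).
Hypothesis r0 : 0 < r.
Hypothesis df : forall z, `|z - z0| < r -> differentiable f z.
Hypothesis dfe : forall z, `|z - z0| < r -> 0 < 'd f z e.
Hypothesis dfq : forall z v, `|z - z0| < r ->
  'd f z v = 'd f z e * pairing (q z) v.
Hypothesis qe : forall z, `|z - z0| < r -> pairing (q z) e = 1.
Hypothesis sq : forall z, `|z - z0| < r -> smooth_near z q.
Hypothesis qK : forall z i, `|z - z0| < r -> `|q z 0 i| <= K.

(** Coordinates adapted to the graph: [y] runs along the rows of [A], and [s] along the direction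
    [e] in which [f] increases. *)
Let J (y : 'rV[R]_k) (s : R) := s *: e + (y *m A + z0).

Lemma level_secant (x y : 'rV[R]_n) : `|x - z0| < r -> `|y - z0| < r ->
  exists2 t, 0 < t < 1 & f y - f x =
    'd f (t *: (y - x) + x) e * pairing (q (t *: (y - x) + x)) (y - x).
Proof.
move=> xr yr; have [t t01|t t01] := @MVT_line R _ f (y - x) x 1 ltr01.
  by apply: df; exact: ball_segment.
have tr : `|t *: (y - x) + x - z0| < r.
  by apply: ball_segment => //; case/andP: t01 => /ltW-> /ltW->.
have -> : 1 *: (y - x) + x = y by rewrite scale1r subrK.
rewrite mul1r => E; exists t; first exact: t01.
exact: (etrans E (dfq (y - x) tr)).
Qed.

(** The height [h y] comes from the intermediate value theorem along [e]. The mean value theorem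
    between two points of the level set makes [h] Lipschitz, then differentiable, with ['d h]
    expressed by [q] along the graph. Smoothness is assumed of the normalized gradient [q], while
    [f] is only differentiable: this matches what a primitive built by integration offers. *)
Lemma implicit_graph : exists (h : 'rV[R]_k -> R) (a : R),
  [/\ 0 < a, h 0 = 0 & forall y, `|y| < a ->
   [/\ `|h y *: e + (y *m A + z0) - z0| < r, smooth_near y h &
     forall v, 'd h y v = - pairing (q (h y *: e + (y *m A + z0))) (v *m A)]].
Proof.
have [m m0 mA] := mulmxr_bound A.
(* With [|s| <= b] and [|y| < a1], the vectors [s *: e] and [y *m A] each have norm at most [r / 2],
   so that [J y s] remains in the ball where the hypotheses hold. *)
pose b := r / 2 / (`|e| + 1).
have e1 : 0 < `|e| + 1 by rewrite ltr_wpDl.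
have r2 : 0 < r / 2 by rewrite divr_gt0.
have b0 : 0 < b by rewrite divr_gt0.
have be : b * `|e| <= r / 2.
  by rewrite /b -mulrA ger_pMr// ler_pdivrMl// mulr1 lerDl.
pose a1 := r / 2 / m.
have a10 : 0 < a1 by rewrite divr_gt0.
have Jr y s : `|y| < a1 -> -b <= s <= b -> `|J y s - z0| < r.
  move=> ya sb; rewrite /J addrA addrK (le_lt_trans (ler_normD _ _))// [ltRHS](splitr r).
  apply: ler_ltD.
    by rewrite normrZ; apply: le_trans be; rewrite ler_wpM2r// ler_norml.
  by apply: (le_lt_trans (mA y)); rewrite mulrC -ltr_pdivlMr.
have J0 : J 0 0 = z0 by rewrite /J scale0r mul0mx !add0r.
have bb : -b <= b <= b by rewrite lexx andbT -subr_ge0 opprK addr_ge0 ?ltW.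
have bb' : -b <= -b <= b by rewrite lexx /= -subr_ge0 opprK addr_ge0 ?ltW.
have bb0 : -b <= 0 <= b by rewrite oppr_le0 ltW.
(* As [pairing (q z) e = 1], the increment of [f] separates into an [s]-part and a [y]-part. Since
   ['d f z e > 0], equal values of [f] determine [s2 - s1]. *)
have secant y1 y2 s1 s2 : `|y1| < a1 -> `|y2| < a1 -> -b <= s1 <= b -> -b <= s2 <= b ->
    exists2 t, 0 < t < 1 & let z := t *: (J y2 s2 - J y1 s1) + J y1 s1 in
    `|z - z0| < r /\
    f (J y2 s2) - f (J y1 s1) = 'd f z e * (s2 - s1 + pairing (q z) ((y2 - y1) *m A)).
  move=> y1a y2a s1b s2b.
  have [t t01 ->] := level_secant (Jr _ _ y1a s1b) (Jr _ _ y2a s2b).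
  pose z := t *: (J y2 s2 - J y1 s1) + J y1 s1.
  have zr : `|z - z0| < r.
    by apply: ball_segment; rewrite ?Jr//; case/andP: t01 => /ltW-> /ltW->.
  exists t; first by [].
  split; first exact: zr.
  rewrite -/z; congr (_ * _).
  have -> : J y2 s2 - J y1 s1 = (s2 - s1) *: e + (y2 - y1) *m A.
    by rewrite /J mulmxBl scalerBl opprD addrACA; congr (_ + _); rewrite opprD addrACA subrr addr0.
  rewrite linearD linearZ /=; congr (_ + _).
  by rewrite -[LHS]/((s2 - s1) * pairing _ e) qe// mulr1.
have z0a : `|0 : 'rV[R]_k| < a1 by rewrite normr0.
have p0 z : pairing (q z) ((0 - 0 : 'rV_k) *m A) = 0.
  by rewrite subrr mul0mx linear0.
have fb : 0 < f (J 0 b) - f z0.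
  have [t _ /=] := secant _ _ _ _ z0a z0a bb0 bb; rewrite J0 => -[zr ->].
  apply: mulr_gt0; first exact: dfe.
  by rewrite p0 addr0 subr0.
have fb' : f (J 0 (-b)) - f z0 < 0.
  have [t _ /=] := secant _ _ _ _ z0a z0a bb0 bb'; rewrite J0 => -[zr ->].
  rewrite p0 addr0 subr0 mulrN oppr_lt0.
  by apply: mulr_gt0; first exact: dfe.
have cJ s y : -b <= s <= b -> `|y| < a1 -> {for y, continuous (fun y => f (J y s))}.
  move=> sb ya; have cf : {for J y s, continuous f}.
    by apply: differentiable_continuous; apply: df; exact: Jr.
  have cJ : {for y, continuous (J^~ s)}.
    apply/differentiable_continuous/smooth_near_differentiable.
    exact: (smooth_near_add (smooth_near_cst _ _) (smooth_affine A z0 y)).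
  exact: (continuous_comp cJ cf).
have nb : \forall y \near (0 : 'rV[R]_k), 0 < f (J y b) - f z0.
  have := cJ b 0 bb z0a; move=> /cvgrPdist_lt/(_ _ fb); apply: filterS => y.
  exact: sign_stable.
have nb' : \forall y \near (0 : 'rV[R]_k), f (J y (-b)) - f z0 < 0.
  have := cJ (-b) 0 bb' z0a; have fb2 : 0 < - (f (J 0 (-b)) - f z0) by rewrite oppr_gt0.
  move=> /cvgrPdist_lt/(_ _ fb2); apply: filterS => y.
  exact: sign_stableN.
have nba : \forall y \near (0 : 'rV[R]_k), [/\ `|y| < a1, 0 < f (J y b) - f z0 & f (J y (-b)) - f z0 < 0].
  have na : \forall y \near (0 : 'rV[R]_k), `|y| < a1 by exact: near0_norm_lt.
  by near=> y; split; near: y.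
move: nba => /nbhs_ballP[a /= a0 aH].
have aP y : `|y| < a -> [/\ `|y| < a1, 0 < f (J y b) - f z0 & f (J y (-b)) - f z0 < 0].
  by move=> ya; apply: aH; rewrite -ball_normE /ball_ /= sub0r normrN.
(* For [|y| < a] a root exists, because [f (J y _) - f z0] has opposite signs at [-b] and [b], so
   the default 0 is not reached there. *)
pose h y := xget 0 [set s | -b <= s <= b /\ f (J y s) = f z0].
have hP y : `|y| < a -> -b <= h y <= b /\ f (J y (h y)) = f z0.
  move=> /aP[ya1 y1 y2]; rewrite /h; case: xgetP => [s _ //|/=].
  have cs : {within `[-b, b], continuous (fun s => f (J y s))}.
    apply: derivable_within_continuous => s; rewrite in_itv /= => sb.
    by have [] := is_derive_line (f := f) (u := e) (df (Jr _ _ ya1 sb)).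
  have lebb : -b <= b by case/andP: bb.
  have [|s] := @IVT R _ (-b) b (f z0) lebb cs.
    have l1 : f (J y (-b)) <= f z0 by rewrite -subr_le0 ltW.
    have l2 : f z0 <= f (J y b) by rewrite -subr_ge0 ltW.
    by rewrite ge_min le_max l1 l2 orbT.
  by rewrite in_itv /= => sb fs /(_ s)[].
exists h, a.
(* The mean value point [z] is also kept no farther from the first graph point than the second one
   is; this lets [q z] tend to [q (J y (h y))] when [h] is differentiated. *)
have dh y1 y2 : `|y1| < a -> `|y2| < a -> exists2 z,
    [/\ `|z - z0| < r & `|z - J y1 (h y1)| <= `|J y2 (h y2) - J y1 (h y1)|] &
    h y2 - h y1 = - pairing (q z) ((y2 - y1) *m A).
  move=> y1a y2a; have [y1a1 _ _] := aP _ y1a; have [y2a1 _ _] := aP _ y2a.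
  have [h1 f1] := hP _ y1a; have [h2 f2] := hP _ y2a.
  have [t t01 /= [zr]] := secant _ _ _ _ y1a1 y2a1 h1 h2.
  rewrite f1 f2 subrr => /esym/eqP; rewrite mulf_eq0 gt_eqF ?dfe//= addr_eq0 => /eqP E.
  exists (t *: (J y2 (h y2) - J y1 (h y1)) + J y1 (h y1)); last exact: E.
  split=> //; rewrite addrK normrZ; case/andP: t01 => /ltW t0 /ltW t1.
  by rewrite ger0_norm// ler_piMl.
(* [xget] returns some root; at [y = 0] the strict increase of [f] along [e] leaves only 0. *)
have h0 : h 0 = 0.
  have [_ f0] : -b <= h 0 <= b /\ f (J 0 (h 0)) = f z0 by apply: hP; rewrite normr0.
  have [hb _] : -b <= h 0 <= b /\ f (J 0 (h 0)) = f z0 by apply: hP; rewrite normr0.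
  have [t _ /=] := secant _ _ _ _ z0a z0a bb0 hb.
  rewrite J0 f0 => -[zr]; rewrite subrr p0 addr0 subr0 => /esym/eqP.
  by rewrite mulf_eq0 gt_eqF ?dfe//= => /eqP.
pose L := n%:R * K * m.
have lip y1 y2 : `|y1| < a -> `|y2| < a -> `|h y2 - h y1| <= `|L| * `|y2 - y1|.
  move=> y1a y2a; have [z [zr _] ->] := dh _ _ y1a y2a; rewrite normrN.
  apply: (le_trans (pairing_bound _ (fun i => qK i zr))).
  have nK : 0 <= n%:R * K.
    rewrite -[n in n%:R]card_ord -sum1_card natr_sum mulr_suml sumr_ge0// => i _.
    by rewrite mul1r; apply: le_trans (qK i zr).
  rewrite /L (ger0_norm (mulr_ge0 nK (ltW m0))).
  apply: (@le_trans _ _ (n%:R * K * (m * `|y2 - y1|))); last by rewrite mulrA.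
  by rewrite ler_wpM2l.
have dhE y : `|y| < a -> differentiable h y /\
    forall v, 'd h y v = - pairing (q (J y (h y))) (v *m A).
  move=> ya; have [h1 _] := hP _ ya; have [ya1 _ _] := aP _ ya.
  have jr := Jr _ _ ya1 h1.
  pose D : 'rV[R]_k := - (q (J y (h y)) *m A^T).
  suff [dh1 dh2] : differentiable h y /\ 'd h y = pairing D :> (_ -> _).
    split=> // v; rewrite pairing_mulmx -pairingN; exact: (congr1 (fun g => g v) dh2).
  apply: eps_diff; first exact: pairing_continuous.
  move=> eps eps0; pose eps1 := eps / n.+1%:R / m.
  have eps10 : 0 < eps1 by rewrite !divr_gt0.
  have cq : {for J y (h y), continuous q}.
    exact/differentiable_continuous/smooth_near_differentiable/sq.
  have : \forall z \near J y (h y), `|q (J y (h y)) - q z| < eps1.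
    by move: cq => /cvgrPdist_lt/(_ _ eps10).
  move=> /nbhs_ballP[d /= d0 dH].
  (* A step [v] in the parameter moves the graph point by at most [C * |v|]: [|L| * |e|] bounds the
     contribution of [h], and [m] that of [A]. *)
  pose C := `|L| * `|e| + m.
  have C0 : 0 < C by rewrite ltr_wpDl ?mulr_ge0.
  have dC0 : 0 < d / C by rewrite divr_gt0.
  have ay0 : 0 < a - `|y| by rewrite subr_gt0.
  have n1 : \forall v \near (0 : 'rV[R]_k), `|v| < d / C by exact: near0_norm_lt.
  have n2 : \forall v \near (0 : 'rV[R]_k), `|v| < a - `|y| by exact: near0_norm_lt.
  near=> v.
  have v1 : `|v| < d / C by near: v; exact: n1.
  have v2 : `|v| < a - `|y| by near: v; exact: n2.
  have vya : `|v + y| < a by rewrite (le_lt_trans (ler_normD _ _))// -ltrBrDr.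
  have [z [zr zJ] ->] := dh _ _ ya vya; rewrite addrK.
  have vy : `|h (v + y) - h y| <= `|L| * `|v| by have := lip _ _ ya vya; rewrite addrK.
  have zd : `|J y (h y) - z| < d.
    rewrite distrC; apply: (le_lt_trans zJ).
    have -> : J (v + y) (h (v + y)) - J y (h y) = (h (v + y) - h y) *: e + v *m A.
      rewrite /J mulmxDl scalerBl opprD addrACA; congr (_ + _).
      by rewrite opprD addrACA subrr addr0 addrK.
    apply: (@le_lt_trans _ _ (`|v| * C)); last by rewrite -ltr_pdivlMr.
    rewrite /C mulrDr (le_trans (ler_normD _ _))// lerD//; last by rewrite mulrC.
    by rewrite normrZ mulrA [`|v| * _]mulrC ler_wpM2r.
  rewrite /D pairingN -pairing_mulmx -opprD normrN -pairingN -[X in `|X|]opprK.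
  have -> : - (pairing (q z) (v *m A) + pairing (- q (J y (h y))) (v *m A))
     = pairing (q (J y (h y)) - q z) (v *m A) by rewrite pairingN pairingB opprD opprK addrC.
  rewrite normrN.
  have qb i : `|(q (J y (h y)) - q z) 0 i| <= eps1.
    apply: (le_trans (coord_norm_le _ _)); apply/ltW/dH.
    by rewrite -ball_normE.
  apply: (le_trans (pairing_bound _ qb)).
  apply: (@le_trans _ _ (n%:R * eps1 * (m * `|v|))).
    by rewrite ler_wpM2l// mulr_ge0// ltW.
  rewrite mulrA ler_wpM2r// /eps1 -mulrA divfK ?gt_eqF// mulrCA ger_pMr//.
  by rewrite ler_pdivrMr// mul1r ler_nat.
pose Ua := [set y : 'rV[R]_k | `|y| < a].
have oUa : open Ua.
  rewrite (_ : Ua = ball 0 a); first exact: ball_open.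
  by rewrite -ball_normE; apply/seteqP; split => y; rewrite /Ua /ball_ /= sub0r normrN.
pose Ur := [set z | `|z - z0| < r].
have Jry y : Ua y -> Ur (J y (h y)).
  by move=> ya; have [h1 _] := hP _ ya; have [ya1 _ _] := aP _ ya; exact: Jr.
(* Bootstrapping: ['d h] is a smooth expression in the graph point, which is as regular as [h];
   hence class C^j implies class C^(j+1). *)
have sh j : Ck_on j Ua h.
  elim: j => [|j IH]; first by move=> y /dhE[/differentiable_continuous].
  split=> [y /dhE[]//|v].
  have CJ : Ck_on j Ua (fun y => J y (h y)).
    apply/(Ck_rowP _ _ oUa) => i.
    have C1 : Ck_on j Ua (fun y => h y * e 0 i + (y *m A + z0) 0 i).
      apply: (Ck_add oUa).
        by apply: (Ck_mul oUa IH); exact: Ck_cst.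
      apply: Ck_smooth_near => y _.
      by have /smooth_near_row := smooth_affine A z0 y; apply.
    by apply: (Ck_eq oUa) C1 => y _; rewrite /J !mxE.
  have Cq i : Ck_on j Ur (fun z => q z 0 i).
    by apply: Ck_smooth_near => z /sq/smooth_near_row; apply.
  have C2 : Ck_on j Ua (fun y => - \sum_i q (J y (h y)) 0 i * (v *m A) 0 i).
    apply: (Ck_opp oUa); apply: (Ck_sum _ oUa) => i; apply: (Ck_mul oUa).
      exact: (Ck_comp oUa Jry CJ (Cq i)).
    exact: Ck_cst.
  by apply: (Ck_eq oUa) C2 => y /dhE[_ /(_ v)] ->.
split=> // y ya; split; first exact: Jry.
  by exists Ua.
by have [] := dhE _ ya.
Unshelve. all: by end_near. Qed.
End implicit_function.

(** * An open ball as a manifold with a single chart *)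

Section ball_manifold.
Variables (R : realType) (k : nat) (r : R).
Hypothesis r0 : 0 < r.
Let rball : set 'rV[R]_k := [set y | `|y| < r].

Lemma rball_open : open rball.
Proof.
rewrite (_ : rball = ball 0 r); first exact: ball_open.
by rewrite -ball_normE; apply/seteqP; split => y; rewrite /rball /ball_ /= sub0r normrN.
Qed.

Definition rball_pt (y : 'rV[R]_k) (yr : `|y| < r) : rball :=
  exist _ y (mem_set yr).

Lemma rball_center : `|0 : 'rV[R]_k| < r. Proof. by rewrite normr0. Qed.

(** A chart needs a total inverse; outside the ball the centre is an arbitrary value. *)
Definition rball_inv (y : 'rV[R]_k) : rball :=
  if pselect (`|y| < r) is left yr then rball_pt yr else rball_pt rball_center.

Definition rball_val (l : rball) : 'rV[R]_k := \val l.

Lemma rball_valP l : `|rball_val l| < r.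
Proof. exact: (set_valP l). Qed.

Lemma rball_invK l : rball_inv (rball_val l) = l.
Proof.
rewrite /rball_inv; case: pselect => [yr|]; last by move/(_ (rball_valP l)).
exact: val_inj.
Qed.

Lemma rball_valK y : `|y| < r -> rball_val (rball_inv y) = y.
Proof. by move=> yr; rewrite /rball_inv; case: pselect. Qed.

Lemma rball_val_continuous : continuous rball_val.
Proof. exact: initial_continuous. Qed.

Lemma rball_nbhsP l (O : set rball) : nbhs l O ->
  exists2 W : set 'rV[R]_k, open_nbhs (rball_val l) W & rball_val @^-1` W `<=` O.
Proof. by move=> [?/= [[W oW <-] Wl sO]]; exists W. Qed.

Lemma rball_inv_continuous l : {for rball_val l, continuous rball_inv}.
Proof.
move=> O; rewrite /= rball_invK => /rball_nbhsP[W oW sO]; rewrite nbhs_simpl /=.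
have nW := open_nbhs_nbhs oW.
have nr : nbhs (rball_val l) rball.
  by apply: open_nbhs_nbhs; split; [exact: rball_open|exact: rball_valP].
near=> y; apply: sO; rewrite /preimage/= rball_valK; first by near: y.
by near: y.
Unshelve. all: by end_near. Qed.

Lemma rball_im : rball_val @` [set: rball] = rball.
Proof.
apply/seteqP; split=> [_ [l _ <-]|y yr]; first exact: rball_valP.
by exists (rball_inv y) => //; rewrite rball_valK.
Qed.

Lemma rball_im_open : open (rball_val @` [set: rball]).
Proof. by rewrite rball_im; exact: rball_open. Qed.

Definition rball_chart : chart R k rball :=
  @Chart R k rball [set: rball] rball_val rball_inv openT rball_im_open
    (fun l _ => rball_invK l) (fun l _ => @rball_val_continuous l)
    (fun l _ => @rball_inv_continuous l).

Lemma rball_hausdorff : hausdorff_space rball.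
Proof.
move=> l l' H; apply: val_inj; apply: (@norm_hausdorff R 'rV[R]_k).
move=> A A' nA nA'.
have nB : nbhs l (rball_val @^-1` A) by exact: (@rball_val_continuous l).
have nB' : nbhs l' (rball_val @^-1` A') by exact: (@rball_val_continuous l').
by have [x [Ax Ax']] := H _ _ nB nB'; exists (rball_val x).
Qed.

(** The ball is the union of its radial segments, which all contain the centre. *)
Lemma rball_connected : connected [set: rball].
Proof.
have -> : [set: rball] = \bigcup_(l in [set: rball])
    ((fun t : R => rball_inv (t *: rball_val l)) @` `[0, 1]).
  apply/seteqP; split=> // l _; exists l => //; exists 1.
    by rewrite /= in_itv /= ler01 lexx.
  by rewrite scale1r rball_invK.
apply: bigcup_connected.
  exists (rball_inv 0) => l _; exists 0; first by rewrite /= in_itv /= lexx ler01.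
  by rewrite scale0r.
move=> l _; apply: connected_continuous_connected; first exact: segment_connected.
apply: continuous_in_subspaceT => t; rewrite inE /= in_itv /= => /andP[t0 t1].
have tr : `|t *: rball_val l| < r.
  rewrite normrZ (ger0_norm t0); apply: le_lt_trans (rball_valP l).
  by rewrite ler_piMl.
have c1 : {for t, continuous (fun t : R => t *: rball_val l)} by exact: scalel_continuous.
have c2 : {for t *: rball_val l, continuous rball_inv}.
  by rewrite -(rball_valK tr); exact: rball_inv_continuous.
exact: (continuous_comp c1 c2).
Qed.

Lemma rball_compat (l l' : rball) : smooth_on
  (chart_map rball_chart @` (chart_dom rball_chart `&` chart_dom rball_chart))
  (chart_map rball_chart \o chart_inv rball_chart).
Proof.
rewrite setIid => j; rewrite [X in Ck_on _ X](_ : _ = rball); last exact: rball_im.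
apply: (@Ck_eq _ _ _ _ _ id); first exact: rball_open.
  by move=> y yr; rewrite /= rball_valK.
by apply: Ck_smooth_near => y _; exact: smooth_near_id.
Qed.

(* Second countability is a parameter: a leaf inherits it from the ambient
   manifold. *)
Definition ball_manifold (sc : @second_countable rball) : manifold R k :=
  @Manifold R k rball rball_hausdorff sc rball_connected (fun=> rball_chart)
    (fun=> I) rball_compat.

End ball_manifold.

(** * Integral manifolds of the kernel of a closed 1-form *)

Section frobenius.
Variables (R : realType) (n : nat) (M : manifold R n) (eta : form1 M).
Hypothesis eta_lin : forall a, scalar (eta a).
Hypothesis eta_smooth : forall a (X : vfield M), vsmooth_at a X ->
  smooth_at a (fun b => eta b (X b)).
Hypothesis eta_closed : closed_form1 eta.
Implicit Types (p a : M).

Lemma eta_sum a (I : Type) (s : seq I) (c : I -> R) (u : I -> 'rV[R]_n) :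
  eta a (\sum_(i <- s) c i *: u i) = \sum_(i <- s) c i * eta a (u i).
Proof.
have eta0 : eta a 0 = 0.
  by have := eta_lin a (-1) 0 0; rewrite scaler0 addr0 mulN1r addNr.
elim: s => [|i s IH]; first by rewrite !big_nil.
by rewrite !big_cons eta_lin IH.
Qed.

Definition covector p (z : 'rV[R]_n) : 'rV[R]_n :=
  \row_i eta (uncoord p z) (const_field p (delta_mx 0 i) (uncoord p z)).

Lemma eta_const_field p a v : mdom p a ->
  eta a (const_field p v a) = pairing (covector p (coord p a)) v.
Proof.
move=> pa; rewrite {1}[v]row_sum_delta /const_field linear_sum.
under eq_bigr do rewrite linearZ /=.
rewrite eta_sum /pairing; apply: eq_bigr => i _.
by rewrite mxE coordK// mulrC.
Qed.

Lemma covector_smooth p : smooth_near (coord p p) (covector p).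
Proof.
apply/smooth_near_row => i.
have := eta_smooth (vsmooth_const_field (delta_mx 0 i) (mdom_self p)).
by apply: smooth_near_eq; near=> z; rewrite mxE.
Unshelve. all: by end_near. Qed.

(** [d eta] evaluated on two commuting coordinate fields is the difference of these partial
    derivatives. *)
Lemma covector_closed p : \forall z \near coord p p, forall i j,
  'd (fun y => covector p y 0 i) z (delta_mx 0 j)
  = 'd (fun y => covector p y 0 j) z (delta_mx 0 i).
Proof.
have pp := mdom_self p.
have H := near_uncoord pp (mdom_near pp); have H' := uncoordK pp.
near=> z => i j.
have pa : mdom p (uncoord p z) by near: z; exact: H.
have zE : coord p (uncoord p z) = z by near: z; exact: H'.
have sE s : vsmooth_at (uncoord p z) (const_field p s) by exact: vsmooth_const_field.
have := eta_closed (sE (delta_mx 0 j)) (sE (delta_mx 0 i)).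
rewrite /dform1 lie_const_field//.
have -> : eta (uncoord p z) 0 = 0.
  by have := eta_lin (uncoord p z) (-1) 0 0; rewrite scaler0 addr0 mulN1r addNr.
rewrite subr0 => /subr0_eq.
rewrite (vder_const_field _ pa (eta_smooth (sE (delta_mx 0 i)))).
rewrite (vder_const_field _ pa (eta_smooth (sE (delta_mx 0 j)))) zE.
have E l : (fun y => covector p y 0 l) = (fun b => eta b (const_field p (delta_mx 0 l) b)) \o uncoord p.
  by apply/funext => y; rewrite mxE.
by rewrite !E.
Unshelve. all: by end_near. Qed.

Section leaf.
Variables (p : M) (e : 'rV[R]_n).
Hypothesis eta_e : eta p e = 1.
Let z0 := coord p p.
Let c := covector p.

(** The dimension of the leaf, in fact [n - 1] as [eta] does not vanish at [p]. Kept as a rank, it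
    is the number of rows of the basis [A] of the kernel. *)
Let k := \rank (kermx (c z0)^T).
Let A : 'M[R]_(k, n) := row_base (kermx (c z0)^T).

Lemma pairing_ce : pairing (c z0) e = 1.
Proof. by rewrite -eta_const_field ?const_field_self//; exact: mdom_self. Qed.

Lemma kernelP (v : 'rV[R]_n) : (v <= A)%MS = (pairing (c z0) v == 0).
Proof.
have -> : pairing (c z0) v = (v *m (c z0)^T) 0 0.
  by rewrite mxE; apply: eq_bigr => i _; rewrite !mxE mulrC.
rewrite eq_row_base sub_kermx; apply/eqP/eqP => [->|H]; first by rewrite mxE.
by apply/matrixP => i j; rewrite !ord1 H mxE.
Qed.

Lemma kernel_row (v : 'rV[R]_k) : pairing (c z0) (v *m A) = 0.
Proof. by apply/eqP; rewrite -kernelP submxMl. Qed.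

(* The level sets of a primitive of [eta], as graphs over [ker (eta p)]. *)
Lemma level_chart : exists (h : 'rV[R]_k -> R) (r : R),
  [/\ 0 < r, h 0 = 0 & forall y, `|y| < r ->
   let z := h y *: e + (y *m A + z0) in
   [/\ mdom p (uncoord p z), coord p (uncoord p z) = z, smooth_near y h,
     pairing (c z) e != 0 &
     forall v, 'd h y v * pairing (c z) e = - pairing (c z) (v *m A)]].
Proof.
have pp := mdom_self p.
have [f fP] := poincare_lemma (covector_smooth p) (covector_closed p).
have sc := smooth_near_open (covector_smooth p).
have spair z (u : 'rV[R]_n) : smooth_near z c -> smooth_near z (fun y => pairing (c y) u).
  move=> /smooth_near_row s; apply: smooth_near_sum => i.
  exact: (smooth_near_mul (s i) (smooth_near_cst _ _)).
have ce0 : \forall z \near z0, 0 < pairing (c z) e.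
  have ct : {for z0, continuous (fun z => pairing (c z) e)}.
    exact/differentiable_continuous/smooth_near_differentiable/spair/covector_smooth.
  apply: (cvgr_gt _ ct); by rewrite pairing_ce.
(* The gradient of the primitive, rescaled so as to pair to 1 with [e]. It inherits its smoothness
   from [eta]. *)
pose q z := (pairing (c z) e)^-1 *: c z.
have sq z : smooth_near z c -> pairing (c z) e != 0 -> smooth_near z q.
  move=> s nz; apply/smooth_near_row => i.
  have := smooth_near_mul (@smooth_near_inv _ _ z (fun y => pairing (c y) e) nz (spair z e s))
    (iffLR (smooth_near_row _ _) s i).
  rewrite [X in _ -> smooth_near z X](_ : _ = fun y => (pairing (c y) e)^-1 * c y 0 i)//.
  by apply/funext => y; rewrite mxE.
have qz0 : smooth_near z0 q by apply: sq; [exact: covector_smooth|rewrite pairing_ce oner_eq0].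
have [K qK] := @local_bound _ _ 'I_n (fun i z => q z 0 i) z0
  (fun i => differentiable_continuous (smooth_near_differentiable (iffLR (smooth_near_row _ _) qz0 i))).
have nd := near_uncoord pp (mdom_near pp); have nk := uncoordK pp.
have nG : \forall z \near z0, [/\ differentiable f z /\ 'd f z = pairing (c z) :> (_ -> _),
    smooth_near z c, 0 < pairing (c z) e, forall i, `|q z 0 i| <= K &
    mdom p (uncoord p z) /\ coord p (uncoord p z) = z].
  near=> z; split.
  - by near: z; exact: fP.
  - by near: z; exact: sc.
  - by near: z; exact: ce0.
  - by near: z; exact: qK.
  - by split; near: z; [exact: nd|exact: nk].
move: nG => /nbhs_ballP[r /= r0 rG].
have GP z : `|z - z0| < r -> [/\ differentiable f z /\ 'd f z = pairing (c z) :> (_ -> _),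
    smooth_near z c, 0 < pairing (c z) e, forall i, `|q z 0 i| <= K &
    mdom p (uncoord p z) /\ coord p (uncoord p z) = z].
  by move=> zr; apply: rG; rewrite -ball_normE /ball_ /= distrC.
have pq z u : pairing (q z) u = (pairing (c z) e)^-1 * pairing (c z) u.
  by rewrite /pairing mulr_sumr; apply: eq_bigr => i _; rewrite mxE mulrA.
have dfv z u : `|z - z0| < r -> 'd f z u = pairing (c z) u.
  by move=> /GP[[_ E] _ _ _ _]; exact: (congr1 (fun g => g u) E).
have H1 z : `|z - z0| < r -> differentiable f z by move=> /GP[[]].
have H2 z : `|z - z0| < r -> 0 < 'd f z e.
  by move=> zr; rewrite dfv//; have [] := GP z zr.
have H3 z u : `|z - z0| < r -> 'd f z u = 'd f z e * pairing (q z) u.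
  by move=> zr; rewrite !dfv// pq mulVKf//; have [_ _ + _ _] := GP z zr; move/gt_eqF->.
have H4 z : `|z - z0| < r -> pairing (q z) e = 1.
  by move=> zr; rewrite pq mulVf//; have [_ _ + _ _] := GP z zr; move/gt_eqF->.
have H5 z : `|z - z0| < r -> smooth_near z q.
  by move=> /GP[_ s + _ _] => /gt_eqF nz; apply: sq => //; rewrite nz.
have H6 z i : `|z - z0| < r -> `|q z 0 i| <= K by move=> /GP[].
have [h [a [a0 h0 ha]]] := implicit_graph A r0 H1 H2 H3 H4 H5 H6.
exists h, a; split; [exact: a0|exact: h0|] => y ya.
set z := h y *: e + (y *m A + z0); have [zr sh dh] := ha y ya.
have [_ _ cz _ [dz kz]] := GP z zr; split=> //; first by rewrite gt_eqF.
by move=> v; rewrite dh pq mulNr mulrC mulVKf// gt_eqF.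
Unshelve. all: by end_near. Qed.

Lemma const_field_inj a : mdom p a ->
  injective (fun u : 'rV[R]_n => const_field p u a).
Proof.
move=> pa u v uv; apply/rowP => i.
by rewrite -(vder_coord u i pa) -(vder_coord v i pa) uv.
Qed.

(** The graph of [h] over a ball, carried to [M] by the inverse chart. A continuous left inverse
    [rho] of the parametrization gives both injectivity and the second countability of the ball. *)
Lemma integral_leaf : exists (L : manifold R k) (j : L -> M) (l0 : L),
  integral_manifold (screen eta) j /\ j l0 = p.
Proof.
have [h [r [r0 h0 H]]] := level_chart.
pose z y := h y *: e + (y *m A + z0).
pose j0 (l : [set y : 'rV[R]_k | `|y| < r]) : M := uncoord p (z (rball_val l)).
have dj l : mdom p (j0 l) by have [] := H _ (rball_valP l).
have zj l : coord p (j0 l) = z (rball_val l) by have [] := H _ (rball_valP l).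
have sz y : `|y| < r -> smooth_near y z.
  move=> yr; have [_ _ sh _ _] := H y yr.
  apply: smooth_near_add (smooth_affine A z0 y).
  apply/smooth_near_row => i.
  rewrite (_ : (fun y => _) = fun y => h y * e 0 i); last by apply/funext => y'; rewrite mxE.
  exact: (smooth_near_mul sh (smooth_near_cst _ _)).
have dz y v : `|y| < r -> 'd z y v = 'd h y v *: e + v *m A.
  move=> yr; have [_ _ sh _ _] := H y yr; have dz := smooth_near_differentiable (sz y yr).
  apply/rowP => i; rewrite (diff_row _ _ dz).
  have -> : ('d h y v *: e + v *m A) 0 i = 'd h y v * e 0 i + (v *m A) 0 i by rewrite !mxE.
  have dh := smooth_near_differentiable sh.
  have dA : is_diff y (fun y => (y *m A + z0) 0 i) (fun v => (v *m A) 0 i).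
    rewrite (_ : (fun y => (y *m A + z0) 0 i) = fun y => (@rcoord R n i \o mulmxr A) y + z0 0 i); last first.
      by apply/funext => y'; rewrite mxE.
    apply: is_diff_shift.
    have cA : continuous (@rcoord R n i \o mulmxr A).
      move=> y'; apply: continuous_comp; [exact: mulmxr_continuous|exact: rcoord_continuous].
    apply: DiffDef; first exact: linear_differentiable.
    by rewrite diff_lin.
  have dhe : differentiable (fun y => h y * e 0 i) y by exact: differentiableM.
  have E1 : 'd (fun y => h y * e 0 i) y v = 'd h y v * e 0 i.
    apply: (etrans (diffME v dh (differentiable_cst (e 0 i) y))).
    have -> : 'd (cst (e 0 i)) y v = 0 by rewrite diff_cst.
    by rewrite mulr0 add0r mulrC.
  have E2 : 'd (fun y => (y *m A + z0) 0 i) y v = (v *m A) 0 i.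
    exact: (congr1 (fun g => g v) (@diff_val _ _ _ _ _ _ _ dA)).
  have zE : (fun y => z y 0 i) = fun y => h y * e 0 i + (y *m A + z0) 0 i.
    by apply/funext => y'; rewrite !mxE.
  rewrite zE.
  exact: (etrans (diffDE v dhe (@ex_diff _ _ _ _ _ _ _ dA)) (congr2 +%R E1 E2)).
(* The first factor projects along [e] onto the kernel of [c z0], which removes the height [h y];
   [pinvmx A] then reads the coordinates in the basis [A]. *)
pose Q := (1%:M - (c z0)^T *m e) *m pinvmx A.
pose rho (a : M) : 'rV[R]_k := coord p a *m Q + (- z0) *m Q.
have rfA : row_free A by exact: row_base_free.
have pairing_combination (s : R) w : pairing (c z0) (s *: e + w *m A) = s.
  by rewrite linearD linearZ /= kernel_row addr0 pairing_ce; exact: mulr1.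
have rhoj l : rho (j0 l) = rball_val l.
  set y := rball_val l.
  set u := h y *: e + y *m A.
  have uc : u *m (c z0)^T = (h y)%:M.
    apply/matrixP => i i'; rewrite !ord1 [RHS]mxE eqxx mulr1n -[RHS](pairing_combination _ y) mxE.
    by apply: eq_bigr => l' _; rewrite [X in _ * X]mxE mulrC.
  have uQ : u *m (1%:M - (c z0)^T *m e) = y *m A.
    rewrite mulmxBr mulmx1 (mulmxA u) uc mul_scalar_mx /u.
    by rewrite addrC addrA [- _ + _]addrC subrr add0r.
  rewrite /rho zj -/y -mulmxDl.
  have -> : z y - z0 = u by rewrite /z addrA addrK.
  by rewrite /Q (mulmxA u) uQ mulmxKp.
have rho_cont l : {for j0 l, continuous rho}.
  have cc : {for j0 l, continuous (coord p)} by exact: (@chart_map_cont _ _ _ (chart_at p) (j0 l) (dj l)).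
  have cL := differentiable_continuous (smooth_near_differentiable (smooth_affine Q (- z0 *m Q) (coord p (j0 l)))).
  exact: (continuous_comp cc cL).
have jcont l : {for l, continuous j0}.
  have c1 : {for rball_val l, continuous z}.
    exact/differentiable_continuous/smooth_near_differentiable/sz/rball_valP.
  have c2 : {for z (rball_val l), continuous (uncoord p)}.
    by rewrite -zj; exact: (@chart_inv_cont _ _ _ (chart_at p) (j0 l) (dj l)).
  exact: (continuous_comp (continuous_comp (@rball_val_continuous R k r l) c1) c2).
have jc : continuous j0 by move=> l; exact: jcont.
(* Preimages under [j0] of a countable basis of [M] form a basis: thanks to [rho], every open set of
   the ball around a point contains such a preimage. *)
have sc : @second_countable [set y : 'rV[R]_k | `|y| < r].
  have [Bs cB [oB nB]] := @manifold_countable R n M.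
  exists ((fun b => j0 @^-1` b) @` Bs); first exact: card_le_trans (card_image_le _ _) cB.
  split=> [_ [b Bb <-]|l O].
    by apply: open_comp; [move=> l _; exact: jc|exact: oB].
  move=> /rball_nbhsP[W oW sO].
  have nW : nbhs (j0 l) (rho @^-1` W).
    by apply: rho_cont; rewrite rhoj; exact: open_nbhs_nbhs.
  have [b [Bb bl] sb] := nB _ _ nW.
  exists (j0 @^-1` b); first by split=> //; exists b.
  by move=> l' /= bl'; apply: sO; rewrite /preimage/= -rhoj; exact: sb.
pose L := ball_manifold r0 sc.
have zr y : `|y| < r -> rball_val (rball_inv r0 y) = y by exact: rball_valK.
have smj : smooth_map (j0 : L -> M).
  split; first exact: jc.
  move=> l; have ll := dj l; have tr := transition_smooth ll (mdom_self (j0 l)).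
  rewrite zj in tr.
  have S := smooth_near_comp_row (sz _ (rball_valP l)) tr.
  apply: smooth_near_eq S.
  have nr : nbhs (rball_val l) [set y : 'rV[R]_k | `|y| < r].
    by apply: open_nbhs_nbhs; split; [exact: rball_open|exact: rball_valP].
  by apply: filterS nr => y yr; rewrite /= /j0 /uncoord /= zr.
have tj l v : tmap (j0 : L -> M) l v = const_field p ('d z (rball_val l) v) (j0 l).
  rewrite /const_field zj.
  have dtr := transition_smooth (dj l) (mdom_self (j0 l)); rewrite zj in dtr.
  set F := coord (j0 l) \o uncoord p in dtr *.
  transitivity ('d (fun y => F (z y)) (rball_val l) v); last first.
    apply: diff_compE; first exact/smooth_near_differentiable/sz/rball_valP.
    exact: smooth_near_differentiable.
  have nr : nbhs (rball_val l) [set y : 'rV[R]_k | `|y| < r].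
    by apply: open_nbhs_nbhs; split; [exact: rball_open|exact: rball_valP].
  have H' : \forall y \near rball_val l, (coord (j0 l) \o (j0 : L -> M) \o rball_inv r0) y = F (z y).
    by apply: filterS nr => y yr; rewrite /= /j0 zr.
  exact: (congr1 (fun g => g v) (near_eq_diff H')).
exists L, j0, (rball_inv r0 0); split; last first.
  by rewrite /j0 zr ?rball_center// /z h0 scale0r mul0mx !add0r coordK//; exact: mdom_self.
split.
- split; first exact: smj.
  move=> l u v; rewrite !tj => /(const_field_inj (dj l)).
  have yr := rball_valP l; rewrite !dz// => E.
  have := congr1 (pairing (c z0)) E; rewrite !pairing_combination => Eh.
  by move: E; rewrite Eh => /addrI/(row_free_inj rfA).
- move=> l l' ll'; apply: val_inj.
  by rewrite -[LHS]rhoj -[RHS]rhoj ll'.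
- move=> l; have yr := rball_valP l; have [_ _ _ ce hv] := H _ yr.
  have etaj w : eta (j0 l) (const_field p w (j0 l)) = pairing (c (z (rball_val l))) w.
    exact: (etrans (eta_const_field w (dj l)) (congr1 (fun y => pairing (c y) w) (zj l))).
  apply/seteqP; split=> [_ [v _ <-]|w sw].
    apply: (etrans (congr1 (eta (j0 l)) (tj l v))); apply: (etrans (etaj _)).
    rewrite (dz _ _ yr) linearD linearZ /=.
    by apply/eqP; rewrite addr_eq0; apply/eqP; exact: hv.
  have wE := const_field_inv w (dj l).
  set w' := 'd _ _ w in wE.
  have pw : pairing (c (z (rball_val l))) w' = 0 by rewrite -etaj wE.
  (* For the converse inclusion, the components of a screen vector split as [s *: e + v *m A]. Being
     annihilated by [eta] at the current point forces [s] to be the derivative of [h] along [v], so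
     the vector is tangent to the graph. *)
  pose s := pairing (c z0) w'.
  have : ((w' - s *: e) <= A)%MS.
    rewrite kernelP linearB linearZ /= pairing_ce -/s.
    by rewrite [s *: 1]mulr1 subrr.
  move=> /submxP[v vE].
  have w'E : w' = s *: e + v *m A by rewrite -vE addrC subrK.
  have sv : 'd h (rball_val l) v = s.
    move: pw; rewrite w'E linearD linearZ /= => /eqP.
    by rewrite addr_eq0 -hv => /eqP /(mulIf ce).
  exists v; first by [].
  by rewrite tj (dz _ _ yr) sv -w'E wE.
Qed.

End leaf.

(** One small integral manifold through [p] suffices: [alpha] is constant along it, and its tangent
    space at [p] is the whole screen. *)
Lemma constant_on_leaves_vder (alpha : M -> R) p e w : eta p e = 1 ->
  smooth_at p alpha -> constant_on_leaves (screen eta) alpha ->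
  screen eta p w -> vder p w alpha = 0.
Proof.
move=> pe sa cst_a sw; have [L [j [l0 [Lj jp]]]] := integral_leaf pe.
have aj l : alpha (j l) = alpha p.
  apply: (cst_a p); exists _, L, j; split=> //; try by exists l.
  - by exists l0.
  - by exists l0.
  - by exists l0.
have [v _ vw] : range (tmap j l0) w by rewrite (intm_tan Lj) jp.
have sa' : smooth_at (j l0) alpha by rewrite jp.
transitivity (vder (j l0) (tmap j l0 v) alpha); first by rewrite vw jp.
rewrite (vder_tmap (imm_smooth (intm_imm Lj)) v sa').
have -> : alpha \o j = fun=> alpha p by apply/funext => l; exact: aj.
exact: vder_cst.
Qed.

End frobenius.

(** The zeros stand for the products of [N] and [xi] with a screen vector; [u] and [v] are the
    derivatives of [B] and [h] which they remove. *)
Lemma second_derivative_regroup (R : comNzRingType) (D b a t h B0 u v : R) :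
  D + -1 * (u * 0 + b * (- a + t * 0)) + (v * 0 + h * - B0)
  = D + b * a - h * B0.
Proof. by ring. Qed.

(** * Rigged null hypersurfaces and the associated metric *)

Section null_geometry.
Variables (R : realType) (n : nat) (Mb : manifold R n.+1) (gb : form2 Mb).
Variables (Db : cov Mb) (M : manifold R n) (x : M -> Mb) (Dx : cov_along M Mb).
Variables (N : vfield Mb) (xi : vfield M) (nabla nablaS : cov M).
Variables (B C : form2 M) (AN Axi : M -> 'rV[R]_n -> 'rV[R]_n) (tau : form1 M).
Variables (alpha : M -> R) (Da : cov M).
Let g := pull_metric x gb.
Let eta := rig_form gb x N.
Let ga := assoc_metric g eta alpha.
Local Notation dx := (tmap x).

Hypothesis imm : immersion x.
Hypothesis gb_lin : forall b s, scalar (gb b s).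
Hypothesis gb_sym : forall b s t, gb b s t = gb b t s.
Hypothesis gb_smooth : forall b (X Y : vfield Mb), vsmooth_at b X ->
  vsmooth_at b Y -> smooth_at b (fun c => gb c (X c) (Y c)).
Hypothesis gb_nondeg : forall b, ~ degenerate (gb b).
Hypothesis lcb : levi_civita gb Db.
Hypothesis pull : pullback_connection x Db Dx.
Hypothesis N_smooth : forall p, vsmooth_at (x p) N.
Hypothesis N_transverse : forall p, ~ range (dx p) (N (x p)).
Hypothesis N_null : forall p, gb (x p) (N (x p)) (N (x p)) = 0.
Hypothesis rf : rigged_field gb x N xi.
Hypothesis gw :
  gauss_weingarten x Dx N eta xi nabla nablaS B C AN Axi tau.
Hypothesis eta_closed : closed_form1 eta.
Hypothesis alpha_smooth : forall p, smooth_at p alpha.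
Hypothesis alpha_neq0 : forall p, alpha p != 0.
Hypothesis dalpha_screen : forall p u, screen eta p u -> vder p u alpha = 0.
Hypothesis lca : levi_civita ga Da.

Implicit Types (p a : M) (u v w r : 'rV[R]_n) (X Y Z : vfield M).

Let smx := imm_smooth imm.
Let connb := lc_conn lcb.
Let connDx := pull_conn pull.
Let conna := lc_conn lca.
Let gbDr := metricDr gb_lin.
Let gbZr := metricZr gb_lin.
Let gbDl := metricDl gb_lin gb_sym.
Let gbZl := metricZl gb_lin gb_sym.

Lemma gbNl b s t : gb b (- s) t = - gb b s t.
Proof. by rewrite -scaleN1r gbZl mulN1r. Qed.

Lemma dxD p u v : dx p (u + v) = dx p u + dx p v.
Proof. by rewrite /tmap linearD. Qed.

Lemma dxZ p c u : dx p (c *: u) = c *: dx p u.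
Proof. by rewrite /tmap linearZ. Qed.

Lemma dxN p u : dx p (- u) = - dx p u.
Proof. by rewrite /tmap linearN. Qed.

Lemma etaD p u v : eta p (u + v) = eta p u + eta p v.
Proof. by rewrite /eta /rig_form dxD gbDr. Qed.

Lemma etaZ p c u : eta p (c *: u) = c * eta p u.
Proof. by rewrite /eta /rig_form dxZ gbZr. Qed.

Lemma etaN p u : eta p (- u) = - eta p u.
Proof. by rewrite -scaleN1r etaZ mulN1r. Qed.

Lemma eta_xi p : eta p (xi p) = 1.
Proof. by rewrite /eta /rig_form gb_sym (rf_norm rf). Qed.

Lemma g_xi p v : g p (xi p) v = 0.
Proof. exact: (rf_radical rf). Qed.

Lemma g_sym p u v : g p u v = g p v u.
Proof. by rewrite /g /pull_metric gb_sym. Qed.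

Lemma gDl p u v w : g p (u + v) w = g p u w + g p v w.
Proof. by rewrite /g /pull_metric dxD gbDl. Qed.

Lemma gZl p c u w : g p (c *: u) w = c * g p u w.
Proof. by rewrite /g /pull_metric dxZ gbZl. Qed.

Lemma gNl p u w : g p (- u) w = - g p u w.
Proof. by rewrite -scaleN1r gZl mulN1r. Qed.

Lemma gDr p u v w : g p w (u + v) = g p w u + g p w v.
Proof. by rewrite g_sym gDl !(g_sym p w). Qed.

Lemma gaDl p u v w : ga p (u + v) w = ga p u w + ga p v w.
Proof. by rewrite /ga /assoc_metric gDl etaD; ring. Qed.

Lemma gaZl p c u w : ga p (c *: u) w = c * ga p u w.
Proof. by rewrite /ga /assoc_metric gZl etaZ; ring. Qed.

Lemma gaNl p u w : ga p (- u) w = - ga p u w.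
Proof. by rewrite -scaleN1r gaZl mulN1r. Qed.

Lemma ga_sym p u v : ga p u v = ga p v u.
Proof. by rewrite /ga /assoc_metric g_sym; congr (_ + _ * _); rewrite mulrC. Qed.

Lemma ga_screen p u w : screen eta p w -> ga p u w = g p u w.
Proof. by rewrite /screen/= /ga /assoc_metric => ->; rewrite !mulr0 addr0. Qed.

(** Dimension count: the image of [dx p] has dimension [n] and does not contain [N], so the two
    together fill the space. *)
Lemma transverse_decomposition p (s : 'rV[R]_n.+1) :
  exists u c, s = dx p u + c *: N (x p).
Proof.
pose L := 'd (coord (x p) \o x \o uncoord p) (coord p p).
pose A : 'M[R]_(n, n.+1) := lin1_mx L.
have AE u : u *m A = dx p u by exact: mul_rV_lin1.
have kA : kermx A = 0.
  apply/row_matrixP => i; rewrite row0; apply: (imm_inj imm (p := p)).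
  by rewrite -!AE -row_mul mulmx_ker row0 mul0mx.
have rA : \rank A = n by apply/eqP; rewrite -[_ == _]/(row_free A) -kermx_eq0 kA.
have NA : ~~ (N (x p) <= A)%MS.
  by apply/negP => /submxP[u uE]; apply: (@N_transverse p); exists u => //; rewrite -AE.
have full : row_full (A + N (x p))%MS.
  rewrite -col_leq_rank -[in X in (X < _)%N]rA.
  apply: rank_ltmx; rewrite ltmxE addsmxSl /=; apply: contra NA => H.
  by apply: submx_trans H; exact: addsmxSr.
have /sub_addsmxP[[u c] /= sE] := submx_full s full.
exists u, (c 0 0); rewrite -AE {1}sE; congr (_ + _).
by rewrite [in LHS](mx11_scalar c) mul_scalar_mx.
Qed.

Lemma dx_inj p : injective (dx p).
Proof. exact: (imm_inj imm). Qed.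

(** A tangent vector orthogonal to TM and to [N] is orthogonal to the whole ambient tangent space,
    where [gb] is nondegenerate. *)
Lemma nondegenerate_radical p u : (forall w, g p u w = 0) -> eta p u = 0 -> u = 0.
Proof.
move=> gu eu; apply: (@dx_inj p); have [/eqP->|u0] := boolP (dx p u == 0).
  by rewrite /tmap linear0.
case: (@gb_nondeg (x p)); exists (dx p u) => // s.
have [w [c ->]] := transverse_decomposition p s.
rewrite gbDr gbZr -[gb _ _ (dx p w)]/(g p u w) gu.
by rewrite gb_sym -[gb _ _ _]/(eta p u) eu mulr0 addr0.
Qed.

Lemma screen_xi p w : screen eta p (w - eta p w *: xi p).
Proof. by rewrite /screen/= etaD etaN etaZ eta_xi mulr1 subrr. Qed.

Lemma radical_direction p u : (forall w, screen eta p w -> g p u w = 0) ->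
  u = eta p u *: xi p.
Proof.
move=> gu; apply/eqP; rewrite -subr_eq0; apply/eqP.
apply: (@nondegenerate_radical p); last first.
  by rewrite etaD etaN etaZ eta_xi mulr1 subrr.
move=> w; rewrite gDl gNl gZl g_xi mulr0 oppr0 addr0.
have := gu _ (screen_xi p w).
by rewrite gDr -scaleNr [g p u (_ *: _)]g_sym gZl g_xi mulr0 addr0.
Qed.

Lemma tangent_smooth p X : vsmooth_at p X ->
  vsmooth_along_at x p (fun a => dx a (X a)).
Proof. exact: vsmooth_along_tmap. Qed.

Lemma N_along p : vsmooth_along_at x p (N \o x).
Proof. by apply: vsmooth_along_comp => //; exact: N_smooth. Qed.

Lemma gb_compatible p u (Y Z : M -> 'rV[R]_n.+1) :
  vsmooth_along_at x p Y -> vsmooth_along_at x p Z -> metric_compatible x Dx gb p u Y Z.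
Proof. exact: (pull_compatible smx pull gb_lin gb_sym gb_smooth (lc_metric lcb)). Qed.

Lemma gauss_formula p u Y : vsmooth_at p Y ->
  Dx p u (fun a => dx a (Y a)) = dx p (nabla p u Y) + B p u (Y p) *: N (x p).
Proof. exact: (gw_gauss gw). Qed.

Lemma gb_gauss p u Y w : vsmooth_at p Y ->
  gb (x p) (Dx p u (fun a => dx a (Y a))) (dx p w)
  = g p (nabla p u Y) w + B p u (Y p) * eta p w.
Proof. by move=> sY; rewrite gauss_formula// gbDl gbZl. Qed.

(** Pairing the Gauss formula with [xi] kills its tangent part and leaves [B], as [gb (xi, N) = 1].
    All properties of [B] are drawn from this ambient expression. *)
Lemma B_gauss p u Y : vsmooth_at p Y ->
  B p u (Y p) = gb (x p) (Dx p u (fun a => dx a (Y a))) (dx p (xi p)).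
Proof. by move=> sY; rewrite gb_gauss// g_sym g_xi eta_xi add0r mulr1. Qed.

Lemma eta_nabla p u Y : vsmooth_at p Y ->
  gb (x p) (N (x p)) (Dx p u (fun a => dx a (Y a))) = eta p (nabla p u Y).
Proof. by move=> sY; rewrite gauss_formula// gbDr gbZr N_null mulr0 addr0. Qed.

(* [(nabla_u eta) w], see [vder_eta]. *)
Definition deta p u w : R := - g p (AN p u) w + tau p u * eta p w.

Lemma gb_weingarten p u w : gb (x p) (Dx p u (N \o x)) (dx p w) = deta p u w.
Proof. by rewrite (gw_weingarten gw) gbDl gbZl gbNl. Qed.

Lemma eta_smooth p Y : vsmooth_at p Y -> smooth_at p (fun a => eta a (Y a)).
Proof. by move=> sY; exact: (gb_compatible 0 (@N_along p) (tangent_smooth sY)).1. Qed.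

(** Compatibility of [Dx] with [gb], applied to [N] and [Y]; [N] being null removes the [B] term. *)
Lemma vder_eta p u Y : vsmooth_at p Y ->
  vder p u (fun a => eta a (Y a)) = deta p u (Y p) + eta p (nabla p u Y).
Proof.
move=> sY; rewrite -gb_weingarten -eta_nabla//.
exact: (gb_compatible u (@N_along p) (tangent_smooth sY)).2.
Qed.

Lemma Dx_torsion p X Y : vsmooth_at p X -> vsmooth_at p Y ->
  Dx p (X p) (fun a => dx a (Y a)) - Dx p (Y p) (fun a => dx a (X a))
  = dx p (lie X Y p).
Proof. exact: (pull_torsion smx connb pull (lc_torsion_free lcb)). Qed.

Lemma B_sym p X Y : vsmooth_at p X -> vsmooth_at p Y ->
  B p (X p) (Y p) = B p (Y p) (X p).
Proof.
move=> sX sY; apply/eqP; rewrite -subr_eq0 !B_gauss// -gbNl -gbDl Dx_torsion//.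
by rewrite -[gb _ _ _]/(g p _ _) g_sym g_xi.
Qed.

Lemma nabla_torsion p X Y : vsmooth_at p X -> vsmooth_at p Y ->
  nabla p (X p) Y - nabla p (Y p) X = lie X Y p.
Proof.
move=> sX sY; apply: (@dx_inj p); rewrite -Dx_torsion// !gauss_formula//.
by rewrite dxD dxN (B_sym sX sY) opprD addrACA subrr addr0.
Qed.

(** For a torsion-free connection, the antisymmetric part of [nabla eta] is [d eta]. *)
Lemma deta_sym p X Y : vsmooth_at p X -> vsmooth_at p Y ->
  deta p (X p) (Y p) = deta p (Y p) (X p).
Proof.
move=> sX sY; apply/eqP; rewrite -subr_eq0 -(eta_closed sX sY) /dform1.
by rewrite !vder_eta// -nabla_torsion// etaD etaN; apply/eqP; ring.
Qed.

Lemma vder_alpha p u : vder p u alpha = vder p (xi p) alpha * eta p u.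
Proof.
apply/eqP; rewrite -subr_eq0 mulrC -vderZ -vderB; apply/eqP.
exact: (dalpha_screen (screen_xi p u)).
Qed.

(* [(nabla_u ga) (y, z)], see [vder_ga]. *)
Definition dga p (u y z : 'rV[R]_n) : R :=
  B p u y * eta p z + B p u z * eta p y + vder p u alpha * (eta p y * eta p z)
  + alpha p * (deta p u y * eta p z + eta p y * deta p u z).

(** [nabla] is not metric even for [g]: the component of the Gauss formula along [N] leaves the two
    terms in [B]. *)
Lemma vder_ga p u Y Z : vsmooth_at p Y -> vsmooth_at p Z ->
  vder p u (fun a => ga a (Y a) (Z a)) =
  ga p (nabla p u Y) (Z p) + ga p (Y p) (nabla p u Z) + dga p u (Y p) (Z p).
Proof.
move=> sY sZ; have [sg dg] := gb_compatible u (tangent_smooth sY) (tangent_smooth sZ).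
have sy := eta_smooth sY; have sz := eta_smooth sZ.
rewrite (vder_add _ sg (smooth_at_mul (alpha_smooth p) (smooth_at_mul sy sz))).
rewrite dg (vder_mul _ (alpha_smooth p) (smooth_at_mul sy sz)) (vder_mul _ sy sz).
rewrite !vder_eta// gb_gauss// gb_sym gb_gauss// /ga /assoc_metric /dga.
by rewrite (g_sym p (Y p)); ring.
Qed.

Definition dconn p u Y : 'rV[R]_n := Da p u Y - nabla p u Y.

Lemma ga_dconn p u Y Z : vsmooth_at p Y -> vsmooth_at p Z ->
  ga p (dconn p u Y) (Z p) + ga p (Y p) (dconn p u Z) = dga p u (Y p) (Z p).
Proof.
move=> sY sZ; have := lc_metric lca u sY sZ; rewrite vder_ga// /dconn.
by rewrite gaDl gaNl !(ga_sym p (Y p)) gaDl gaNl => H; rewrite addrACA -H; ring.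
Qed.

Lemma dconn_sym p X Y : vsmooth_at p X -> vsmooth_at p Y ->
  dconn p (X p) Y = dconn p (Y p) X.
Proof.
move=> sX sY; apply/eqP; rewrite -subr_eq0 /dconn opprD addrACA -opprD.
by rewrite (lc_torsion_free lca)// nabla_torsion// subrr.
Qed.

(** This is [alpha * h], where [Da = nabla + h xi]. *)
Definition dconn_coef p u w : R :=
  B p u w + alpha p * deta p u w + 2^-1 * vder p (xi p) alpha * (eta p u * eta p w).

(** The usual alternating sum over the three arguments. As [B], [deta] and the difference tensor are
    symmetric and [d alpha] is a multiple of [eta], all terms cancel except those containing
    [eta p (Z p)]. *)
Lemma koszul p X Y Z : vsmooth_at p X -> vsmooth_at p Y -> vsmooth_at p Z ->
  ga p (dconn p (X p) Y) (Z p) = eta p (Z p) * dconn_coef p (X p) (Y p).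
Proof.
move=> sX sY sZ.
have E1 := ga_dconn (X p) sY sZ; have E2 := ga_dconn (Y p) sX sZ.
have E3 := ga_dconn (Z p) sX sY.
have S1 := dconn_sym sX sY; have S2 := dconn_sym sX sZ; have S3 := dconn_sym sY sZ.
rewrite -S1 in E2; rewrite -S2 -S3 [ga p (X p) _]ga_sym in E3.
rewrite [ga p (Y p) _]ga_sym in E1; rewrite [ga p (X p) _]ga_sym in E2.
suff H : 2 * ga p (dconn p (X p) Y) (Z p) = 2 * (eta p (Z p) * dconn_coef p (X p) (Y p)).
  by apply: (mulfI _ H); rewrite pnatr_eq0.
have -> : 2 * ga p (dconn p (X p) Y) (Z p) =
    dga p (X p) (Y p) (Z p) + dga p (Y p) (X p) (Z p) - dga p (Z p) (X p) (Y p).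
  by rewrite -E1 -E2 -E3; ring.
rewrite /dga /dconn_coef (B_sym sY sX) (B_sym sZ sX) (B_sym sZ sY).
rewrite (deta_sym sY sX) (deta_sym sZ sX) (deta_sym sZ sY).
rewrite (vder_alpha p (X p)) (vder_alpha p (Y p)) (vder_alpha p (Z p)).
by field.
Qed.

(** By [koszul] the difference is orthogonal to the screen, hence along [xi]; pairing with [xi],
    whose square is [alpha], gives the coefficient. *)
Lemma dconn_xi p X Y : vsmooth_at p X -> vsmooth_at p Y ->
  dconn p (X p) Y = ((alpha p)^-1 * dconn_coef p (X p) (Y p)) *: xi p.
Proof.
move=> sX sY.
have H w : ga p (dconn p (X p) Y) w = eta p w * dconn_coef p (X p) (Y p).
  have := koszul sX sY (vsmooth_const_field w (mdom_self p)).
  by rewrite const_field_self.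
rewrite [LHS](@radical_direction p) => [|w sw]; last first.
  by rewrite -ga_screen// H; move: sw; rewrite /screen/= => ->; rewrite mul0r.
congr (_ *: _); have := H (xi p); rewrite /ga /assoc_metric g_sym g_xi eta_xi add0r mul1r mulr1.
by move=> <-; rewrite mulKf.
Qed.

(** Obtained by differentiating the identity [gb (dx xi, dx w) = 0]. *)
Lemma gb_Dx_xi p u w :
  gb (x p) (Dx p u (fun a => dx a (xi a))) (dx p w) = - B p u w.
Proof.
have sw := vsmooth_const_field w (mdom_self p).
have sxi : vsmooth_at p xi by exact: (rf_smooth rf).
have [_] := gb_compatible u (tangent_smooth sxi) (tangent_smooth sw).
rewrite const_field_self [X in X = _](_ : _ = 0); last first.
  rewrite -[RHS](vder_cst p u 0); apply: vder_near_eq; near=> a.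
  exact: g_xi.
rewrite [X in _ + X]gb_sym -B_gauss// const_field_self => /eqP.
by rewrite eq_sym addr_eq0 => /eqP.
Unshelve. all: by end_near. Qed.

(** The field [Da_v w], seen in the ambient manifold, is [Z - b N + h dx xi] with [Z] the ambient
    derivative. In its derivative along [u], the terms with differentiated [b] and [h] vanish
    against [r]; the derivative of [N] contributes [AN] and that of [xi] contributes [- B]. *)
Lemma second_derivative p u v w r : screen eta p r ->
  let c := fun s => const_field p s in
  ga p (Da p u (fun a => Da a (c v a) (c w))) r =
  gb (x p) (Dx p u (fun a => Dx a (c v a) (fun b => dx b (c w b)))) (dx p r)
  + B p v w * g p (AN p u) r - (alpha p)^-1 * dconn_coef p v w * B p u r.
Proof.
move=> sr c; have er : eta p r = 0 by [].
have pp := mdom_self p.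
have sc s : vsmooth_at p (c s) by exact: vsmooth_const_field.
pose E : vfield M := fun a => Da a (c v a) (c w).
pose F : vfield M := fun a => nabla a (c v a) (c w).
pose Z := fun a => Dx a (c v a) (fun b => dx b (c w b)).
have sE : vsmooth_at p E by exact: (conn_smooth conna (sc v) (sc w)).
have sF : vsmooth_at p F by exact: (gw_nabla_smooth gw (sc v) (sc w)).
have sZ : vsmooth_along_at x p Z.
  exact: (conn_smooth connDx (sc v) (tangent_smooth (sc w))).
have sxi : vsmooth_at p xi by exact: (rf_smooth rf).
(* [b] is [B] on the fields [c v] and [c w], in a form visibly smooth by metric compatibility. *)
pose b a := gb (x a) (Z a) (dx a (xi a)).
have sb : smooth_at p b by exact: (gb_compatible 0 sZ (tangent_smooth sxi)).1.
(* Likewise, the coefficient of [xi] in the difference of the connections is read off by [eta], from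
   two smooth fields. *)
pose h a := eta a (E a) - eta a (F a).
have sh : smooth_at p h.
  exact: (smooth_at_add (eta_smooth sE) (smooth_at_opp (eta_smooth sF))).
have near_c (s : 'rV[R]_n) : \forall a \near p, vsmooth_at a (c s).
  by apply: filterS (mdom_near pp) => a; exact: vsmooth_const_field.
have H : \forall a \near p, dx a (E a) = Z a + (-1) *: (b a *: N (x a)) + h a *: dx a (xi a).
  near=> a.
  have sv : vsmooth_at a (c v) by near: a; exact: near_c.
  have sw : vsmooth_at a (c w) by near: a; exact: near_c.
  have -> : E a = F a + dconn a (c v a) (c w) by rewrite /dconn addrC subrK.
  have -> : dconn a (c v a) (c w) = h a *: xi a.
    have -> : h a = eta a (dconn a (c v a) (c w)) by rewrite /dconn etaD etaN.
    by rewrite dconn_xi// etaZ eta_xi mulr1.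
  rewrite dxD dxZ; congr (_ + _).
  by rewrite /Z /b /Z -B_gauss// gauss_formula// scaleN1r addrK.
have sb' : vsmooth_along_at x p (fun a => b a *: N (x a)).
  exact: (vsmooth_along_scale sb (@N_along p)).
have sb1 : vsmooth_along_at x p (fun a => (-1) *: (b a *: N (x a))).
  by apply: vsmooth_along_scale => //; exact: smooth_at_cst.
have sh' : vsmooth_along_at x p (fun a => h a *: dx a (xi a)).
  exact: (vsmooth_along_scale sh (tangent_smooth sxi)).
have Ep : dconn_coef p v w = alpha p * h p.
  have -> : h p = eta p (dconn p (c v p) (c w)) by rewrite /dconn etaD etaN.
  by rewrite dconn_xi// etaZ eta_xi mulr1 /c !const_field_self mulVKf.
have bp : b p = B p v w by rewrite /b /Z -B_gauss// /c !const_field_self.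
(* The outer [Da] may be replaced by [nabla]: they differ by a multiple of [xi], which is orthogonal
   to [r]. *)
have -> : ga p (Da p u E) r = g p (nabla p u E) r.
  rewrite ga_screen// -[Da p u E](subrK (nabla p u E)) gDl.
  have := dconn_xi (vsmooth_const_field u pp) sE.
  by rewrite const_field_self /dconn => ->; rewrite gZl g_xi mulr0 add0r.
have := gb_gauss u r sE; rewrite er mulr0 addr0 => <-.
rewrite (conn_near_eq connDx u H (tangent_smooth sE)).
rewrite (conn_add connDx)//; last exact: vsmooth_along_add.
rewrite (conn_add connDx)// (conn_scale connDx)//.
rewrite (conn_leibniz connDx u sb (@N_along p)) (conn_leibniz connDx u sh (tangent_smooth sxi)).
rewrite !gbDl !gbZl gbDl !gbZl gb_weingarten gb_Dx_xi /deta er.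
have gx : gb (x p) (dx p (xi p)) (dx p r) = 0 by exact: g_xi.
have gN : gb (x p) ((N \o x) p) (dx p r) = 0 by exact: er.
rewrite gx gN.
rewrite bp Ep mulKf// -/Z; exact: second_derivative_regroup.
Unshelve. all: by end_near. Qed.

Lemma curvature_comparison p u v w r : screen eta p r ->
  ga p (curv_tensor Da p u v w) r =
  gb (x p) (curv_tensor Db (x p) (dx p u) (dx p v) (dx p w)) (dx p r)
  + B p v w * g p (AN p u) r - B p u w * g p (AN p v) r
  - (alpha p)^-1 * dconn_coef p v w * B p u r + (alpha p)^-1 * dconn_coef p u w * B p v r.
Proof.
move=> sr; rewrite -(pull_curvature smx connb pull) /curv_tensor /curvature.
rewrite lie_const_field ?(conn0l conna); [|exact: vsmooth_const_field (mdom_self p)|exact: mdom_self].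
rewrite subr0 gaDl gaNl gbDl gbNl !const_field_self.
by rewrite !second_derivative//; ring.
Qed.

(** With [w = xi], [gb_Dx_xi] says that this number is its own opposite. *)
Lemma B_xi p u : B p u (xi p) = 0.
Proof.
have sxi : vsmooth_at p xi by exact: (rf_smooth rf).
have H := gb_Dx_xi p u (xi p); rewrite -B_gauss// in H.
by have : B p u (xi p) + B p u (xi p) = 0; [rewrite {1}H addNr|lra].
Qed.

Lemma B_xi_l p X : vsmooth_at p X -> B p (xi p) (X p) = 0.
Proof.
move=> sX; rewrite B_sym// ?B_xi//; exact: (rf_smooth rf).
Qed.

(** Differentiating [eta Y = 0] equates the [xi]-component of [nabla Y], which is [C], with the
    opposite of [deta], which is the [AN] product. *)
Lemma C_screen p u Y : vsmooth_at p Y -> (forall a, screen eta a (Y a)) ->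
  C p u (Y p) = g p (AN p u) (Y p).
Proof.
move=> sY Yscreen; have eY a : eta a (Y a) = 0 by exact: Yscreen.
have PY : (fun a => screen_proj eta xi a (Y a)) = Y.
  by apply/funext => a; rewrite /screen_proj eY scale0r subr0.
have := gw_gauss_screen gw u sY; have := gw_nablaS_screen gw u sY.
rewrite PY /screen_proj eY scale0r subr0 /screen /= => nS nE.
have := vder_eta u sY; rewrite nE etaD etaZ nS eta_xi add0r mulr1 /deta eY mulr0 addr0.
under eq_fun do rewrite eY.
by rewrite vder_cst addrC => /esym/subr0_eq.
Qed.

(** Since [B] vanishes on [xi], the [AN] terms and one of the [h] terms disappear. What survives is
    [h(xi, xi) B(X, X)], where [h(xi, xi) = tau(xi) + xi(alpha) / (2 alpha)]. *)
Lemma sectional_radical p X : vsmooth_at p X -> screen eta p (X p) ->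
  g p (X p) (X p) != 0 ->
  sectional ga Da p (xi p) (X p) =
    (alpha p * g p (X p) (X p))^-1 *
      (gb (x p) (curv_tensor Db (x p) (dx p (xi p)) (dx p (X p)) (dx p (xi p)))
         (dx p (X p))
       + (tau p (xi p) + (2 * alpha p)^-1 * vder p (xi p) alpha)
           * B p (X p) (X p)).
Proof.
move=> sX eX gX; have a0 := alpha_neq0 p; rewrite /sectional curvature_comparison//.
rewrite /dconn_coef /deta !B_xi (B_xi_l sX) !eta_xi.
have -> : ga p (xi p) (xi p) = alpha p.
  by rewrite /ga /assoc_metric g_xi eta_xi add0r !mulr1.
have -> : ga p (X p) (X p) = g p (X p) (X p) by rewrite ga_screen.
have -> : ga p (xi p) (X p) = 0 by rewrite ga_screen// g_xi.
have -> : g p (AN p (xi p)) (xi p) = 0 by rewrite g_sym g_xi.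
set r := gb _ _ _; set d := vder p _ _.
move: (tau p (xi p)) (B p (X p) (X p)) (g p (X p) (X p)) gX (alpha p) a0 => t b gX gX0 a a0.
by field; rewrite gX0 a0.
Qed.

(** On the screen [h = B / alpha - C]. The quadratic terms in [B] come from [B / alpha]; the mixed
    terms come in equal parts from [AN] and from [- C], which produces the factor 2. *)
Lemma sectional_screen p X Y : vsmooth_at p X -> vsmooth_at p Y ->
  (forall a, screen eta a (X a)) -> (forall a, screen eta a (Y a)) ->
  g p (X p) (Y p) = 0 -> g p (X p) (X p) != 0 -> g p (Y p) (Y p) != 0 ->
  sectional ga Da p (X p) (Y p) =
    sectional gb Db (x p) (dx p (X p)) (dx p (Y p))
    + (B p (X p) (X p) * B p (Y p) (Y p) - B p (X p) (Y p) ^+ 2)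
        / (alpha p * (g p (X p) (X p) * g p (Y p) (Y p)))
    + (2 * B p (X p) (Y p) * C p (X p) (Y p)
       - B p (X p) (X p) * C p (Y p) (Y p)
       - B p (Y p) (Y p) * C p (X p) (X p))
        / (g p (X p) (X p) * g p (Y p) (Y p)).
Proof.
move=> sX sY eX eY gXY gX gY; have a0 := alpha_neq0 p.
have eX0 : eta p (X p) = 0 by exact: eX.
have eY0 : eta p (Y p) = 0 by exact: eY.
rewrite /sectional curvature_comparison// !ga_screen//.
rewrite -![gb _ (dx p _) (dx p _)]/(g p _ _) gXY.
have dE Z W : vsmooth_at p Z -> (forall a, screen eta a (Z a)) ->
    deta p (W p) (Z p) = - C p (W p) (Z p).
  move=> sZ eZ; have eZ0 : eta p (Z p) = 0 by exact: eZ.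
  by rewrite /deta eZ0 mulr0 addr0 C_screen.
(* The symmetry of [C] on the screen, which reflects its integrability, is again closedness of
   [eta]. *)
have CYX : C p (Y p) (X p) = C p (X p) (Y p).
  by apply/oppr_inj; rewrite -(dE X Y)// -(dE Y X)// deta_sym.
rewrite -!C_screen// /dconn_coef !dE// CYX (B_sym sY sX) eX0 eY0.
set r := gb _ _ _; set c1 := C p _ _; set c2 := C p _ _; set c3 := C p _ _.
set b1 := B p (X p) (X p); set b2 := B p (X p) (Y p); set b3 := B p (Y p) (Y p).
move: (vder p _ _) => d.
move: (g p (X p) (X p)) (g p (Y p) (Y p)) gX gY (alpha p) a0 => gX gY gX0 gY0 a a0.
by field; rewrite gX0 gY0 a0.
Qed.

End null_geometry.

Theorem proposition4p4 (R : realType) (n q : nat)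
    (Mb : manifold R n.+1) (gb : form2 Mb) (Db : cov Mb)
    (M : manifold R n) (x : M -> Mb) (Dx : cov_along M Mb)
    (U : set Mb) (N : vfield Mb) (xi : vfield M)
    (nabla nablaS : cov M) (B C : form2 M)
    (AN Axi : M -> 'rV[R]_n -> 'rV[R]_n) (tau : form1 M)
    (alpha : M -> R) (Da : cov M) (X Y : vfield M)
    (g := pull_metric x gb) (eta := rig_form gb x N)
    (ga := assoc_metric g eta alpha) :
  (0 < q)%N ->
  semi_riemannian gb q ->
  levi_civita gb Db ->
  null_hypersurface gb x ->
  null_rigging gb x U N ->
  pullback_connection x Db Dx ->
  rigged_field gb x N xi ->
  gauss_weingarten x Dx N eta xi nabla nablaS B C AN Axi tau ->
  closed_form1 eta ->
  (forall p, smooth_at p alpha) ->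
  (forall p, alpha p != 0) ->
  constant_on_leaves (screen eta) alpha ->
  levi_civita ga Da ->
  vsmooth X -> vsmooth Y ->
  (forall p, screen eta p (X p)) -> (forall p, screen eta p (Y p)) ->
  (forall p, g p (X p) (Y p) = 0) ->
  (forall p, g p (X p) (X p) != 0) -> (forall p, g p (Y p) (Y p) != 0) ->
  forall p : M,
    sectional ga Da p (xi p) (X p) =
      (alpha p * g p (X p) (X p))^-1 *
        (gb (x p)
           (curv_tensor Db (x p) (tmap x p (xi p)) (tmap x p (X p))
              (tmap x p (xi p)))
           (tmap x p (X p))
         + (tau p (xi p) + (2 * alpha p)^-1 * vder p (xi p) alpha)
             * B p (X p) (X p))
  /\
    sectional ga Da p (X p) (Y p) =
      sectional gb Db (x p) (tmap x p (X p)) (tmap x p (Y p))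
      + (B p (X p) (X p) * B p (Y p) (Y p) - B p (X p) (Y p) ^+ 2)
          / (alpha p * (g p (X p) (X p) * g p (Y p) (Y p)))
      + (2 * B p (X p) (Y p) * C p (X p) (Y p)
         - B p (X p) (X p) * C p (Y p) (Y p)
         - B p (Y p) (Y p) * C p (X p) (X p))
          / (g p (X p) (X p) * g p (Y p) (Y p)).
Proof.
move=> _ sr lcb nh rig pull rf gw closed sa a0 const_a lca sX sY eX eY gXY gX gY p.
have imm := emb_imm (nh_emb nh).
have sN a : vsmooth_at (x a) N.
  by apply: (rig_smooth rig); apply: (rig_sub rig); exists a.
have eta_lin a : scalar (eta a).
  by move=> c u v; rewrite /eta /rig_form tmap_linear (sr_linear sr).
have eta_smooth a (Z : vfield M) : vsmooth_at a Z ->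
    smooth_at a (fun b => eta b (Z b)).
  exact: (eta_smooth imm (sr_linear sr) (sr_sym sr) (sr_smooth sr) lcb pull sN).
(* The hypothesis on leaves is used only through this infinitesimal form; [xi] serves as the
   transverse direction with [eta = 1] in the construction of the leaf. *)
have dalpha a u : screen eta a u -> vder a u alpha = 0.
  exact: (constant_on_leaves_vder eta_lin eta_smooth closed (eta_xi (sr_sym sr) rf a)
    (sa a) const_a).
split.
  by apply: (sectional_radical imm (sr_linear sr) (sr_sym sr) (sr_smooth sr)
    (sr_nondeg sr) lcb pull sN (rig_transverse rig) (rig_null rig) rf gw closed sa a0
    dalpha lca).
by apply: (sectional_screen imm (sr_linear sr) (sr_sym sr) (sr_smooth sr)
  (sr_nondeg sr) lcb pull sN (rig_transverse rig) (rig_null rig) rf gw closed sa a0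
  dalpha lca).
Qed.
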